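(* Let $f:\Sigma\to\mathbb{R}^4$ be a simply connected flat surface in $\mathbb{R}^4$ with flat normal bundle and regular Gauss map $\mathcal{G}$. Then there exists an immersion from $\Sigma$ into the $u,v$-plane with respect to which every special section $N$ on $\Sigma$ is a flat map whose polar map $\hat N$ is its orthonormal complement in the normal bundle $\mathfrak{X}^\perp(f)$.
   Context: All objects are smooth. A flat surface in $\mathbb{R}^4$ is an immersion whose induced metric is flat. It has flat normal bundle if its normal curvature tensor $R^\perp$ vanishes identically. $\mathfrak{X}^\perp(f)$ denotes the normal vector fields of $f$. A special section on $\Sigma$ is a unit normal vector field $N\in\mathfrak{X}^\perp(f)$ globally defined on $\Sigma$ and parallel in the normal bundle (i.e. $dN(X)$ is tangent to $f$ for every tangent field $X$), regarded as a map $N:\Sigma\to\mathbb{S}^3$. Its orthonormal complement is a unit normal field $\hat N$ with $\{N,\hat N\}$ orthonormal in the normal bundle. The Gauss map is the map $\mathcal{G}:\Sigma\to G_{2,4}$ into the Grassmannian of oriented $2$-planes of $\mathbb{R}^4$ assigning to $p$ the oriented tangent plane of $f$ at $p$; it is regular if it is an immersion. Flat map: for a smooth simply connected surface $\Sigma$, a map $F:\Sigma\to\mathbb{S}^3$ is a flat map (with respect to a given immersion of $\Sigma$ into the $u,v$-plane, called the canonical immersion, not necessarily injective) if there exist $\hat F:\Sigma\to\mathbb{S}^3$ (the polar map of $F$) and $\omega:\Sigma\to\mathbb{R}$ (the angle of $F$) such that $$\langle dF,dF\rangle=du^2+2\cos\omega\,du\,dv+dv^2,\quad \langle dF,d\hat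 F\rangle=2\sin\omega\,du\,dv,\quad \langle d\hat F,d\hat F\rangle=du^2-2\cos\omega\,du\,dv+dv^2,$$ $$\langle F,\hat F\rangle=0,\quad \langle dF,\hat F\rangle=\langle F,d\hat F\rangle=0,\quad \omega_{uv}\equiv0.$$ *)

(* Defs.v *)
From HB Require Import structures.
From mathcomp Require Import all_boot all_order all_algebra.
From mathcomp Require Import all_classical all_reals all_analysis.
Set Implicit Arguments.
Unset Strict Implicit.
Unset Printing Implicit Defensive.
Import Order.TTheory GRing.Theory Num.Theory.
Import numFieldNormedType.Exports.
Local Open Scope classical_set_scope.
Local Open Scope ring_scope.

Section Calculus.
Context {R : realType} {W : normedModType R}.
Implicit Types (h : 'rV[R]_2 -> W) (U : set 'rV[R]_2).

Definition basis_vec (i : 'I_2) : 'rV[R]_2 := delta_mx 0 i.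

Definition pd (i : 'I_2) h : 'rV[R]_2 -> W := fun x => 'd h x (basis_vec i).

Fixpoint Ck (k : nat) U h : Prop :=
  if k is k'.+1 then
    (forall x, U x -> differentiable h x) /\ forall i, Ck k' U (pd i h)
  else forall x, U x -> {for x, continuous h}.

Definition smooth_on U h : Prop := forall k, Ck k U h.

End Calculus.

(* [cmap] and [cinv] are total; only their values on [cdom] and on
   [cimg] := [cmap @` cdom] are meaningful. *)
Record chart (R : realType) (T : topologicalType) := Chart {
  cdom : set T;
  cmap : T -> 'rV[R]_2;
  cinv : 'rV[R]_2 -> T }.

Definition cimg (R : realType) (T : topologicalType) (c : chart R T) :
  set 'rV[R]_2 := cmap c @` cdom c.

Record surface (R : realType) := Surface {
  surf_sort :> topologicalType;
  surf_hausdorff : hausdorff_space surf_sort;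
  surf_second_countable : @second_countable surf_sort;
  atlas : set (chart R surf_sort);
  atlas_cover : forall p, exists2 c, atlas c & cdom c p;
  cdom_open : forall c, atlas c -> open (cdom c);
  cimg_open : forall c, atlas c -> open (cimg c);
  cmap_continuous : forall c p, atlas c -> cdom c p ->
    {for p, continuous (cmap c)};
  cinv_continuous : forall c x, atlas c -> cimg c x ->
    {for x, continuous (cinv c)};
  cmapK : forall c p, atlas c -> cdom c p -> cinv c (cmap c p) = p;
  transition_smooth : forall c c', atlas c -> atlas c' ->
    smooth_on (cmap c @` (cdom c `&` cdom c')) (cmap c' \o cinv c) }.

Section SimplyConnected.
Context (R : realType) (T : topologicalType).

Definition is_path (g : R -> T) : Prop := {within `[0, 1], continuous g}.

Definition path_connected : Prop :=
  forall p q : T, exists g : R -> T, [/\ is_path g, g 0 = p & g 1 = q].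

Definition null_homotopic (g : R -> T) : Prop :=
  exists H : R * R -> T,
    {within `[0, 1] `*` `[0, 1], continuous H} /\
    forall s, 0 <= s <= 1 ->
      [/\ H (0, s) = g s, H (1, s) = g 0, H (s, 0) = g 0 & H (s, 1) = g 0].

Definition simply_connected : Prop :=
  path_connected /\
  forall g : R -> T, is_path g -> g 0 = g 1 -> null_homotopic g.

End SimplyConnected.

Section SurfaceMaps.
Context {R : realType} {S : surface R} {W : normedModType R}.
Implicit Types (F : S -> W).

Definition smooth F : Prop :=
  forall c, atlas c -> smooth_on (cimg c) (F \o cinv c).

(* The differential of [F] at [p], where the tangent plane of the surface at
   [p] is identified with the coordinate plane of the chart [c]. *)
Definition tdiff (c : chart R S) F (p : S) : 'rV[R]_2 -> W :=
  'd (F \o cinv c) (cmap c p).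

Definition immersion F : Prop :=
  smooth F /\ forall c p, atlas c -> cdom c p -> injective (tdiff c F p).

Definition tangent_plane F (p : S) : set W :=
  [set w | exists c X, [/\ atlas c, cdom c p & w = tdiff c F p X]].

End SurfaceMaps.

Definition dotp {R : realType} {n : nat} (x y : 'rV[R]_n) : R :=
  \sum_(i < n) x 0 i * y 0 i.

(* Levi-Civita connection and Riemann curvature tensor of a metric [g] given
   in coordinates: [christoffel g k i j] is Gamma^k_{ij}, and
   [riemann g l i j k] is the component of R(d_i, d_j) d_k along d_l. *)
Section Riemann.
Context {R : realType}.
Implicit Types (g : 'rV[R]_2 -> 'M[R]_2) (i j k l : 'I_2) (x : 'rV[R]_2).

Definition christoffel g k i j x : R :=
  2^-1 * \sum_l invmx (g x) k l *
    (pd i (fun y => g y j l) x + pd j (fun y => g y i l) x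
     - pd l (fun y => g y i j) x).

Definition riemann g l i j k x : R :=
  pd i (christoffel g l j k) x - pd j (christoffel g l i k) x
  + \sum_m (christoffel g l i m x * christoffel g m j k x
            - christoffel g l j m x * christoffel g m i k x).

End Riemann.

Section NormalBundle.
Context {R : realType} (phi : 'rV[R]_2 -> 'rV[R]_4).
Implicit Types (x : 'rV[R]_2) (V : set 'rV[R]_2) (xi : 'rV[R]_2 -> 'rV[R]_4).

Definition induced_metric x : 'M[R]_2 :=
  \matrix_(i, j) dotp (pd i phi x) (pd j phi x).

Definition normal_proj x (w : 'rV[R]_4) : 'rV[R]_4 :=
  w - \sum_i \sum_j
        (invmx (induced_metric x) i j * dotp w (pd i phi x)) *: pd j phi x.

Definition normal_on V xi : Prop :=
  forall x i, V x -> dotp (xi x) (pd i phi x) = 0.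

Definition nabla_perp (i : 'I_2) xi : 'rV[R]_2 -> 'rV[R]_4 :=
  fun x => normal_proj x (pd i xi x).

(* The coordinate fields commute, so that
   R^perp(d_i, d_j) xi = nabla_i nabla_j xi - nabla_j nabla_i xi. *)
Definition normal_curvature (i j : 'I_2) xi : 'rV[R]_2 -> 'rV[R]_4 :=
  fun x => nabla_perp i (nabla_perp j xi) x - nabla_perp j (nabla_perp i xi) x.

End NormalBundle.

Section SurfacesInR4.
Context {R : realType} {S : surface R} (f : S -> 'rV[R]_4).

Definition flat_surface : Prop :=
  immersion f /\
  forall c x, atlas c -> cimg c x ->
    forall l i j k, riemann (induced_metric (f \o cinv c)) l i j k x = 0.

(* The tensor R^perp is evaluated on arbitrary local normal fields. *)
Definition flat_normal_bundle : Prop :=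
  forall c (V : set 'rV[R]_2) xi, atlas c -> open V -> V `<=` cimg c ->
    smooth_on V xi -> normal_on (f \o cinv c) V xi ->
    forall i j x, V x -> normal_curvature (f \o cinv c) i j xi x = 0.

Definition wedge (a b : 'rV[R]_4) : 'M[R]_4 := a^T *m b - b^T *m a.

(* G_{2,4} is embedded in the space of bivectors, i.e. of skew-symmetric
   matrices, an oriented plane with positively oriented orthonormal basis
   (a, b) being sent to a /\ b. The two orientations of a plane correspond to
   opposite bivectors, and continuity of [G] amounts to orienting the tangent
   planes coherently. Since the embedding is itself an immersion, the map into
   G_{2,4} is an immersion if and only if [G] is. *)
Definition is_gauss_map (G : S -> 'M[R]_4) : Prop :=
  continuous G /\
  forall p, exists a b,
    [/\ tangent_plane f p a, tangent_plane f p b,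
        dotp a a = 1, dotp b b = 1 & dotp a b = 0] /\ G p = wedge a b.

Definition unit_normal_field (N : S -> 'rV[R]_4) : Prop :=
  [/\ smooth N, forall p, dotp (N p) (N p) = 1
    & forall p w, tangent_plane f p w -> dotp (N p) w = 0].

Definition special_section (N : S -> 'rV[R]_4) : Prop :=
  unit_normal_field N /\
  forall p, tangent_plane N p `<=` tangent_plane f p.

Definition orthonormal_complement (N Nh : S -> 'rV[R]_4) : Prop :=
  unit_normal_field Nh /\ forall p, dotp (N p) (Nh p) = 0.

End SurfacesInR4.

Section FlatMaps.
Context {R : realType} {S : surface R}.
Implicit Types (u v w : S -> R) (F Fh : S -> 'rV[R]_4).

(* [wu] and [wv] are the partial derivatives of [w] with respect to the local
   coordinates u, v; when (u, v) is an immersion into the plane, du and dv form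
   a coframe, so that [wu] and [wv] are determined by [w]. *)
Definition uv_partials u v w wu wv : Prop :=
  forall c p X, atlas c -> cdom c p ->
    tdiff c w p X = wu p * tdiff c u p X + wv p * tdiff c v p X.

Definition uv_mixed_zero u v w : Prop :=
  exists wu wv wvv, [/\ smooth wv, uv_partials u v w wu wv
    & uv_partials u v wv (fun=> 0) wvv].

Definition sphere_map F : Prop :=
  smooth F /\ forall p, dotp (F p) (F p) = 1.

(* The three quadratic forms are written as symmetric bilinear forms, with
   2 du dv standing for du (x) dv + dv (x) du. *)
Definition is_polar_angle u v F Fh w : Prop :=
  [/\ immersion (fun p => (u p, v p)),
      sphere_map F, sphere_map Fh, smooth w & [/\
      forall c p X Y, atlas c -> cdom c p ->
        let du := tdiff c u p in let dv := tdiff c v p in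
        let dF := tdiff c F p in let dFh := tdiff c Fh p in
        [/\ dotp (dF X) (dF Y) =
              du X * du Y + cos (w p) * (du X * dv Y + dv X * du Y)
              + dv X * dv Y,
            dotp (dF X) (dFh Y) = sin (w p) * (du X * dv Y + dv X * du Y),
            dotp (dFh X) (dFh Y) =
              du X * du Y - cos (w p) * (du X * dv Y + dv X * du Y)
              + dv X * dv Y,
            dotp (dF X) (Fh p) = 0 & dotp (F p) (dFh X) = 0],
      forall p, dotp (F p) (Fh p) = 0
    & uv_mixed_zero u v w]].

Definition is_polar_map u v F Fh : Prop :=
  exists w, is_polar_angle u v F Fh w.

Definition flat_map u v F : Prop := exists Fh, is_polar_map u v F Fh.

End FlatMaps.

(* Main.v *)
From HB Require Import structures.
Require Import Defs.
From mathcomp Require Import all_boot all_order all_algebra.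
From mathcomp Require Import all_classical all_reals all_analysis.
From mathcomp Require Import ring lra.
Set Implicit Arguments.
Unset Strict Implicit.
Unset Printing Implicit Defensive.
Import Order.TTheory GRing.Theory Num.Theory.
Import numFieldNormedType.Exports.
Local Open Scope classical_set_scope.
Local Open Scope ring_scope.

(** Along the surface choose an orthonormal tangent frame and an orthonormal
    normal frame, and consider the tangential parts of the derivatives of the
    two normal fields. The Gauss equation of a flat metric says that the two
    determinants of these tangential parts add up to zero, and the Ricci
    equation of a flat normal bundle says that the two tangential parts commute.
    The first fact allows to rotate the normal frame, by half of an explicit
    angle, so that both determinants vanish (rotate_normal). When the Gauss map
    is an immersion the two rank-one forms so obtained have no common kernel,
    and commutation then forces their values to lie on two orthogonal lines
    (rank_one_forms). This gives a diagonal frame e1, e2 (tangent), n1, n2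
    (normal): <de1,n2> = <de2,n1> = 0, while phi1 = <de1,n1> and
    phi2 = <de2,n2> form a coframe. The structure equations make phi1 and phi2
    closed, so that locally phi1 = da and phi2 = db (diag_frame_exists,
    immersion_diag_frame).

    A diagonal frame is unique up to signs and up to the exchange of its two
    halves (diag_frame_rigid). Hence the germs of admissible pairs (a, b) form a
    torsor under the group of signed permutations composed with translations,
    and a general monodromy argument on a simply connected space
    (rigid_global_section) produces a global pair (global_frame). The canonical
    immersion is u = (a + b) / 2, v = (a - b) / 2, so that phi1 = du + dv and
    phi2 = du - dv.

    A special section is N = c n1 + s n2 with
    dN = - c phi1 e1 - s phi2 e2, and its orthonormal complement
    Nh = ch n1 + sh n2 satisfies the same formula, since it is parallel too.
    As (c, s) and (ch, sh) form an orthogonal matrix, the three quadratic forms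
    are those of a flat map, with cos w = c^2 - s^2 and sin w = 2 c ch
    (pd_forms). The unit vector with these components turns with the speed
    2 (c sh - s ch) psi, where psi = <dn1,n2>; this form is closed, and the same
    monodromy argument yields a global angle w (global_angle).

    Finally let rho = <de1,e2>. The equations d<de1,n2> = 0 and d<de2,n1> = 0
    read psi /\ phi1 = rho /\ phi2 and psi /\ phi2 = rho /\ phi1, that is,
    (psi - rho) /\ du = 0 and (psi + rho) /\ dv = 0. Thus psi + rho = 2 k dv
    for a function k, and psi + rho is closed, so dk /\ dv = 0. Since w_v is k
    up to the constant factor 2 (c sh - s ch) = 2 or -2, the mixed derivative of
    w vanishes (kappa_v, angle_mixed_zero). *)

(** * Differential calculus on the plane *)

Section Differentials.
Context {R : realType}.
Local Notation V2 := 'rV[R]_2.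

Lemma forall_I2 (P : 'I_2 -> Prop) : P 0 -> P 1 -> forall i, P i.
Proof.
move=> P0 P1 [[|[|//]] Hi].
- by rewrite (_ : Ordinal Hi = 0)//; apply: val_inj.
- by rewrite (_ : Ordinal Hi = 1)//; apply: val_inj.
Qed.

Lemma sum_I2 (V : nmodType) (F : 'I_2 -> V) : \sum_i F i = F 0 + F 1.
Proof.
rewrite big_ord_recl big_ord_recl big_ord0 addr0.
by congr (F _ + F _); apply: val_inj.
Qed.

Lemma row2E (v : V2) : v = v 0 0 *: basis_vec 0 + v 0 1 *: basis_vec 1.
Proof. by rewrite [LHS]row_sum_delta sum_I2. Qed.

Lemma pdE (W : normedModType R) (h : V2 -> W) x i : pd i h x = 'd h x (basis_vec i).
Proof. by []. Qed.

Lemma diff_pd (W : normedModType R) (h : V2 -> W) x v :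
  'd h x v = v 0 0 *: pd 0 h x + v 0 1 *: pd 1 h x.
Proof. by rewrite {1}(row2E v) linearD !linearZ. Qed.

(** An epsilon characterization of the differential, which avoids manipulating
    little-o expressions. *)
Lemma is_diff_eps (V W : normedModType R) (h : V -> W) (df : {linear V -> W}) x :
  continuous df ->
  (forall e, 0 < e -> \forall k \near 0, `|h (k + x) - h x - df k| <= e * `|k|) ->
  differentiable h x /\ 'd h x = df :> (V -> W).
Proof.
move=> cdf hdf.
have E : h \o shift x = cst (h x) + df +o_ 0 id.
  apply/eqaddoP => e e0; move: (hdf e e0); apply: filterS => k /=.
  by rewrite !fctE /= opprD addrA.
have H := diff_unique cdf E.
by split=> //; apply/diff_locallyP; rewrite H.
Qed.

Lemma diff_eps (V W : normedModType R) (h : V -> W) x : differentiable h x ->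
  forall e, 0 < e -> \forall k \near 0, `|h (k + x) - h x - 'd h x k| <= e * `|k|.
Proof.
move=> /diff_locallyP[_ /eqaddoP H] e e0; move: (H e e0).
by apply: filterS => k /=; rewrite !fctE /= opprD addrA.
Qed.

(** Differentials are local; this is what allows to work with functions that are
    only prescribed on an open set. *)
Lemma diff_near_eq (V W : normedModType R) (h k : V -> W) x :
  (\forall y \near x, h y = k y) -> differentiable h x ->
  differentiable k x /\ 'd k x = 'd h x :> (V -> W).
Proof.
move=> hk dh; have cd := diff_continuous dh.
apply: is_diff_eps => // e e0.
have H : \forall z \near 0, h (z + x) = k (z + x).
  move: hk; rewrite (near_shift 0 x) => hk.
  by apply: filterS hk => z /=; rewrite subr0.
have hx : h x = k x by apply: nbhs_singleton hk.
apply: filterS2 H (diff_eps dh e0) => z <-.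
by rewrite hx.
Qed.

Lemma pd_derive (W : normedModType R) (h : V2 -> W) x i :
  differentiable h x -> pd i h x = 'D_(basis_vec i) h x.
Proof. by move=> dh; rewrite deriveE. Qed.

End Differentials.

Section SmoothCalculus.
Context {R : realType}.
Local Notation V2 := 'rV[R]_2.
Implicit Types (W : normedModType R) (U V : set V2).

Lemma open_near (T : topologicalType) (U : set T) x (P : T -> Prop) :
  open U -> U x -> (forall y, U y -> P y) -> \forall y \near x, P y.
Proof. by move=> oU Ux UP; apply: filterS UP _; exact: open_nbhs_nbhs. Qed.

Lemma cont_near_eq (T S : topologicalType) (h k : T -> S) x :
  (\forall y \near x, h y = k y) -> {for x, continuous h} -> {for x, continuous k}.
Proof.
move=> hk ch; rewrite /prop_for /continuous_at -(nbhs_singleton hk).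
by apply: cvg_trans ch; apply: near_eq_cvg.
Qed.

Lemma continuous_mx (T : topologicalType) m n (h : T -> 'M[R]_(m, n)) x :
  (forall a b, {for x, continuous (fun y => h y a b)}) -> {for x, continuous h}.
Proof.
move=> ch; apply/cvg_ballP => e e0.
near=> y; split=> // a b; move: a b.
near: y; apply: filter_forall => a; apply: filter_forall => b.
have /cvg_ballP := ch a b; exact.
Unshelve. all: end_near. Qed.

Lemma smooth_onP W U (h : V2 -> W) :
  smooth_on U h <->
  (forall x, U x -> differentiable h x) /\ forall i, smooth_on U (pd i h).
Proof.
split=> [sh|[dh ph]].
  split; first by have [] := sh 1%N.
  by move=> i k; have [_] := sh k.+1; apply.
case=> [|k]; last by split=> // i; exact: ph.
by move=> x Ux; apply: differentiable_continuous; exact: dh.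
Qed.

Lemma smooth_on_diff W U (h : V2 -> W) x :
  smooth_on U h -> U x -> differentiable h x.
Proof. by move=> /smooth_onP[+ _]; apply. Qed.

Lemma smooth_on_pd W U (h : V2 -> W) i : smooth_on U h -> smooth_on U (pd i h).
Proof. by move=> /smooth_onP[_]. Qed.

Lemma smooth_on_cont W U (h : V2 -> W) x :
  smooth_on U h -> U x -> {for x, continuous h}.
Proof. by move=> sh Ux; apply: differentiable_continuous; exact: smooth_on_diff Ux. Qed.

Lemma smooth_on_sub W U V (h : V2 -> W) :
  V `<=` U -> smooth_on U h -> smooth_on V h.
Proof.
move=> VU sh k; move: (sh k); elim: k h {sh} => [|k IH] h /=.
  by move=> ch x /VU; exact: ch.
by move=> [dh ph]; split=> [x /VU|i]; [exact: dh|exact: IH].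
Qed.

Lemma pd_near_eq W (h k : V2 -> W) x i : (\forall y \near x, h y = k y) ->
  differentiable h x -> pd i h x = pd i k x.
Proof.
move=> hk dh; have [_ E] := diff_near_eq hk dh.
exact: (congr1 (fun F : V2 -> W => F (basis_vec i)) (esym E)).
Qed.

Lemma pd_open_eq W U (h k : V2 -> W) x i : open U -> U x ->
  (forall y, U y -> h y = k y) -> differentiable h x -> pd i h x = pd i k x.
Proof.
move=> oU Ux hk; apply: pd_near_eq.
by apply: (open_near oU Ux) => y /hk.
Qed.

Lemma Ck_eq W n U (h k : V2 -> W) : open U -> (forall y, U y -> h y = k y) ->
  Ck n U h -> Ck n U k.
Proof.
move=> oU; elim: n h k => [|n IH] h k hk /=.
  by move=> ch x Ux; apply: cont_near_eq (open_near oU Ux hk) (ch _ Ux).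
move=> [dh ph]; have dk x : U x -> differentiable k x.
  move=> Ux; have [] := diff_near_eq (open_near oU Ux hk) (dh _ Ux); done.
split; first exact: dk.
move=> i; apply: IH (ph i) => x Ux.
exact: (pd_open_eq i oU Ux hk (dh _ Ux)).
Qed.

Lemma smooth_on_eq W U (h k : V2 -> W) : open U -> (forall y, U y -> h y = k y) ->
  smooth_on U h -> smooth_on U k.
Proof. by move=> oU hk sh n; exact: Ck_eq oU hk (sh n). Qed.

Lemma CkW W n U (h : V2 -> W) : Ck n.+1 U h -> Ck n U h.
Proof.
elim: n h => [|n IH] h [dh ph].
  by move=> x /dh; exact: differentiable_continuous.
by split=> // i; apply: IH; exact: ph.
Qed.

Lemma pdD W (f g : V2 -> W) x i : differentiable f x -> differentiable g x ->
  pd i (fun y => f y + g y) x = pd i f x + pd i g x.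
Proof.
move=> df dg.
exact: (congr1 (fun F : V2 -> W => F (basis_vec i)) (diffD df dg)).
Qed.

Lemma pdN W (f : V2 -> W) x i : differentiable f x ->
  pd i (fun y => - f y) x = - pd i f x.
Proof.
move=> df.
exact: (congr1 (fun F : V2 -> W => F (basis_vec i)) (diffN df)).
Qed.

Lemma pdB W (f g : V2 -> W) x i : differentiable f x -> differentiable g x ->
  pd i (fun y => f y - g y) x = pd i f x - pd i g x.
Proof.
move=> df dg; rewrite (pdD i df)// ?pdN//; exact: differentiableN.
Qed.

Lemma pd_cst W (a : W) x i : pd i (fun _ : V2 => a) x = 0.
Proof. exact: (congr1 (fun F : V2 -> W => F (basis_vec i)) (diff_cst a x)). Qed.

Lemma pdM (f g : V2 -> R) x i : differentiable f x -> differentiable g x ->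
  pd i (fun y => f y * g y) x = pd i f x * g x + f x * pd i g x.
Proof.
move=> df dg.
transitivity (f x * pd i g x + g x * pd i f x); last by rewrite addrC [g x * _]mulrC.
exact: (congr1 (fun F : V2 -> R => F (basis_vec i)) (diffM df dg)).
Qed.

Lemma pdV (f : V2 -> R) x i : differentiable f x -> f x != 0 ->
  pd i (fun y => (f y)^-1) x = - (pd i f x * (f x)^-1 * (f x)^-1).
Proof.
move=> df f0; transitivity (- (f x) ^- 2 * pd i f x).
  exact: (congr1 (fun F : V2 -> R => F (basis_vec i)) (diffV df f0)).
by rewrite mulNr mulrC -exprVn expr2 mulrA.
Qed.

Lemma smooth_on_cst W U (a : W) : smooth_on U (fun=> a).
Proof.
move=> n; elim: n a => [|n IH] a; first by move=> x _; apply: (@cst_continuous _ _ a).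
split=> [x _|i]; first exact: differentiable_cst.
have -> : pd i (fun _ : V2 => a) = (fun=> 0) by apply/funext => x; rewrite pd_cst.
exact: IH.
Qed.

Lemma smooth_onD W U (f g : V2 -> W) : open U ->
  smooth_on U f -> smooth_on U g -> smooth_on U (fun x => f x + g x).
Proof.
move=> oU sf sg n; move: (sf n) (sg n); elim: n f g {sf sg} => [|n IH] f g.
  by move=> cf cg x Ux; apply: continuousD; [exact: cf|exact: cg].
move=> [df pf] [dg pg]; split=> [x Ux|i].
  by apply: differentiableD; [exact: df|exact: dg].
apply: Ck_eq oU _ (IH _ _ (pf i) (pg i)) => x Ux.
by rewrite pdD//; [exact: df|exact: dg].
Qed.

Lemma smooth_onN W U (f : V2 -> W) : open U ->
  smooth_on U f -> smooth_on U (fun x => - f x).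
Proof.
move=> oU sf n; move: (sf n); elim: n f {sf} => [|n IH] f.
  by move=> cf x Ux; apply: continuousN; exact: cf.
move=> [df pf]; split=> [x Ux|i]; first by apply: differentiableN; exact: df.
apply: Ck_eq oU _ (IH _ (pf i)) => x Ux.
by rewrite pdN//; exact: df.
Qed.

Lemma smooth_onB W U (f g : V2 -> W) : open U ->
  smooth_on U f -> smooth_on U g -> smooth_on U (fun x => f x - g x).
Proof. by move=> oU sf sg; apply: smooth_onD => //; exact: smooth_onN. Qed.

Lemma CkD W n U (f g : V2 -> W) : open U ->
  Ck n U f -> Ck n U g -> Ck n U (fun x => f x + g x).
Proof.
move=> oU; elim: n f g => [|n IH] f g.
  by move=> cf cg x Ux; apply: continuousD; [exact: cf|exact: cg].
move=> [df pf] [dg pg]; split=> [x Ux|i].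
  by apply: differentiableD; [exact: df|exact: dg].
apply: Ck_eq oU _ (IH _ _ (pf i) (pg i)) => x Ux.
by rewrite pdD//; [exact: df|exact: dg].
Qed.

(** The product is treated by induction on the order, the Leibniz rule
    expressing the partial derivatives of a product by products of functions of
    lower order. *)
Lemma CkM n U (f g : V2 -> R) : open U ->
  Ck n U f -> Ck n U g -> Ck n U (fun x => f x * g x).
Proof.
move=> oU; elim: n f g => [|n IH] f g.
  by move=> cf cg x Ux; apply: continuousM; [exact: cf|exact: cg].
move=> Cf Cg; have [df pf] := Cf; have [dg pg] := Cg; split=> [x Ux|i].
  by apply: differentiableM; [exact: df|exact: dg].
have H := CkD oU (IH _ _ (pf i) (CkW Cg)) (IH _ _ (CkW Cf) (pg i)).
apply: Ck_eq oU _ H => x Ux.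
by rewrite pdM//; [exact: df|exact: dg].
Qed.

Lemma smooth_onM U (f g : V2 -> R) : open U ->
  smooth_on U f -> smooth_on U g -> smooth_on U (fun x => f x * g x).
Proof. by move=> oU sf sg n; exact: CkM. Qed.

Lemma smooth_on_sum W U n (f : 'I_n -> V2 -> W) : open U ->
  (forall i, smooth_on U (f i)) -> smooth_on U (fun x => \sum_i f i x).
Proof.
move=> oU; elim: n f => [|n IH] f sf.
  apply: smooth_on_eq (smooth_on_cst _ 0) => // x _; by rewrite big_ord0.
apply: smooth_on_eq (smooth_onD oU (IH (fun i => f (widen_ord (leqnSn n) i)) _)
  (sf ord_max)) => //.
by move=> x _; rewrite big_ord_recr.
Qed.

(** The derivative of the inverse is a polynomial in the inverse itself and in
    the derivative of f, hence the induction on the order of differentiability. *)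
Lemma smooth_onV U (f : V2 -> R) : open U -> (forall x, U x -> f x != 0) ->
  smooth_on U f -> smooth_on U (fun x => (f x)^-1).
Proof.
move=> oU f0 sf; have df x : U x -> differentiable f x by exact: smooth_on_diff.
elim=> [|n IH].
  move=> x Ux; apply: differentiable_continuous.
  by apply: differentiableV; [exact: df|exact: f0].
split=> [x Ux|i]; first by apply: differentiableV; [exact: df|exact: f0].
have H := smooth_on_pd i sf n.
apply: Ck_eq oU _ (CkM oU (CkM oU (smooth_onN oU (smooth_on_pd i sf) n) IH) IH) => x Ux /=.
by rewrite pdV ?mulNr//; [exact: df|exact: f0].
Qed.

Lemma diff_sqrt (f : V2 -> R) x : differentiable f x -> 0 < f x ->
  differentiable (fun y => Num.sqrt (f y)) x /\
  forall i, pd i (fun y => Num.sqrt (f y)) x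
    = pd i f x * (2^-1 * (Num.sqrt (f x))^-1).
Proof.
move=> df f0.
have ds := @is_derive1_sqrt R _ f0.
have dS : differentiable (@Num.sqrt R) (f x).
  by apply/derivable1_diffP; exact: ex_derive.
split=> [|i]; first exact: differentiable_comp.
transitivity ('d (@Num.sqrt R) (f x) (pd i f x)).
  exact: (congr1 (fun F : V2 -> R => F (basis_vec i)) (diff_comp df dS)).
have dS' : derivable (@Num.sqrt R) (f x) 1 by apply/derivable1_diffP.
rewrite (deriv1E dS') derive1E derive_val.
by rewrite /GRing.scale /= invfM.
Qed.

(** The derivative of the square root involves its inverse, and that of the
    inverse involves both, so the two are treated in the same induction. *)
Lemma smooth_on_sqrt U (f : V2 -> R) : open U -> (forall x, U x -> 0 < f x) ->
  smooth_on U f -> smooth_on U (fun x => Num.sqrt (f x)).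
Proof.
move=> oU f0 sf.
have dS x : U x -> differentiable (fun y => Num.sqrt (f y)) x.
  by move=> Ux; have [] := diff_sqrt (smooth_on_diff sf Ux) (f0 _ Ux).
suff H n : Ck n U (fun x => Num.sqrt (f x)) /\ Ck n U (fun x => (Num.sqrt (f x))^-1).
  by move=> n; have [] := H n.
have s0 x : U x -> Num.sqrt (f x) != 0 by move=> Ux; rewrite gt_eqF// sqrtr_gt0 f0.
have dV x : U x -> differentiable (fun y => (Num.sqrt (f y))^-1) x.
  by move=> Ux; apply: differentiableV; [exact: dS|exact: s0].
elim: n => [|n [IH1 IH2]].
  by split=> x Ux; apply: differentiable_continuous; [exact: dS|exact: dV].
have H i : Ck n U (pd i (fun x => Num.sqrt (f x))).
  apply: Ck_eq oU _ (CkM oU (smooth_on_pd i sf n)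
    (CkM oU (smooth_on_cst U (2^-1 : R) n) IH2)) => x Ux.
  by have [_ ->] := diff_sqrt (smooth_on_diff sf Ux) (f0 _ Ux).
split; split; [exact: dS|exact: H|exact: dV|move=> i].
apply: Ck_eq oU _ (CkM oU (smooth_on_cst U (-1 : R) n) (CkM oU (CkM oU (H i) IH2) IH2)) => x Ux.
by rewrite mulN1r pdV//; [exact: dS|exact: s0].
Qed.

(** Matrices carry the sup norm, so the entrywise estimates can be combined into
    one by taking a finite intersection of neighbourhoods. *)
Lemma differentiable_mxP m n (h : V2 -> 'M[R]_(m, n)) x :
  differentiable h x <-> forall a b, differentiable (fun y => h y a b) x.
Proof.
split=> [dh a b|dh].
  exact: (@differentiable_comp _ _ _ _ h (fun M : 'M[R]_(m, n) => M a b) x dh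
    (differentiable_coord _ a b)).
rewrite (_ : h = fun y => \sum_a \sum_b h y a b *: delta_mx a b); last first.
  by apply/funext => y; rewrite [LHS]matrix_sum_delta.
have S k (F : 'I_k -> V2 -> 'M[R]_(m, n)) : (forall i, differentiable (F i) x) ->
    differentiable (fun y => \sum_i F i y) x.
  move=> dF; rewrite (_ : (fun y => _) = \sum_i F i); first exact: differentiable_sum.
  by apply/funext => y; rewrite fct_sumE.
apply: (S _ (fun a y => \sum_b h y a b *: delta_mx a b)) => a.
apply: (S _ (fun b y => h y a b *: delta_mx a b)) => b.
exact: differentiableZl.
Qed.

Lemma pd_mx m n (h : V2 -> 'M[R]_(m, n)) x i a b : differentiable h x ->
  pd i h x a b = pd i (fun y => h y a b) x.
Proof.
move=> dh; have dhc : differentiable (fun y => h y a b) x.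
  by move/differentiable_mxP: dh.
rewrite !pd_derive//.
by rewrite derive_mx ?mxE//; exact: diff_derivable.
Qed.

Lemma smooth_on_mxP m n U (h : V2 -> 'M[R]_(m, n)) : open U ->
  smooth_on U h <-> forall a b, smooth_on U (fun y => h y a b).
Proof.
move=> oU; split=> [sh a b k|sh k].
  move: (sh k); elim: k h {sh} => [|k IH] h /=.
    move=> ch x Ux.
    apply: (@continuous_comp _ _ _ h (fun M : 'M[R]_(m, n) => M a b)); first exact: ch.
    exact: coord_continuous.
  move=> [dh ph]; split=> [x Ux|i].
    by move/differentiable_mxP: (dh _ Ux).
  apply: Ck_eq oU _ (IH _ (ph i)) => x Ux /=.
  by rewrite pd_mx//; exact: dh.
have : forall a b, Ck k U (fun y => h y a b) by move=> a b; exact: sh.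
have d0 x : U x -> differentiable h x.
  by move=> Ux; apply/differentiable_mxP => a b; apply: smooth_on_diff (sh a b) Ux.
elim: k h {sh} d0 => [|k IH] h d0 Ch.
  by move=> x Ux; apply: differentiable_continuous; exact: d0.
split=> // i; case: k IH Ch => [|k] IH Ch.
  move=> x Ux; apply: continuous_mx => a b.
  have [_ /(_ i x Ux)] := Ch a b; apply: cont_near_eq.
  by apply: (open_near oU Ux) => y Uy; rewrite pd_mx//; exact: d0.
apply: IH => [x Ux|a b].
  apply/differentiable_mxP => a b; have [_ /(_ i)[dab _]] := Ch a b.
  suff H : forall y, U y -> pd i (fun y => h y a b) y = pd i h y a b.
    by have [] := diff_near_eq (open_near oU Ux H) (dab x Ux).
  by move=> y Uy; rewrite pd_mx//; exact: d0.
have [_ /(_ i) H] := Ch a b; apply: (@Ck_eq _ k.+1 U _ _ oU _ H) => x Ux.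
by rewrite pd_mx//; exact: d0.
Qed.

End SmoothCalculus.

Section VectorCalculus.
Context {R : realType}.
Local Notation V2 := 'rV[R]_2.
Implicit Types (U V : set V2).

Lemma differentiable_pdsum n (f : 'I_n -> V2 -> R) x i :
  (forall k, differentiable (f k) x) ->
  differentiable (fun y => \sum_k f k y) x /\
  pd i (fun y => \sum_k f k y) x = \sum_k pd i (f k) x.
Proof.
elim: n f => [|n IH] f df.
  rewrite big_ord0 (_ : (fun y => _) = fun=> 0); last first.
    by apply/funext => y; rewrite big_ord0.
  by split; [exact: differentiable_cst|rewrite pd_cst].
rewrite (_ : (fun y => _) = fun y => (\sum_(k < n) f (widen_ord (leqnSn n) k) y) + f ord_max y).
  have [d E] := IH _ (fun k => df (widen_ord (leqnSn n) k)).
  split; first exact: differentiableD.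
  by rewrite (pdD _ d (df _)) big_ord_recr /= E.
by apply/funext => y; rewrite big_ord_recr.
Qed.

Lemma differentiable_dotp n (A B : V2 -> 'rV[R]_n) x :
  differentiable A x -> differentiable B x ->
  differentiable (fun y => dotp (A y) (B y)) x.
Proof.
move=> /differentiable_mxP dA /differentiable_mxP dB.
by have [] := @differentiable_pdsum n (fun k y => A y 0 k * B y 0 k) x 0
  (fun k => differentiableM (dA 0 k) (dB 0 k)).
Qed.

Lemma pd_dotp n (A B : V2 -> 'rV[R]_n) x i :
  differentiable A x -> differentiable B x ->
  pd i (fun y => dotp (A y) (B y)) x =
  dotp (pd i A x) (B x) + dotp (A x) (pd i B x).
Proof.
move=> dA' dB'; have dA := (differentiable_mxP _ _).1 dA'.
have dB := (differentiable_mxP _ _).1 dB'.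
have [_ ->] := @differentiable_pdsum n (fun k y => A y 0 k * B y 0 k) x i
  (fun k => differentiableM (dA 0 k) (dB 0 k)).
rewrite /dotp -big_split /=; apply: eq_bigr => k _.
apply: (etrans (pdM i (dA 0 k) (dB 0 k))).
by congr (_ * _ + _ * _); apply/esym; apply: pd_mx.
Qed.

Lemma smooth_on_dotp n U (A B : V2 -> 'rV[R]_n) : open U ->
  smooth_on U A -> smooth_on U B -> smooth_on U (fun y => dotp (A y) (B y)).
Proof.
move=> oU /(smooth_on_mxP _ oU) sA /(smooth_on_mxP _ oU) sB.
by apply: smooth_on_sum => // k; apply: smooth_onM.
Qed.

Lemma differentiable_scale n (k : V2 -> R) (A : V2 -> 'rV[R]_n) x :
  differentiable k x -> differentiable A x -> differentiable (fun y => k y *: A y) x.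
Proof.
move=> dk /differentiable_mxP dA; apply/differentiable_mxP => a b.
rewrite (_ : (fun y => _) = fun y => k y * A y a b); first exact: differentiableM.
by apply/funext => y; rewrite mxE.
Qed.

Lemma pdZ n (k : V2 -> R) (A : V2 -> 'rV[R]_n) x i :
  differentiable k x -> differentiable A x ->
  pd i (fun y => k y *: A y) x = pd i k x *: A x + k x *: pd i A x.
Proof.
move=> dk dA; apply/matrixP => a b.
rewrite pd_mx; last exact: differentiable_scale.
rewrite (_ : (fun y => _) = fun y => k y * A y a b); last first.
  by apply/funext => y; rewrite mxE.
move/differentiable_mxP: (dA) => dA'.
apply: (etrans (pdM i dk (dA' a b))).
by rewrite !mxE; congr (_ * _ + _ * _); apply/esym; apply: pd_mx.
Qed.

Lemma smooth_onZ n U (k : V2 -> R) (A : V2 -> 'rV[R]_n) : open U ->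
  smooth_on U k -> smooth_on U A -> smooth_on U (fun y => k y *: A y).
Proof.
move=> oU sk /(smooth_on_mxP _ oU) sA; apply/(smooth_on_mxP _ oU) => a b.
rewrite (_ : (fun y => _) = fun y => k y * A y a b); first exact: smooth_onM.
by apply/funext => y; rewrite mxE.
Qed.

Lemma pd_comp (W : normedModType R) (h : V2 -> W) (t : V2 -> V2) x i :
  differentiable t x -> differentiable h (t x) ->
  pd i (h \o t) x = pd i t x 0 0 *: pd 0 h (t x) + pd i t x 0 1 *: pd 1 h (t x).
Proof.
move=> dt dh; rewrite -diff_pd.
exact: (congr1 (fun F : V2 -> W => F (basis_vec i)) (diff_comp dt dh)).
Qed.

(** By the chain rule the partial derivatives of the composite are sums of
    products of composites, hence the induction on the order. *)
Lemma smooth_on_comp U V (h : V2 -> R) (t : V2 -> V2) : open U -> open V ->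
  (forall x, V x -> U (t x)) -> smooth_on V t -> smooth_on U h ->
  smooth_on V (h \o t).
Proof.
move=> oU oV VU st sh k; move: (sh k); elim: k h {sh} => [|k IH] h /=.
  move=> ch x Vx; apply: (@continuous_comp _ _ _ t h).
    exact: smooth_on_cont st Vx.
  by apply: ch; exact: VU.
move=> [dh ph]; split=> [x Vx|i].
  apply: differentiable_comp; first exact: smooth_on_diff st Vx.
  by apply: dh; exact: VU.
have st' j : smooth_on V (fun x => pd i t x 0 j).
  by have /(smooth_on_mxP _ oV) := smooth_on_pd i st.
apply: Ck_eq oV _ (CkD oV (CkM oV (st' 0 k) (IH _ (ph 0)))
  (CkM oV (st' 1 k) (IH _ (ph 1)))) => x Vx.
by apply: (esym (pd_comp i (smooth_on_diff st Vx) (dh _ (VU _ Vx)))).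
Qed.

Lemma smooth_on_comp_mx m n U V (h : V2 -> 'M[R]_(m, n)) (t : V2 -> V2) :
  open U -> open V -> (forall x, V x -> U (t x)) ->
  smooth_on V t -> smooth_on U h -> smooth_on V (h \o t).
Proof.
move=> oU oV VU st /(smooth_on_mxP _ oU) sh; apply/(smooth_on_mxP _ oV) => a b.
exact: (smooth_on_comp oU oV VU st (sh a b)).
Qed.

Definition convex_set U := forall x y (t : R), U x -> U y -> 0 <= t <= 1 ->
  U (x + t *: (y - x)).

Lemma ball_convex (c : V2) r : convex_set (ball c r).
Proof.
move=> x y t; rewrite -ball_normE /= => bx b_y /andP[t0 t1].
have -> : c - (x + t *: (y - x)) = (1 - t) *: (c - x) + t *: (c - y).
  by apply/matrixP => a b; rewrite !mxE; ring.
apply: le_lt_trans (ler_normD _ _) _; rewrite !normrZ.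
rewrite (ger0_norm t0) ger0_norm ?subr_ge0//.
have [->|tn0] := eqVneq t 0; first by rewrite mul0r addr0 subr0 mul1r.
have tp : 0 < t by rewrite lt_neqAle eq_sym tn0.
have : t * `|c - y| < t * r by rewrite ltr_pM2l.
have : (1 - t) * `|c - x| <= (1 - t) * r by rewrite ler_wpM2l ?subr_ge0// ltW.
lra.
Qed.

Lemma is_derive_line (W : normedModType R) (h : V2 -> W) x v (t : R) :
  differentiable h (x + t *: v) ->
  is_derive t 1 (fun s => h (x + s *: v)) ('d h (x + t *: v) v).
Proof.
move=> dh.
have E : (fun s : R => s^-1 *: (h (x + (s *: (1 : R) + t) *: v) - h (x + t *: v)))
       = (fun s : R => s^-1 *: (h (s *: v + (x + t *: v)) - h (x + t *: v))).
  apply/funext => s; congr (_ *: (h _ - _)).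
  by rewrite (_ : s *: (1 : R) = s) ?scalerDl 1?addrCA//; exact: mulr1.
have dv : derivable h (x + t *: v) v by exact: diff_derivable.
apply: DeriveDef; first by rewrite /derivable /= E.
by rewrite -(deriveE v dh) /derive /= E.
Qed.

Lemma mvt_line (h : V2 -> R) x v :
  (forall t : R, 0 <= t <= 1 -> differentiable h (x + t *: v)) ->
  exists2 t : R, 0 <= t <= 1 & h (x + v) - h x = 'd h (x + t *: v) v.
Proof.
move=> dh.
have D (t : R) : 0 <= t <= 1 -> is_derive t 1 (fun s => h (x + s *: v)) ('d h (x + t *: v) v).
  by move=> t01; apply: is_derive_line; exact: dh.
have [||t t01] := @MVT R (fun s => h (x + s *: v)) (fun t => 'd h (x + t *: v) v) 0 1 ltr01.
- by move=> t; rewrite in_itv /= => /andP[t0 t1]; apply: D; rewrite !ltW.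
- apply: derivable_within_continuous => t; rewrite in_itv /= => t01.
  exact: (@ex_derive _ _ _ _ _ _ _ (D t t01)).
rewrite subr0 mulr1 scale0r addr0 scale1r => E; exists t => //.
by move: t01; rewrite in_itv /= => /andP[t0 t1]; rewrite !ltW.
Qed.

(** Mean value theorem on the segment joining the two points. *)
Lemma pd0_cst U (h : V2 -> R) : convex_set U ->
  (forall x, U x -> differentiable h x) ->
  (forall x i, U x -> pd i h x = 0) -> forall x y, U x -> U y -> h x = h y.
Proof.
move=> cU dh p0 x y Ux Uy.
have [t t01|t t01] := @mvt_line h x (y - x).
  by apply: dh; exact: cU.
rewrite diff_pd !p0 ?scaler0 ?addr0; try exact: cU.
by rewrite subrKC => /eqP; rewrite subr_eq0 => /eqP ->.
Qed.

End VectorCalculus.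

#[local] Opaque pd diff.
(** * Symmetry of second derivatives *)

Section Schwarz.
Context {R : realType}.
Local Notation V2 := 'rV[R]_2.
Implicit Types (U V : set V2).

Lemma norm_basis (i : 'I_2) : `|basis_vec i : V2| <= 1.
Proof.
rewrite /Num.Def.normr/= mx_normrE (bigmax_le _ ler01)//= => -[a b] _.
by rewrite /basis_vec mxE; case: (_ && _); rewrite ?normr1 ?normr0.
Qed.

Lemma ball_basis (x : V2) r (a b : R) i j : `|a| + `|b| < r ->
  ball x r (x + a *: basis_vec i + b *: basis_vec j).
Proof.
move=> abr; rewrite -ball_normE /= -addrA opprD addrA subrr sub0r normrN.
apply: le_lt_trans abr; apply: le_trans (ler_normD _ _) _; rewrite !normrZ.
by apply: lerD; rewrite -[leRHS]mulr1 ler_wpM2l// norm_basis.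
Qed.

Lemma differentiable_shift (h : V2 -> R) w x : differentiable h (x + w) ->
  differentiable (fun z => h (z + w)) x /\
  forall v, 'd (fun z => h (z + w)) x v = 'd h (x + w) v.
Proof.
move=> dh.
have [d e] : differentiable (fun z => h (z + w)) x /\
    'd (fun z => h (z + w)) x = 'd h (x + w) :> (V2 -> R).
  apply: is_diff_eps (diff_continuous dh) _ => e e0.
  by apply: filterS (diff_eps dh e0) => k; rewrite addrA.
split; first exact: d.
by move=> v; exact: (congr1 (fun F : V2 -> R => F v) e).
Qed.

(** The second difference quotient over a small square is a value of the mixed
    derivative: apply the mean value theorem in the direction i to the increment
    of h in the direction j, then in the direction j to the partial derivative
    of h. *)
Lemma second_difference U (h : V2 -> R) x r i j s :
  ball x r `<=` U -> smooth_on U h -> 0 < s -> s + s < r ->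
  exists2 z, ball x r z &
    h (x + s *: basis_vec i + s *: basis_vec j) - h (x + s *: basis_vec i)
    - (h (x + s *: basis_vec j) - h x) = s * (s * pd j (pd i h) z).
Proof.
move=> bU sh s0 ssr.
have r0 : 0 < r by apply: lt_trans ssr; rewrite addr_gt0.
pose w := s *: basis_vec j : V2; pose v := s *: basis_vec i : V2.
have ns t : 0 <= t <= 1 -> `|t * s| <= s.
  move=> /andP[t0 t1]; rewrite ger0_norm; last by rewrite mulr_ge0// ltW.
  by rewrite -[leRHS]mul1r ler_wpM2r// ltW.
have sn : `|s| = s by rewrite gtr0_norm.
have bU' a b k l : `|a| <= s -> `|b| <= s -> ball x r (x + a *: basis_vec k + b *: basis_vec l).
  move=> ha hb; apply: ball_basis; apply: le_lt_trans ssr; exact: lerD.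
have dh y : ball x r y -> differentiable h y by move=> /bU; exact: smooth_on_diff.
pose g z := h (z + w) - h z.
have dg t : 0 <= t <= 1 -> differentiable g (x + t *: v) /\
    'd g (x + t *: v) v = 'd h (x + t *: v + w) v - 'd h (x + t *: v) v.
  move=> t01.
  have b1 : ball x r (x + t *: v + w) by rewrite scalerA; apply: bU'; rewrite ?sn ?ns.
  have b2 : ball x r (x + t *: v).
    rewrite scalerA -[_ + _]addr0 -(scale0r (basis_vec j)); apply: bU'; rewrite ?ns//.
    by rewrite normr0 ltW.
  have [d1 e1] := differentiable_shift (dh _ b1).
  split; first by apply: differentiableB => //; exact: dh.
  apply: (etrans (congr1 (fun F : V2 -> R => F v) (diffB d1 (dh _ b2)))).
  exact: (congr1 (fun y => y - 'd h (x + t *: v) v) (e1 v)).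
have [t /dg[]//|t t01 E] := @mvt_line R g x v.
have [_ e1] := dg _ t01.
pose k := pd i h; have sk : smooth_on U k by exact: smooth_on_pd.
have dv z : 'd h z v = s * k z by rewrite /k pdE; exact: linearZ.
have E2 : g (x + v) - g x = s * (k (x + t *: v + w) - k (x + t *: v)).
  by apply: (etrans (etrans E e1)); rewrite mulrBr; congr (_ - _); exact: dv.
have [q q01|q q01 E3] := @mvt_line R k (x + t *: v) w.
  apply: smooth_on_diff sk _; apply: bU; rewrite !scalerA; apply: bU'; exact: ns.
exists (x + t *: v + q *: w).
  by rewrite !scalerA; apply: bU'; exact: ns.
apply: (etrans E2); congr (_ * _); apply: (etrans E3); rewrite pdE; exact: linearZ.
Qed.

(** The second difference is symmetric in the two directions, so nearby values
    of the two mixed derivatives coincide; conclude by continuity. *)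
Lemma pd_comm_real U (h : V2 -> R) x i j : open U -> U x -> smooth_on U h ->
  pd i (pd j h) x = pd j (pd i h) x.
Proof.
move=> oU Ux sh; apply/eqP; rewrite -subr_eq0 -normr_le0; apply/ler_addgt0Pr => e e0.
rewrite add0r.
have cp a b : {for x, continuous (pd a (pd b h))}.
  by apply: smooth_on_cont Ux; do 2!apply: smooth_on_pd.
have e2 : 0 < e / 2 by rewrite divr_gt0.
have N : \forall y \near x, [/\ U y, `|pd i (pd j h) x - pd i (pd j h) y| < e / 2 &
    `|pd j (pd i h) x - pd j (pd i h) y| < e / 2].
  have nU : \forall y \near x, U y by exact: open_nbhs_nbhs.
  have n1 := (cvgrPdist_lt _ _).1 (cp i j) _ e2.
  have n2 := (cvgrPdist_lt _ _).1 (cp j i) _ e2.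
  near=> y; split; near: y; [exact: nU|exact: n1|exact: n2].
have /nbhs_ballP[r /= r0 br] := N.
have bU : ball x r `<=` U by move=> y /br[].
have r4 : 0 < r / 4 by rewrite divr_gt0.
have r44 : r / 4 + r / 4 < r by lra.
have [y /br[_ hy _] Ey] := second_difference j i bU sh r4 r44.
have [z /br[_ _ hz] Ez] := second_difference i j bU sh r4 r44.
have E : pd i (pd j h) y = pd j (pd i h) z.
  have s2 : r / 4 * (r / 4) != 0 by rewrite mulf_neq0 ?gt_eqF.
  apply: (mulfI s2); rewrite -[LHS]mulrA -[RHS]mulrA; apply: (etrans (esym Ey)); apply: (etrans _ Ez).
  rewrite [X in h X - _ - _ = _]addrAC; ring.
have tri (p q b d : R) : b = d -> `|p - b| < e / 2 -> `|q - d| < e / 2 -> `|p - q| <= e.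
  by rewrite !ltr_norml ler_norml => -> /andP[? ?] /andP[? ?]; apply/andP; split; lra.
exact: tri E hy hz.
Unshelve. all: end_near. Qed.

Lemma pd_comm n U (h : V2 -> 'rV[R]_n) x i j : open U -> U x -> smooth_on U h ->
  pd i (pd j h) x = pd j (pd i h) x.
Proof.
move=> oU Ux sh; have sh' := (smooth_on_mxP _ oU).1 sh.
have E a b k l : pd k (pd l h) x a b = pd k (pd l (fun y => h y a b)) x.
  have spl := smooth_on_pd l sh.
  rewrite pd_mx; last exact: smooth_on_diff spl Ux.
  apply: (pd_open_eq k oU Ux) => [y Uy|].
    by rewrite pd_mx//; exact: smooth_on_diff sh Uy.
  exact: smooth_on_diff ((smooth_on_mxP _ oU).1 spl a b) Ux.
by apply/matrixP => a b; rewrite !E (pd_comm_real _ _ oU Ux).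
Qed.

End Schwarz.

(** * The Poincare lemma *)

Section Poincare.
Context {R : realType}.
Local Notation V2 := 'rV[R]_2.
Implicit Types (U V : set V2).

Lemma coord_le_norm (k : V2) i : `|k 0 i| <= `|k|.
Proof.
rewrite [leRHS]/Num.Def.normr/= mx_normrE.
exact: (le_bigmax _ (fun ij : 'I_1 * 'I_2 => `|k ij.1 ij.2|) (0, i)).
Qed.

(** Only the derivatives along one axis are assumed to exist: the primitive of a
    closed form is not yet known to be differentiable when this is applied to
    it. *)
Lemma axis_mvt U (a : V2 -> R) (g : V2 -> R) i z (w : R) :
  (forall x, U x -> is_derive (0 : R) 1 (fun s : R => a (x + s *: basis_vec i)) (g x)) ->
  (forall t : R, 0 <= t <= 1 -> U (z + (t * w) *: basis_vec i)) ->
  exists2 t : R, 0 <= t <= 1 & a (z + w *: basis_vec i) - a z = w * g (z + (t * w) *: basis_vec i).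
Proof.
move=> da Uz; pose e : V2 := basis_vec i.
have D (t : R) : 0 <= t <= 1 ->
    is_derive t 1 (fun t : R => a (z + (t * w) *: e)) (w * g (z + (t * w) *: e)).
  move=> t01.
  have d1 : is_derive t 1 (fun s : R => (s - t) * w) w.
    by apply: is_derive_eq; rewrite /GRing.scale /= subr0 mulr1 mulr0 add0r.
  have d0 : is_derive ((t - t) * w) 1 (fun s : R => a (z + (t * w) *: e + s *: e)) (g (z + (t * w) *: e)).
    by rewrite subrr mul0r; apply: da; exact: Uz.
  have := @is_derive1_comp R _ (fun s : R => (s - t) * w) t _ _ d0 d1; rewrite [g _ * w]mulrC; congr (is_derive _ _ _ _).
  apply/funext => s /=; congr (a _).
  by rewrite -addrA -scalerDl; congr (z + _ *: e); ring.
have [||c c01] := @MVT R (fun t : R => a (z + (t * w) *: e)) (fun t => w * g (z + (t * w) *: e)) 0 1 ltr01.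
- by move=> t; rewrite in_itv /= => /andP[t0 t1]; apply: D; rewrite !ltW.
- apply: derivable_within_continuous => t; rewrite in_itv /= => t01.
  exact: (@ex_derive _ _ _ _ _ _ _ (D t t01)).
rewrite subr0 mulr1 mul0r scale0r addr0 mul1r => E; exists c => //.
by move: c01; rewrite in_itv /= => /andP[t0 t1]; rewrite !ltW.
Qed.

(** Continuous partial derivatives imply differentiability: join the two points
    by two segments parallel to the axes. *)
Lemma differentiable_partials U (a : V2 -> R) (g : 'I_2 -> V2 -> R) x :
  open U -> U x ->
  (forall i x, U x -> is_derive (0 : R) 1 (fun s : R => a (x + s *: basis_vec i)) (g i x)) ->
  (forall i, {for x, continuous (g i)}) ->
  differentiable a x /\ forall i, pd i a x = g i x.
Proof.
move=> oU Ux da cg.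
pose L (k : V2) : R := k 0 0 * g 0 x + k 0 1 * g 1 x.
have Llin : linear L by move=> c u v; rewrite /L !mxE /GRing.scale /=; ring.
pose LM := GRing.isLinear.Build _ _ _ _ _ Llin.
pose Lf : {linear V2 -> R} := HB.pack L LM.
have Lc : continuous Lf.
  move=> k; apply: (@continuousD _ _ _ (fun k : V2 => k 0 0 * g 0 x) (fun k : V2 => k 0 1 * g 1 x)).
    apply: (@continuousM _ _ (fun k : V2 => k 0 0) (fun=> g 0 x)); first exact: coord_continuous.
    exact: cst_continuous.
  apply: (@continuousM _ _ (fun k : V2 => k 0 1) (fun=> g 1 x)); first exact: coord_continuous.
  exact: cst_continuous.
have [d E] : differentiable a x /\ 'd a x = Lf :> (V2 -> R).
  apply: is_diff_eps Lc _ => e e0.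
  have e2 : 0 < e / 2 by rewrite divr_gt0.
  have N : \forall y \near x, [/\ U y, `|g 0 x - g 0 y| < e / 2 & `|g 1 x - g 1 y| < e / 2].
    have nU : \forall y \near x, U y by exact: open_nbhs_nbhs.
    have n1 := (cvgrPdist_lt _ _).1 (cg 0) _ e2.
    have n2 := (cvgrPdist_lt _ _).1 (cg 1) _ e2.
    near=> y; split; near: y; [exact: nU|exact: n1|exact: n2].
  have /nbhs_ballP[r /= r0 br] := N.
  have r2 : 0 < r / 2 by rewrite divr_gt0.
  have nk : \forall k \near (0 : V2), `|k| < r / 2.
    apply/nbhs_ballP; exists (r / 2) => // k; rewrite -ball_normE /= sub0r normrN.
    exact.
  apply: filterS nk => k kr.
  have k0 := coord_le_norm k 0; have k1 := coord_le_norm k 1.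
  have mt (t c : R) : 0 <= t <= 1 -> `|t * c| <= `|c|.
    by move=> /andP[t0 t1]; rewrite normrM (ger0_norm t0) ler_piMl.
  have br0 (t : R) : 0 <= t <= 1 -> ball x r (x + (t * k 0 0) *: basis_vec 0).
    move=> t01; rewrite -[_ + _]addr0 -(scale0r (basis_vec 1)); apply: ball_basis.
    by rewrite normr0 addr0; have := mt _ (k 0 0) t01; lra.
  have br1 (t : R) : 0 <= t <= 1 ->
      ball x r (x + k 0 0 *: basis_vec 0 + (t * k 0 1) *: basis_vec 1).
    by move=> t01; apply: ball_basis; have := mt _ (k 0 1) t01; lra.
  have [t t01 E0] := @axis_mvt (ball x r) a (g 0) 0 x (k 0 0)
    (fun y by_ => da 0 y (let: And3 Uy _ _ := br _ by_ in Uy)) br0.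
  have [s s01 E1] := @axis_mvt (ball x r) a (g 1) 1 (x + k 0 0 *: basis_vec 0) (k 0 1)
    (fun y by_ => da 1 y (let: And3 Uy _ _ := br _ by_ in Uy)) br1.
  have [_ + _] := br _ (br0 _ t01); move: E0; set gt := g 0 _ => E0 h0.
  have [_ _ +] := br _ (br1 _ s01); move: E1; set gs := g 1 _ => E1 h1.
  have -> : a (k + x) = a (x + k 0 0 *: basis_vec 0 + k 0 1 *: basis_vec 1).
    by congr (a _); rewrite -addrA -row2E addrC.
  have -> : a (x + k 0 0 *: basis_vec 0 + k 0 1 *: basis_vec 1) - a x - Lf k
      = k 0 1 * (gs - g 1 x) + k 0 0 * (gt - g 0 x).
    by rewrite !mulrBr -E0 -E1 [Lf k]/(L k) /L; ring.
  apply: le_trans (ler_normD _ _) _; rewrite !normrM.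
  have q0 : `|k 0 0| * `|gt - g 0 x| <= `|k| * (e / 2).
    by apply: ler_pM => //; rewrite distrC ltW.
  have q1 : `|k 0 1| * `|gs - g 1 x| <= `|k| * (e / 2).
    by apply: ler_pM => //; rewrite distrC ltW.
  lra.
split; first exact: d.
move=> i; rewrite pdE; apply: (etrans (congr1 (fun F : V2 -> R => F (basis_vec i)) E)).
rewrite [LHS]/(L _) /L /basis_vec; move: i; apply: forall_I2; rewrite !mxE /=; ring.
Unshelve. all: end_near. Qed.

End Poincare.

Section Poincare.
Context {R : realType}.
Local Notation V2 := 'rV[R]_2.
Local Notation mu := (@lebesgue_measure R).
Implicit Types (U V : set V2).

Lemma near_bounded (T : topologicalType) (g : T -> R) x : {for x, continuous g} ->
  \forall y \near x, `|g y| <= `|g x| + 1.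
Proof.
move=> cg; have H := (cvgrPdist_lt _ _).1 cg _ (@ltr01 R).
near=> y; have : `|g x - g y| < 1 by near: y; exact: H.
rewrite distrC => h; have -> : g y = g x + (g y - g x) by ring.
by apply: le_trans (ler_normD _ _) _; rewrite lerD2l ltW.
Unshelve. all: end_near. Qed.

Lemma integrable01 (h : R -> R) : (forall t : R, 0 <= t <= 1 -> derivable h t 1) ->
  mu.-integrable `[0, 1]%classic (EFin \o h).
Proof.
move=> dh; apply: continuous_compact_integrable; first exact: segment_compact.
apply: derivable_within_continuous => t; rewrite in_itv /=; exact: dh.
Qed.

Lemma Rintegral_FTC01 (H h : R -> R) :
  (forall t : R, 0 <= t <= 1 -> is_derive t 1 H (h t)) ->
  (forall t : R, 0 <= t <= 1 -> derivable h t 1) ->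
  (\int[mu]_(t in `[0, 1]) h t)%R = H 1 - H 0.
Proof.
move=> dH dh.
have dc t : 0 <= t <= 1 -> {for t, continuous H}.
  move=> /dH D; apply: differentiable_continuous.
  by apply/derivable1_diffP; exact: (@ex_derive _ _ _ _ _ _ _ D).
rewrite /Rintegral (@continuous_FTC2 _ h H 0 1 ltr01)//.
- apply: derivable_within_continuous => t; rewrite in_itv /=; exact: dh.
- split.
  + move=> t; rewrite in_itv /= => /andP[t0 t1].
    by apply: (@ex_derive _ _ _ _ _ _ _ (dH t _)); rewrite !ltW.
  + by apply: cvg_at_right_filter; apply: dc; rewrite lexx ler01.
  + by apply: cvg_at_left_filter; apply: dc; rewrite lexx ler01.
- move=> t; rewrite in_itv /= => /andP[t0 t1].
  by rewrite derive1E (@derive_val _ _ _ _ _ _ _ (dH t _))// !ltW.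
Qed.

Variables (p : V2) (r M : R) (al : 'I_2 -> V2 -> R).
Hypothesis r0 : 0 < r.
Hypothesis sal : forall i, smooth_on (ball p r) (al i).
Hypothesis closed_al : forall x, ball p r x -> pd 0 (al 1) x = pd 1 (al 0) x.
Hypothesis bal : forall x i, ball p r x -> `|al i x| <= M.
Hypothesis bpal : forall x i j, ball p r x -> `|pd i (al j) x| <= M.

(** Integrating the form along the segment from p to x gives its primitive; the
    bound M on the form and on its partial derivatives serves to differentiate
    under the integral sign. *)
Let F (x : V2) (t : R) : R := \sum_j al j (p + t *: (x - p)) * (x - p) 0 j.
Let prim x := (\int[mu]_(t in `[0, 1]) F x t)%R.

Let seg x (t : R) : ball p r x -> 0 <= t <= 1 -> ball p r (p + t *: (x - p)).
Proof. by move=> bx t01; apply: ball_convex => //; exact: ballxx. Qed.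

Let closed_sym i j x : ball p r x -> pd i (al j) x = pd j (al i) x.
Proof.
by move=> bx; move: i j; apply: forall_I2; apply: forall_I2 => //; rewrite closed_al.
Qed.

Let der_t (g : V2 -> R) x (t : R) : smooth_on (ball p r) g -> ball p r x -> 0 <= t <= 1 ->
  is_derive t 1 (fun t : R => g (p + t *: (x - p)))
    (\sum_j (x - p) 0 j * pd j g (p + t *: (x - p))).
Proof.
move=> sg bx t01; rewrite sum_I2.
have -> : (x - p) 0 0 * pd 0 g (p + t *: (x - p)) + (x - p) 0 1 * pd 1 g (p + t *: (x - p))
   = 'd g (p + t *: (x - p)) (x - p) by rewrite diff_pd.
by apply: is_derive_line; apply: smooth_on_diff sg _; exact: seg.
Qed.

Let derivable_F x (t : R) : ball p r x -> 0 <= t <= 1 -> derivable (F x) t 1.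
Proof.
move=> bx t01; rewrite /F.
have d j : derivable (fun t : R => al j (p + t *: (x - p)) * (x - p) 0 j) t 1.
  apply: (@derivableM _ _ (fun t : R => al j (p + t *: (x - p))) (fun=> (x - p) 0 j)).
    exact: (@ex_derive _ _ _ _ _ _ _ (der_t (sal j) bx t01)).
  exact: derivable_cst.
rewrite (_ : (fun t => _) = (fun t : R => al 0 (p + t *: (x - p)) * (x - p) 0 0)
   + (fun t : R => al 1 (p + t *: (x - p)) * (x - p) 0 1)); first exact: derivableD.
by apply/funext => s; rewrite sum_I2.
Qed.

(** The derivative of the integrand F in the direction i, rewritten by
    closedness as the derivative of t al_i(p + t (x - p)) with respect to t. *)
Let DF i x t := t * \sum_j (x - p) 0 j * pd j (al i) (p + t *: (x - p)) + al i (p + t *: (x - p)).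

Let der_s i x (t : R) : ball p r x -> 0 <= t <= 1 ->
  is_derive (0 : R) 1 (fun s : R => F (x + s *: basis_vec i) t) (DF i x t).
Proof.
move=> bx t01; have bq := seg bx t01.
pose q := p + t *: (x - p); pose v := t *: basis_vec i : V2.
have d1 j : is_derive (0 : R) 1 (fun s : R => al j (q + s *: v)) (t * pd i (al j) q).
  have -> : t * pd i (al j) q = 'd (al j) (q + (0 : R) *: v) v.
    by rewrite scale0r addr0 /v pdE linearZ.
  by apply: is_derive_line; rewrite scale0r addr0; apply: smooth_on_diff (sal j) bq.
have d2 j : is_derive (0 : R) 1 (fun s : R => (x - p) 0 j + s * (basis_vec i : V2) 0 j)
   ((basis_vec i : V2) 0 j).
  by apply: is_derive_eq; rewrite /GRing.scale /= ?mulr0 ?mulr1 ?add0r mul1r.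
have d3 j := is_deriveM (d1 j) (d2 j).
have := is_deriveD (d3 0) (d3 1).
set d := (X in is_derive _ _ _ X -> _).
rewrite (_ : _ + _ = fun s : R => F (x + s *: basis_vec i) t); last first.
  apply/funext => s; rewrite /F sum_I2 fctE /=.
  have -> : p + t *: (x + s *: basis_vec i - p) = q + s *: v.
    by apply/matrixP => a b; rewrite !mxE; ring.
  by rewrite !fctE /= !mxE; ring.
move=> D; apply: is_derive_eq D _.
rewrite /d /DF sum_I2 !scale0r !addr0 !mul0r !addr0 -/q /GRing.scale /=.
rewrite !(closed_sym i _ bq) /basis_vec; move: (i); apply: forall_I2; rewrite !mxE /=; ring.
Qed.

Let bound_DF i x (t : R) : ball p r x -> 0 <= t <= 1 -> `|DF i x t| <= M * (2 * r + 1).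
Proof.
move=> bx t01; have bq := seg bx t01; rewrite /DF sum_I2.
have M0 : 0 <= M by apply: le_trans (bal 0 bx).
have c j : `|(x - p) 0 j| <= r.
  apply: le_trans (coord_le_norm _ _) _; apply: ltW.
  by move: bx; rewrite -ball_normE /= distrC.
have t1 : `|t| <= 1 by move: t01 => /andP[t0 t1]; rewrite ger0_norm.
apply: le_trans (ler_normD _ _) _.
rewrite (mulrDr M) mulr1; apply: lerD; last exact: bal.
rewrite normrM -[leRHS]mul1r; apply: ler_pM => //.
apply: le_trans (ler_normD _ _) _; rewrite !normrM.
have h j : `|(x - p) 0 j| * `|pd j (al i) (p + t *: (x - p))| <= r * M.
  by apply: ler_pM => //; exact: bpal.
by have := h 0; have := h 1; lra.
Qed.

(** Differentiate under the integral sign; the resulting integrand is a total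
    derivative in t, whose integral is al_i at the endpoint. *)
Let der_prim i x : ball p r x ->
  is_derive (0 : R) 1 (fun s : R => prim (x + s *: basis_vec i)) (al i x).
Proof.
move=> bx.
have [d d0 bd] : exists2 d : R, 0 < d & forall s : R, `|s| < d -> ball p r (x + s *: basis_vec i).
  have ob : open (ball p r) by exact: ball_open.
  have /nbhs_ballP[d /= d0 bd] := open_nbhs_nbhs (conj ob bx).
  exists d => // s sd; apply: bd; rewrite -[_ + _]addr0 -(scale0r (basis_vec i)).
  by apply: ball_basis; rewrite normr0 addr0.
pose f (s t : R) := F (x + s *: basis_vec i) t.
have I01 (t : R) : `[0, 1]%classic t -> 0 <= t <= 1 by rewrite /= in_itv.
have Id (s : R) : `](- d), d[%classic s -> ball p r (x + s *: basis_vec i).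
  by rewrite /= in_itv /= => ?; apply: bd; rewrite ltr_norml.
have I0 : `](- d), d[%classic (0 : R) by rewrite /= in_itv /= oppr_lt0 d0.
have der (s t : R) : `](- d), d[%classic s -> `[0, 1]%classic t ->
    is_derive s 1 (f ^~ t) (DF i (x + s *: basis_vec i) t).
  move=> /Id bs /I01 t01.
  have D0 : is_derive (s - s) 1 (fun s' : R => F (x + s *: basis_vec i + s' *: basis_vec i) t)
      (DF i (x + s *: basis_vec i) t).
    by rewrite subrr; exact: der_s.
  have D1 : is_derive s 1 (fun s' : R => s' - s) 1.
    by apply: is_derive_eq; rewrite subr0.
  have := @is_derive1_comp R _ (fun s' : R => s' - s) s _ _ D0 D1; rewrite mulr1.
  congr (is_derive _ _ _ _); apply/funext => s' /=; congr (F _ t).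
  by rewrite -addrA -scalerDl; congr (x + _ *: _); ring.
have mI : measurable (`[0, 1]%classic : set (measurableTypeR R)) by exact: measurable_itv.
have intf s : `](- d), d[%classic s -> mu.-integrable `[0, 1]%classic (EFin \o f s).
  by move=> /Id bs; apply: integrable01 => t; exact: derivable_F.
have derf1 s t : `](- d), d[%classic s -> `[0, 1]%classic t -> derivable (f ^~ t) s 1.
  by move=> hs ht; exact: (@ex_derive _ _ _ _ _ _ _ (der _ _ hs ht)).
have d1f s t : `](- d), d[%classic s -> `[0, 1]%classic t ->
    partial1of2 f s t = DF i (x + s *: basis_vec i) t.
  by move=> hs ht; rewrite partial1of2E (@derive_val _ _ _ _ _ _ _ (der _ _ hs ht)).
pose G (t : R) := `|M * (2 * r + 1)|.
have G0 t : 0 <= G t by exact: normr_ge0.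
have intG : mu.-integrable `[0, 1]%classic (EFin \o G).
  by apply: integrable01 => t _; exact: derivable_cst.
have Gub s t : `](- d), d[%classic s -> `[0, 1]%classic t -> `|partial1of2 f s t| <= G t.
  move=> hs ht; rewrite d1f//; apply: le_trans (bound_DF _ (Id _ hs) (I01 _ ht)) _.
  exact: ler_norm.
have dprim := derivable_under_integral mI I0 intf derf1 G0 intG Gub.
apply: DeriveDef; first exact: dprim.
rewrite -derive1E; apply: (etrans (differentiation_under_integral mI I0 intf derf1 G0 intG Gub)).
pose H t := t * al i (p + t *: (x - p)).
rewrite (eq_Rintegral mu (g := DF i x)); last first.
  by move=> t /set_mem ht; rewrite d1f// scale0r addr0.
have dH (t : R) : 0 <= t <= 1 -> is_derive t 1 H (DF i x t).
  move=> t01; have D := is_deriveM (is_derive_id t 1) (der_t (sal i) bx t01).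
  apply: is_derive_eq D _.
  by rewrite /DF /GRing.scale /= mulr1.
have dDF (t : R) : 0 <= t <= 1 -> derivable (DF i x) t 1.
  move=> t01; rewrite /DF.
  have dj j : derivable (fun t : R => (x - p) 0 j * pd j (al i) (p + t *: (x - p))) t 1.
    apply: (@derivableM _ _ (fun=> (x - p) 0 j) (fun t : R => pd j (al i) (p + t *: (x - p)))).
      exact: derivable_cst.
    exact: (@ex_derive _ _ _ _ _ _ _ (der_t (smooth_on_pd j (sal i)) bx t01)).
  apply: (@derivableD _ _ _ (fun t : R => t * _)); last first.
    exact: (@ex_derive _ _ _ _ _ _ _ (der_t (sal i) bx t01)).
  apply: (@derivableM _ _ id); first exact: derivable_id.
  have -> : (fun t : R => \sum_j (x - p) 0 j * pd j (al i) (p + t *: (x - p))) =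
    (fun t : R => (x - p) 0 0 * pd 0 (al i) (p + t *: (x - p)))
    + (fun t : R => (x - p) 0 1 * pd 1 (al i) (p + t *: (x - p))).
    by apply/funext => s; rewrite sum_I2.
  exact: (derivableD (dj 0) (dj 1)).
apply: (etrans (Rintegral_FTC01 dH dDF)).
by rewrite /H mul1r mul0r subr0 scale1r subrKC.
Qed.

(** The primitive has the smooth functions al_i as partial derivatives, so it is
    smooth. *)
Lemma poincare_ball : exists a, smooth_on (ball p r) a /\
  forall x i, ball p r x -> pd i a x = al i x.
Proof.
exists prim.
have ob : open (ball p r) by exact: ball_open.
have D x : ball p r x -> differentiable prim x /\ forall i, pd i prim x = al i x.
  move=> bx; apply: (differentiable_partials ob bx) => [i y by_|i]; first exact: der_prim.
  exact: smooth_on_cont (sal i) bx.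
split; last by move=> x i /D[].
apply/smooth_onP; split=> [x /D[]//|i].
by apply: smooth_on_eq ob _ (sal i) => x /D[_ ->].
Qed.

End Poincare.

Lemma le_sum_term (R : numDomainType) n (F : 'I_n -> R) i :
  (forall k, 0 <= F k) -> F i <= \sum_k F k.
Proof. by move=> F0; rewrite (bigD1 i)//= lerDl sumr_ge0. Qed.

Lemma poincare (R : realType) (U : set 'rV[R]_2) (p : 'rV[R]_2) (al : 'I_2 -> 'rV[R]_2 -> R) :
  open U -> U p -> (forall i, smooth_on U (al i)) ->
  (forall x, U x -> pd 0 (al 1) x = pd 1 (al 0) x) ->
  exists r a, [/\ 0 < r, ball p r `<=` U, smooth_on (ball p r) a &
    forall x i, ball p r x -> pd i a x = al i x].
Proof.
move=> oU Up sal cal.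
have ca i : {for p, continuous (al i)} by exact: smooth_on_cont (sal i) Up.
have cp i j : {for p, continuous (pd i (al j))}.
  by apply: smooth_on_cont Up; exact: smooth_on_pd.
(* Any common bound of the finitely many local bounds will do. *)
pose M := \sum_i (`|al i p| + 1) + \sum_i \sum_j (`|pd i (al j) p| + 1).
have N : \forall y \near p, [/\ U y, forall i, `|al i y| <= `|al i p| + 1 &
    forall i j, `|pd i (al j) y| <= `|pd i (al j) p| + 1].
  near=> y; split.
  - by near: y; exact: open_nbhs_nbhs.
  - by near: y; apply: filter_forall => i; apply: (near_bounded (ca i)).
  - by near: y; apply: filter_forall => i; apply: filter_forall => j; apply: (near_bounded (cp i j)).
have /nbhs_ballP[r /= r0 br] := N.
have bU : ball p r `<=` U by move=> y /br[].
have q1 k : 0 <= `|al k p| + 1 by rewrite addr_ge0.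
have q2 k l : 0 <= `|pd k (al l) p| + 1 by rewrite addr_ge0.
have pos1 : 0 <= \sum_i (`|al i p| + 1) by apply: sumr_ge0 => i _; rewrite addr_ge0.
have pos2 i : 0 <= \sum_j (`|pd i (al j) p| + 1) by apply: sumr_ge0 => j _; rewrite addr_ge0.
have pos3 : 0 <= \sum_i \sum_j (`|pd i (al j) p| + 1) by apply: sumr_ge0.
have [||x bx|x i bx|x i j bx|a [sa pa]] := @poincare_ball R p r M al.
- by [].
- by move=> i; exact: smooth_on_sub (sal i).
- by apply: cal; exact: bU.
- have [_ /(_ i) h _] := br _ bx; apply: le_trans h _.
  by apply: le_trans (le_sum_term i q1) _; rewrite lerDl.
- have [_ _ /(_ i j) h] := br _ bx; apply: le_trans h _.
  apply: le_trans (le_sum_term j (q2 i)) _.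
  apply: le_trans (le_sum_term i pos2) _.
  by rewrite lerDr.
by exists r, a.
Unshelve. all: end_near. Qed.

(** * Monodromy on simply connected spaces *)

Section Monodromy.
Context {R : realType} {T : topologicalType} {Y : Type}.

Definition germ_eq (p : T) (h k : T -> Y) := \forall q \near p, h q = k q.

Lemma germ_eq_refl p h : germ_eq p h h.
Proof. exact: nearW. Qed.

Lemma germ_eq_sym p h k : germ_eq p h k -> germ_eq p k h.
Proof. by apply: filterS => q ->. Qed.

Lemma germ_eq_trans p h k l : germ_eq p h k -> germ_eq p k l -> germ_eq p h l.
Proof. by apply: filterS2 => q -> ->. Qed.

Lemma germ_eq_open p h k : germ_eq p h k -> \forall q \near p, germ_eq q h k.
Proof. by move=> /nbhs_interior. Qed.

(** Connectedness of the line, in the form used to propagate a property along a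
    path: near every t the property cannot change from one point to another. *)
Lemma locally_constant (A : R -> Prop) (t0 : R) :
  (forall t : R, exists2 W : set R, nbhs t W & forall s s', W s -> W s' -> A s -> A s') ->
  A t0 -> forall t, A t.
Proof.
move=> lA A0 t.
have cR : connected [set: R] by apply/connected_intervalP.
suff E : A = setT :> set R by have : A t by rewrite E.
apply: cR; first by exists t0.
- exists A; last by rewrite setTI.
  rewrite openE => x Ax; have [W nW WA] := lA x.
  by apply: (filterS _ nW) => y Wy; apply: WA Ax => //; exact: nbhs_singleton nW.
- exists A; last by rewrite setTI.
  move=> x clx; have [W nW WA] := lA x; have [y [Ay Wy]] := clx _ nW.
  by apply: WA Ay => //; exact: nbhs_singleton nW.
Qed.

Lemma near_implies (Z : topologicalType) (A : Prop) (P : Z -> Prop) (z : Z) :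
  (A -> \forall z' \near z, P z') -> \forall z' \near z, A -> P z'.
Proof.
move=> AP; have [a|na] := pselect A; last by apply: nearW => z' /na.
by apply: filterS (AP a) => z' ?.
Qed.

Variable sol : T -> (T -> Y) -> Prop.
Hypothesis sol_open : forall (p : T) h, sol p h -> \forall q \near p, sol q h.
Hypothesis sol_germ : forall p h k, germ_eq p h k -> sol p h -> sol p k.
Hypothesis sol_ext : forall p : T, exists2 V : set T, nbhs p V &
  forall q h, V q -> sol q h -> exists2 h', (forall r, V r -> sol r h') & germ_eq q h h'.
Hypothesis sol_uniq : forall p h k, sol p h -> sol p k ->
  \forall q \near p, germ_eq q h k -> germ_eq p h k.

(** L z is the germ at g z of a solution. Coherence at z means that, for z' near
    z, all these germs come from a single solution; it plays the role of
    continuity of a path in the etale space of germs of solutions. *)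
Definition coherent_at (Z : topologicalType) (g : Z -> T) (L : Z -> T -> Y) (z : Z) :=
  exists h, \forall z' \near z, sol (g z') h /\ germ_eq (g z') (L z') h.

Lemma coherent_comp (Z Z' : topologicalType) (g : Z -> T) (L : Z -> T -> Y) (r : Z' -> Z) z :
  {for z, continuous r} -> coherent_at g L (r z) -> coherent_at (g \o r) (L \o r) z.
Proof. by move=> cr [h Hh]; exists h; exact: (cr _ Hh). Qed.

Lemma coherent_cst (Z : topologicalType) (g : Z -> T) h z :
  {for z, continuous g} -> sol (g z) h -> coherent_at g (fun=> h) z.
Proof.
move=> cg sh; exists h; have : \forall z' \near z, sol (g z') h by exact: (cg _ (sol_open sh)).
by apply: filterS => z' ?; split => //; exact: germ_eq_refl.
Qed.

Lemma coherent_sol (Z : topologicalType) (g : Z -> T) L z : coherent_at g L z -> sol (g z) (L z).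
Proof. by move=> [h /nbhs_singleton[sh e]]; apply: sol_germ sh; exact: germ_eq_sym. Qed.

Lemma coherent_near_eq (Z : topologicalType) (g g' : Z -> T) L L' z :
  (\forall z' \near z, g z' = g' z' /\ L z' = L' z') ->
  coherent_at g L z -> coherent_at g' L' z.
Proof. by move=> e [h Hh]; exists h; apply: filterS2 e Hh => z' [<- <-]. Qed.

(** Uniqueness of lifts: two lifts of one path that agree at one time agree at
    all times, because the set of times where they agree is open and closed. *)
Lemma coherent_uniq (g : R -> T) L L' t0 : continuous g ->
  (forall t : R, coherent_at g L t) -> (forall t : R, coherent_at g L' t) ->
  germ_eq (g t0) (L t0) (L' t0) -> forall t, germ_eq (g t) (L t) (L' t).
Proof.
move=> cg cL cL'; apply: locally_constant => t.
have [h Hh] := cL t; have [h' Hh'] := cL' t.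
have [[sh _] [sh' _]] := (nbhs_singleton Hh, nbhs_singleton Hh').
have U : \forall s \near t, germ_eq (g s) h h' -> germ_eq (g t) h h'.
  exact: cg t _ (sol_uniq sh sh').
have O : \forall s \near t, germ_eq (g t) h h' -> germ_eq (g s) h h'.
  by apply: near_implies => e; exact: cg t _ (germ_eq_open e).
exists [set s | [/\ germ_eq (g s) (L s) h, germ_eq (g s) (L' s) h',
  germ_eq (g s) h h' -> germ_eq (g t) h h' & germ_eq (g t) h h' -> germ_eq (g s) h h']].
  near=> s; have [_ a] : sol (g s) h /\ germ_eq (g s) (L s) h by near: s.
  have [_ b] : sol (g s) h' /\ germ_eq (g s) (L' s) h' by near: s.
  by split=> //; near: s.
move=> s s' [a b c _] [a' b' _ d'] e.
apply: germ_eq_trans a' _; apply: germ_eq_trans (germ_eq_sym b').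
apply/d'/c; apply: germ_eq_trans (germ_eq_sym a) _; exact: germ_eq_trans b.
Unshelve. all: end_near. Qed.

Definition glue (X : Type) (c : R) (f1 f2 : R -> X) (t : R) := if t <= c then f1 t else f2 t.

Lemma glue_continuous c (f1 f2 : R -> T) : continuous f1 -> continuous f2 -> f1 c = f2 c ->
  continuous (glue c f1 f2).
Proof.
move=> c1 c2 e t B; rewrite /glue.
have [tc|ct|->] := ltgtP t c => nB.
- have N : \forall s \near t, s < c by exact: lt_nbhsl.
  by apply: filterS2 N (c1 _ _ nB) => s sc Bs; rewrite /= ltW.
- have N : \forall s \near t, c < s by exact: lt_nbhsr.
  by apply: filterS2 N (c2 _ _ nB) => s sc Bs; rewrite /= leNgt sc.
- have nB2 : nbhs (f2 c) B by rewrite -e.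
  have M1 : \forall s \near c, B (f1 s) by exact: c1 c _ nB.
  have M2 : \forall s \near c, B (f2 s) by exact: c2 c _ nB2.
  suff : \forall s \near c, B (if s <= c then f1 s else f2 s) by [].
  near=> s; have B1 : B (f1 s) by near: s.
  have B2 : B (f2 s) by near: s.
  by case: ifP.
Unshelve. all: end_near. Qed.

Lemma coherent_glue c (f1 f2 : R -> T) L1 L2 t : continuous f2 ->
  f1 c = f2 c -> germ_eq (f1 c) (L1 c) (L2 c) ->
  (t <= c -> coherent_at f1 L1 t) -> (c <= t -> coherent_at f2 L2 t) ->
  coherent_at (glue c f1 f2) (glue c L1 L2) t.
Proof.
move=> cf2 e eL H1 H2; have [tc|ct|tc] := ltgtP t c.
- apply: coherent_near_eq (H1 (ltW tc)).
  have N : \forall s \near t, s < c by exact: lt_nbhsl.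
  by apply: filterS N => s sc; rewrite /glue ltW.
- apply: coherent_near_eq (H2 (ltW ct)).
  have N : \forall s \near t, c < s by exact: lt_nbhsr.
  by apply: filterS N => s sc; rewrite /glue leNgt sc.
subst t; have [h1 Hh1] := H1 (lexx c); have [h2 Hh2] := H2 (lexx c).
have [_ e1] := nbhs_singleton Hh1; have [_ e2] := nbhs_singleton Hh2.
have e12 : germ_eq (f2 c) h1 h2.
  rewrite -e; apply: germ_eq_trans (germ_eq_sym e1) _; apply: germ_eq_trans eL _.
  by rewrite e.
have N : \forall s \near c, germ_eq (f2 s) h1 h2 by exact: cf2 c _ (germ_eq_open e12).
exists h1; near=> s; rewrite /glue.
have [s1 g1] : sol (f1 s) h1 /\ germ_eq (f1 s) (L1 s) h1 by near: s.
have [s2 g2] : sol (f2 s) h2 /\ germ_eq (f2 s) (L2 s) h2 by near: s.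
have g12 : germ_eq (f2 s) h1 h2 by near: s.
case: ifP => // _; split; first exact: sol_germ (germ_eq_sym g12) s2.
exact: germ_eq_trans g2 (germ_eq_sym g12).
Unshelve. all: end_near. Qed.

(** Existence of lifts: the set of times up to which the path lifts is open and
    closed, since a germ extends to a full neighbourhood by sol_ext. *)
Lemma path_lift (g : R -> T) h0 : continuous g -> (forall t : R, t <= 0 -> g t = g 0) ->
  (forall t : R, 1 <= t -> g t = g 1) -> sol (g 0) h0 ->
  exists L, (forall t : R, coherent_at g L t) /\ forall t : R, t <= 0 -> L t = h0.
Proof.
move=> cg g0 g1 s0.
pose P t := exists L, (forall s : R, s <= t -> coherent_at g L s) /\ forall s : R, s <= 0 -> L s = h0.
have Pneg (t : R) : t <= 0 -> P t.
  move=> t0; exists (fun=> h0); split=> // s st; apply: coherent_cst; first exact: cg.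
  by rewrite g0// (le_trans st).
suff [L [cL L0]] : P 1.
  (* A lift up to time 1 is extended by its value at time 1, the path being
     constant afterwards. *)
  exists (fun t : R => L (Num.min t 1)); split; last first.
    by move=> t t0; rewrite min_l ?L0// (le_trans t0).
  move=> t; have E : g = g \o (fun t : R => Num.min t 1).
    apply/funext => s /=; case: (leP s 1) => // s1.
    by rewrite g1 ?ltW.
  rewrite {1}E.
  apply: (@coherent_comp _ _ g L (fun t : R => Num.min t 1)).
    by apply: (@continuous_min R R id (fun=> 1)); [exact: cvg_id|exact: cvg_cst].
  by apply: cL; rewrite ge_min lexx orbT.
apply: (@locally_constant P 0); last exact: Pneg.
move=> t; have [V nV Vext] := sol_ext (g t).
have /nbhs_ballP[e /= e0 be] := cg t _ nV.
exists (ball t e); first exact: nbhsx_ballx.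
move=> s s'; rewrite -ball_normE /= => bs bs' Ps.
have Vg x : `|t - x| < e -> V (g x) by move=> bx; apply: be; rewrite -ball_normE.
have [s'0|s'0] := leP s' 0; first exact: Pneg.
have [ss|ss] := leP s' s.
  have [L [cL L0]] := Ps; exists L; split=> // x xs; apply: cL; exact: le_trans ss.
pose m := Num.max s 0.
have Pm : P m by rewrite /m; case: (leP s 0) => // _; exact: Pneg.
have ms' : m < s' by rewrite gt_max ss.
have sm : s <= m by rewrite le_max lexx.
have bx x : s <= x <= s' -> `|t - x| < e.
  move=> /andP[x1 x2]; move: bs bs'; rewrite !ltr_norml => /andP[? ?] /andP[? ?].
  by apply/andP; split; lra.
have [L [cL L0]] := Pm.
have sL : sol (g m) (L m) by apply: coherent_sol; exact: cL.
have Vm : V (g m) by apply: Vg; apply: bx; rewrite sm ltW.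
have [h' Vh' e'] := Vext (g m) (L m) Vm sL.
exists (glue m L (fun=> h')); split; last first.
  by move=> x x0; rewrite /glue ifT ?L0// /m le_max x0 orbT.
move=> x xs'; have := @coherent_glue m g g L (fun=> h') x.
have -> : glue m g g = g by apply/funext => y; rewrite /glue; case: ifP.
apply => //; first by move=> xm; exact: cL.
move=> mx; apply: coherent_cst; first exact: cg.
by apply: Vh'; apply: Vg; apply: bx; rewrite xs' (le_trans sm).
Qed.

(** The retraction of the line onto the unit interval turns a path or a homotopy
    defined on the interval or the square into one defined everywhere, whose
    continuity needs no boundary cases. *)
Definition clamp (t : R) : R := Num.max 0 (Num.min t 1).

Lemma clamp_continuous : continuous clamp.
Proof.
move=> t; apply: (@continuous_max R R (fun=> 0) (fun t : R => Num.min t 1)); first exact: cvg_cst.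
by apply: (@continuous_min R R id (fun=> 1)); [exact: cvg_id|exact: cvg_cst].
Qed.

Lemma clamp_itv t : 0 <= clamp t <= 1.
Proof. by rewrite /clamp le_max lexx /= ge_max ler01 ge_min lexx orbT. Qed.

Lemma clamp_id t : 0 <= t <= 1 -> clamp t = t.
Proof. by move=> /andP[t0 t1]; rewrite /clamp min_l// max_r. Qed.

Lemma clamp0 t : t <= 0 -> clamp t = 0.
Proof. by move=> t0; rewrite /clamp min_l ?max_l// (le_trans t0). Qed.

Lemma clamp1 t : 1 <= t -> clamp t = 1.
Proof. by move=> t1; rewrite /clamp min_r// max_r. Qed.

Lemma continuous_pair (Z X1 X2 : topologicalType) (f : Z -> X1) (g : Z -> X2) z :
  {for z, continuous f} -> {for z, continuous g} -> {for z, continuous (fun x => (f x, g x))}.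
Proof.
move=> cf cg B [[A1 A2] /= [n1 n2] sub].
have m1 : \forall x \near z, A1 (f x) by exact: cf.
have m2 : \forall x \near z, A2 (g x) by exact: cg.
by apply: filterS2 m1 m2 => x a1 a2; exact: sub.
Qed.

Lemma near_fst (X1 X2 : topologicalType) (P : X1 -> Prop) (x : X1) (y : X2) :
  (\forall a \near x, P a) -> \forall z \near (x, y), P z.1.
Proof. by move=> nP; exists (P, setT); [split=> //; exact: filterT|move=> z []]. Qed.

Lemma near_snd (X1 X2 : topologicalType) (P : X2 -> Prop) (x : X1) (y : X2) :
  (\forall b \near y, P b) -> \forall z \near (x, y), P z.2.
Proof. by move=> nP; exists (setT, P); [split=> //; exact: filterT|move=> z []]. Qed.

(** Homotopy lifting: the lifts of the vertical segments, with a common initial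
    germ, fit together. Coherence of the family is propagated in the variable t,
    uniqueness of path lifts comparing each vertical lift with one fixed
    solution. *)
Lemma square_lift (H : R * R -> T) h0 : continuous H ->
  (forall s t : R, t <= 0 -> H (s, t) = H (0, 0)) -> (forall s t : R, 1 <= t -> H (s, t) = H (s, 1)) ->
  sol (H (0, 0)) h0 ->
  exists L, (forall z, coherent_at H L z) /\ forall s t : R, t <= 0 -> L (s, t) = h0.
Proof.
move=> cH H0 H1 s0.
have cHs s : continuous (fun t : R => H (s, t)).
  move=> t; apply: (@continuous_comp _ _ _ (fun t : R => (s, t)) H); last exact: cH.
  by apply: continuous_pair; [exact: cvg_cst|exact: cvg_id].
have lifts s : exists L, (forall t : R, coherent_at (fun t : R => H (s, t)) L t) /\
    forall t : R, t <= 0 -> L t = h0.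
  apply: path_lift; first exact: cHs.
  - by move=> t t0; rewrite !H0.
  - by move=> t t1; rewrite H1.
  - by rewrite H0.
have [Ls HL] := choice lifts.
exists (fun z => Ls z.1 z.2); split; last by move=> s t t0; have [_ ->] := HL s.
move=> [s t]; move: t.
apply: (@locally_constant (fun t : R => coherent_at H (fun z => Ls z.1 z.2) (s, t)) (-1)); last first.
  exists h0; have N : \forall z \near ((s, -1) : R * R), z.2 < 0.
    have N1 : \forall b \near (-1 : R), b < 0 by apply: lt_nbhsl; rewrite ltrN10.
    exact: (near_snd s N1).
  apply: filterS N => -[s' t'] /= t'0; rewrite H0 ?ltW//; split=> //.
  by have [_ ->] := HL s'; [exact: germ_eq_refl|exact: ltW].
move=> t; have [V nV Vext] := sol_ext (H (s, t)).
have /nbhs_ballP[e /= e0 be] := cH (s, t) _ nV.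
have HV s' t' : ball s e s' -> ball t e t' -> V (H (s', t')).
  by move=> b1 b2; apply: be; split.
exists (ball t e); first exact: nbhsx_ballx.
move=> t1 t2 b1 b2 C1; have [h Hh] := C1.
have [sh _] := nbhs_singleton Hh.
have [h' Vh' e'] := Vext _ _ (HV s t1 (ballxx _ e0) b1) sh.
have N0 : \forall z \near (s, t1), germ_eq (H z) h h' by exact: cH (s, t1) _ (germ_eq_open e').
have cp : {for s, continuous (fun s' : R => (s', t1))}.
  by apply: continuous_pair; [exact: cvg_id|exact: cvg_cst].
have Ns : \forall s' \near s, germ_eq (H (s', t1)) (Ls s' t1) h'.
  have M1 : \forall s' \near s, sol (H (s', t1)) h /\ germ_eq (H (s', t1)) (Ls s' t1) h.
    exact: cp _ Hh.
  have M2 : \forall s' \near s, germ_eq (H (s', t1)) h h' by exact: cp _ N0.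
  by apply: filterS2 M1 M2 => s' [_ a] b; exact: germ_eq_trans a b.
have Nt : \forall t' \near t2, ball t e t'.
  by apply: open_nbhs_nbhs; split=> //; exact: ball_open.
have Ne : \forall s' \near s, ball s e s' by exact: nbhsx_ballx.
have claim (s' t' : R) : germ_eq (H (s', t1)) (Ls s' t1) h' -> ball s e s' -> ball t e t' ->
    sol (H (s', t')) h' /\ germ_eq (H (s', t')) (Ls s' t') h'.
  move=> g1 bs' bt'.
  split; first by apply: Vh'; exact: HV.
  pose r tau := t1 + clamp tau * (t' - t1).
  have cr : continuous r.
    move=> tau; apply: cvgD; first exact: cvg_cst.
    by apply: cvgM; [exact: clamp_continuous|exact: cvg_cst].
  have br tau : ball t e (r tau).
    have /andP[c0 c1] := clamp_itv tau; rewrite /r.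
    move: b1 bt'; rewrite -!ball_normE /= => b1 bt'.
    pose m := Num.max `|t - t1| `|t - t'|.
    have me : m < e by rewrite gt_max b1.
    have h1 : `|t - t1| <= m by rewrite le_max lexx.
    have h2 : `|t - t'| <= m by rewrite le_max lexx orbT.
    apply: (le_lt_trans _ me); clear me; move: (clamp tau) m c0 c1 h1 h2 => c m c0 c1.
    rewrite !ler_norml => /andP[? ?] /andP[? ?].
    have c1' : 0 <= 1 - c by rewrite subr_ge0.
    by apply/andP; split; nra.
  have := @coherent_uniq (fun tau : R => H (s', r tau)) (fun tau : R => Ls s' (r tau)) (fun=> h') 0.
  have r0 : r 0 = t1 by rewrite /r clamp0// mul0r addr0.
  have r1 : r 1 = t' by rewrite /r clamp1// mul1r addrC subrK.
  move=> U; rewrite -r1; apply: U.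
  - move=> tau; apply: (@continuous_comp _ _ _ r (fun t : R => H (s', t))); first exact: cr.
    exact: cHs.
  - move=> tau; apply: (@coherent_comp _ _ (fun t : R => H (s', t)) (Ls s') r); first exact: cr.
    by have [] := HL s'.
  - move=> tau; apply: coherent_cst.
      apply: (@continuous_comp _ _ _ r (fun t : R => H (s', t))); first exact: cr.
      exact: cHs.
    by apply: Vh'; exact: HV.
  - by rewrite r0.
have Z1 := near_fst t2 Ns; have Z2 := near_fst t2 Ne; have Z3 := near_snd s Nt.
exists h'; near=> z.
have g1 : germ_eq (H (z.1, t1)) (Ls z.1 t1) h' by near: z.
have bs' : ball s e z.1 by near: z.
have bt' : ball t e z.2 by near: z.
by have := claim z.1 z.2 g1 bs' bt'; rewrite -surjective_pairing.
Unshelve. all: end_near. Qed.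

Lemma within_clamp (g : R -> T) : {within `[0, 1], continuous g} -> continuous (g \o clamp).
Proof.
move=> /subspace_continuousP cg t B nB.
have i01 : `[0, 1]%classic (clamp t) by rewrite /= in_itv /= clamp_itv.
have nW : \forall y \near clamp t, `[0, 1]%classic y -> B (g y) by exact: cg i01 _ nB.
have nC : \forall s \near t, `[0, 1]%classic (clamp s) -> B (g (clamp s)).
  exact: clamp_continuous nW.
apply: filterS nC => s; apply; by rewrite /= in_itv /= clamp_itv.
Qed.

Lemma within_clamp2 (H : R * R -> T) :
  {within `[0, 1] `*` `[0, 1], continuous H} ->
  continuous (fun z : R * R => H (clamp z.1, clamp z.2)).
Proof.
move=> /subspace_continuousP cH z B nB.
have i01 (y : R * R) : (`[0, 1] `*` `[0, 1]) (clamp y.1, clamp y.2).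
  by split; rewrite /= in_itv /= clamp_itv.
have nW : \forall y \near (clamp z.1, clamp z.2), (`[0, 1] `*` `[0, 1]) y -> B (H y).
  exact: cH (i01 z) _ nB.
have cc : {for z, continuous (fun z : R * R => (clamp z.1, clamp z.2))}.
  apply: (@continuous_pair (R * R)%type R R (fun z => clamp z.1) (fun z => clamp z.2)).
    apply: (@continuous_comp _ _ _ (fun z : R * R => z.1) clamp); last exact: clamp_continuous.
    by case: z {nB nW} => a b P nP; exact: near_fst.
  apply: (@continuous_comp _ _ _ (fun z : R * R => z.2) clamp); last exact: clamp_continuous.
  by case: z {nB nW} => a b P nP; exact: near_snd.
have nC : \forall s \near z, (`[0, 1] `*` `[0, 1]) (clamp s.1, clamp s.2) -> B (H (clamp s.1, clamp s.2)).
  exact: cc _ nW.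
by apply: filterS nC => s; apply.
Qed.

(** Homotopy invariance: along the other three sides of the square the homotopy
    is constant, so the lift of the loop returns to the initial germ. *)
Lemma loop_lift (l : R -> T) h0 : simply_connected R T -> continuous l ->
  (forall t : R, t <= 0 -> l t = l 0) -> (forall t : R, 1 <= t -> l t = l 0) ->
  sol (l 0) h0 ->
  exists L, [/\ forall t : R, coherent_at l L t, germ_eq (l 0) (L 0) h0 & germ_eq (l 0) (L 1) h0].
Proof.
move=> [_ sc] cl l0 l1 s0.
have [H0 [cH HH]] : null_homotopic l.
  by apply: sc; [exact: continuous_subspaceT|rewrite (l1 1)].
pose H z := H0 (clamp z.1, clamp z.2).
have cH' : continuous H by exact: within_clamp2.
have HHc s := HH _ (clamp_itv s).
have h01 : 0 <= (0 : R) <= 1 by rewrite lexx ler01.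
have c0 : clamp 0 = 0 by exact: clamp_id.
have Ht0 s t : t <= 0 -> H (s, t) = l 0.
  by move=> t0; rewrite /H /= (clamp0 t0); have [] := HHc s.
have Ht1 s t : 1 <= t -> H (s, t) = l 0.
  by move=> t1; rewrite /H /= (clamp1 t1); have [] := HHc s.
have H0l t : H (0, t) = l t.
  rewrite /H /= c0; have [-> _ _ _] := HHc t.
  have [t0|t0] := leP t 0; first by rewrite clamp0// l0.
  have [t1|t1] := leP 1 t; first by rewrite clamp1// !l1.
  by rewrite clamp_id// !ltW.
have H1l t : H (1, t) = l 0.
  by rewrite /H /= clamp1//; have [_ -> _ _] := HHc t.
have [L [cL L0]] : exists L, (forall z, coherent_at H L z) /\ forall s t : R, t <= 0 -> L (s, t) = h0.
  apply: square_lift => //.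
  - by move=> s t t0; rewrite !Ht0.
  - by move=> s t t1; rewrite !Ht1.
  - by rewrite Ht0.
have line (r : R -> R * R) : continuous r -> forall t, coherent_at (H \o r) (L \o r) t.
  by move=> cr t; apply: coherent_comp; [exact: cr|exact: cL].
have cst_line (r : R -> R * R) t1 t2 : continuous r -> (forall t, H (r t) = l 0) ->
    germ_eq (l 0) (L (r t1)) h0 -> germ_eq (l 0) (L (r t2)) h0.
  move=> cr Hr e.
  have E : H \o r = fun=> l 0 by apply/funext => t /=.
  have := @coherent_uniq (H \o r) (L \o r) (fun=> h0) t1; rewrite E /=.
  apply => //; first by move=> t; exact: cst_continuous.
    by rewrite -E; exact: line.
  by move=> t; apply: coherent_cst => //; exact: cst_continuous.
have e0 s t : t <= 0 -> germ_eq (l 0) (L (s, t)) h0.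
  by move=> t0; rewrite L0//; exact: germ_eq_refl.
have e11 : germ_eq (l 0) (L (1, 1)) h0.
  apply: (@cst_line (fun t : R => (1, t)) 0 1).
  - by move=> t; apply: continuous_pair; [exact: cvg_cst|exact: cvg_id].
  - exact: H1l.
  - exact: e0.
have e01 : germ_eq (l 0) (L (0, 1)) h0.
  apply: (@cst_line (fun t : R => (t, 1)) 1 0) => //.
  - by move=> t; apply: continuous_pair; [exact: cvg_id|exact: cvg_cst].
  - by move=> t; rewrite Ht1.
exists (fun t => L (0, t)); split=> //; last exact: e0.
move=> t; have -> : l = H \o (fun t : R => (0, t)) by apply/funext => s /=; rewrite H0l.
apply: line; move=> s; apply: continuous_pair; [exact: cvg_cst|exact: cvg_id].
Qed.

Hypothesis sc : simply_connected R T.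
Hypothesis locally_path_connected : forall (p : T) (U : set T), nbhs p U ->
  \forall q \near p, exists g : R -> T,
    [/\ continuous g, forall t : R, t <= 0 -> g t = p, forall t : R, 1 <= t -> g t = q &
        forall t : R, U (g t)].
Hypothesis sol_ex : forall p, exists h, sol p h.

(** Continue the germ h0 along paths from p0. Two paths to one point give a
    loop, which acts trivially on germs, so the continued germ depends on the
    point only. *)
Lemma global_section_at (p0 : T) : exists h, forall p, sol p h.
Proof.
have [h0 s0] := sol_ex p0.
pose rel p h := exists g L, [/\ continuous g, forall t : R, t <= 0 -> g t = p0,
  forall t : R, 1 <= t -> g t = p, forall t : R, coherent_at g L t
  & germ_eq p0 (L 0) h0 /\ germ_eq p (L 1) h].
have rel_sol p h : rel p h -> sol p h.
  move=> [g [L [_ _ g1 cL [_ e]]]]; apply: sol_germ e _.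
  by have := coherent_sol (cL 1); rewrite g1.
have rel_total p : exists h, rel p h.
  have [pc _] := sc; have [g [cg g0 g1]] := pc p0 p.
  pose g' := g \o clamp; have cg' : continuous g' by exact: within_clamp.
  have g'0 t : t <= 0 -> g' t = p0 by move=> t0; rewrite /g' /= clamp0.
  have g'1 t : 1 <= t -> g' t = p by move=> t0; rewrite /g' /= clamp1.
  have [L [cL L0]] : exists L, (forall t : R, coherent_at g' L t) /\ forall t : R, t <= 0 -> L t = h0.
    apply: path_lift => //.
    - by move=> t t0; rewrite !g'0.
    - by move=> t t0; rewrite !g'1.
    - by rewrite g'0.
  exists (L 1), g', L; split=> //; split; last exact: germ_eq_refl.
  by rewrite L0//; exact: germ_eq_refl.
have rel_uniq p h h' : rel p h -> rel p h' -> germ_eq p h h'.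
  move=> [g [L [cg g0 g1 cL [e0 e1]]]] [g' [L' [cg' g'0 g'1 cL' [e'0 e'1]]]].
  (* The loop runs through g and then backwards through g'. *)
  pose f1 (t : R) := g (2 * t); pose f2 (t : R) := g' (2 - 2 * t).
  pose l := glue 2^-1 f1 f2.
  have c2 : continuous (fun t : R => 2 * t).
    by move=> t; apply: cvgM; [exact: cvg_cst|exact: cvg_id].
  have c2' : continuous (fun t : R => 2 - 2 * t).
    by move=> t; apply: cvgB; [exact: cvg_cst|exact: c2].
  have cl : continuous l.
    apply: glue_continuous.
    - by move=> t; apply: (@continuous_comp _ _ _ (fun t : R => 2 * t) g); [exact: c2|exact: cg].
    - by move=> t; apply: (@continuous_comp _ _ _ (fun t : R => 2 - 2 * t) g'); [exact: c2'|exact: cg'].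
    - by rewrite /f1 /f2 g1 ?g'1//; lra.
  have l0 t : t <= 0 -> l t = p0.
    by move=> t0; rewrite /l /glue ifT /f1 ?g0//; lra.
  have l1 t : 1 <= t -> l t = p0.
    by move=> t0; rewrite /l /glue ifF /f2 ?g'0//; [lra|apply/negbTE; rewrite -ltNge; lra].
  have s0' : sol (l 0) h0 by rewrite l0.
  have [||M [cM M0 M1]] := loop_lift sc cl _ _ s0'.
    by move=> t t0; rewrite !l0.
    by move=> t t1; rewrite l1// l0.
  rewrite l0// in M0 M1.
  have cr1 : continuous (fun t : R => clamp t / 2).
    by move=> t; apply: cvgM; [exact: clamp_continuous|exact: cvg_cst].
  have cr2 : continuous (fun t : R => 1 - clamp t / 2).
    by move=> t; apply: cvgB; [exact: cvg_cst|exact: cr1].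
  have U1 : germ_eq p (M (2^-1)) (L 1).
    have E : g = l \o (fun t : R => clamp t / 2).
      apply/funext => t /=; have /andP[? ?] := clamp_itv t.
      rewrite /l /glue ifT /f1; last by lra.
      rewrite mulrC divfK//.
      have [t0|t0] := leP t 0; first by rewrite clamp0// !g0.
      have [t1|t1] := leP 1 t; first by rewrite clamp1// !g1.
      by rewrite clamp_id// !ltW.
    have := @coherent_uniq g (fun t => M (clamp t / 2)) L 0 cg _ cL _ 1.
    rewrite g0// g1// clamp0// clamp1// mul0r mul1r; apply.
      by move=> t; rewrite {1}E; apply: (@coherent_comp _ _ l M (fun t : R => clamp t / 2)); [exact: cr1|exact: cM].
    exact: germ_eq_trans M0 (germ_eq_sym e0).
  have U2 : germ_eq p (M (2^-1)) (L' 1).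
    have E : g' = l \o (fun t : R => 1 - clamp t / 2).
      apply/funext => t /=; have /andP[? ?] := clamp_itv t.
      have -> : l (1 - clamp t / 2) = f2 (1 - clamp t / 2).
        rewrite /l /glue; case: ifP => // h2; have E1 : clamp t = 1 by lra.
        by rewrite E1 /f1 /f2 g1 ?g'1//; lra.
      rewrite /f2 (_ : 2 - 2 * (1 - clamp t / 2) = clamp t); last by field.
      have [t0|t0] := leP t 0; first by rewrite clamp0// !g'0.
      have [t1|t1] := leP 1 t; first by rewrite clamp1// !g'1.
      by rewrite clamp_id// !ltW.
    have := @coherent_uniq g' (fun t => M (1 - clamp t / 2)) L' 0 cg' _ cL' _ 1.
    rewrite g'0// g'1// clamp0// clamp1// mul0r mul1r subr0 (_ : 1 - 2^-1 = 2^-1); last by field.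
    apply.
      by move=> t; rewrite {1}E; apply: (@coherent_comp _ _ l M (fun t : R => 1 - clamp t / 2)); [exact: cr2|exact: cM].
    exact: germ_eq_trans M1 (germ_eq_sym e'0).
  apply: germ_eq_trans (germ_eq_sym e1) _; apply: germ_eq_trans (germ_eq_sym U1) _.
  exact: germ_eq_trans U2 e'1.
have rel_near p h : rel p h -> \forall q \near p, rel q h.
  move=> rph; have := locally_path_connected (sol_open (rel_sol _ _ rph)).
  apply: filterS => q [k [ck k0 k1 Uk]].
  have [g [L [cg g0 g1 cL [e0 e1]]]] := rph.
  pose f1 (t : R) := g (2 * t); pose f2 (t : R) := k (2 * t - 1).
  have c2 : continuous (fun t : R => 2 * t).
    by move=> t; apply: cvgM; [exact: cvg_cst|exact: cvg_id].
  have c2' : continuous (fun t : R => 2 * t - 1).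
    by move=> t; apply: cvgB; [exact: c2|exact: cvg_cst].
  have cf1 : continuous f1.
    by move=> t; apply: (@continuous_comp _ _ _ (fun t : R => 2 * t) g); [exact: c2|exact: cg].
  have cf2 : continuous f2.
    by move=> t; apply: (@continuous_comp _ _ _ (fun t : R => 2 * t - 1) k); [exact: c2'|exact: ck].
  have h2 : 2 * 2^-1 = 1 :> R by field.
  have e12 : f1 2^-1 = f2 2^-1 by rewrite /f1 /f2 h2 subrr g1// k0.
  exists (glue 2^-1 f1 f2), (glue 2^-1 (fun t => L (2 * t)) (fun=> h)); split.
  - exact: glue_continuous.
  - by move=> t t0; rewrite /glue ifT /f1 ?g0//; lra.
  - by move=> t t1; rewrite /glue ifF /f2 ?k1//; [lra|apply/negbTE; rewrite -ltNge; lra].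
  - move=> t; apply: coherent_glue => //.
    + by rewrite /f1 h2 g1.
    + move=> _; apply: (@coherent_comp _ _ g L (fun t : R => 2 * t)); [exact: c2|exact: cL].
    + by move=> _; apply: coherent_cst; [exact: cf2|exact: Uk].
  - split; first by rewrite /glue ifT ?mulr0// invr_ge0.
    rewrite /glue ifF; first exact: germ_eq_refl.
    by apply/negbTE; rewrite -ltNge; lra.
have [hsel Hsel] := choice rel_total.
exists (fun q => hsel q q) => p; apply: sol_germ (rel_sol _ _ (Hsel p)).
apply: filterS (rel_near _ _ (Hsel p)) => q rq.
exact: nbhs_singleton (rel_uniq _ _ _ rq (Hsel q)).
Qed.

Theorem global_section : exists h, forall p, sol p h.
Proof.
have [[p0 _]|ne] := pselect (exists p : T, True); first exact: global_section_at.
have [h _] := @choice T Y (fun _ _ => True) (fun p => False_ind _ (ne (ex_intro _ p I))).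
by exists h => p; case: ne; exists p.
Qed.

End Monodromy.

(** Local solutions form a torsor under a group of transformations of the
    values: rigidity lets every germ extend to a neighbourhood by transforming a
    fixed local solution, and freeness makes two solutions that agree near some
    nearby point agree near the point itself. *)
Theorem rigid_global_section (R : realType) (T : topologicalType) (Y : Type)
    (sol : T -> (T -> Y) -> Prop) (G : (Y -> Y) -> Prop) :
  simply_connected R T ->
  (forall (p : T) (U : set T), nbhs p U ->
    \forall q \near p, exists g : R -> T,
    [/\ continuous g, forall t : R, t <= 0 -> g t = p, forall t : R, 1 <= t -> g t = q &
        forall t : R, U (g t)]) ->
  (forall (p : T) h, sol p h -> \forall q \near p, sol q h) ->
  (forall p h k, germ_eq p h k -> sol p h -> sol p k) ->
  (forall p, exists h, sol p h) ->
  (forall p h k, sol p h -> sol p k -> exists2 a, G a & germ_eq p k (a \o h)) ->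
  (forall p h a, G a -> sol p h -> sol p (a \o h)) ->
  (forall p h a, G a -> sol p h -> germ_eq p (a \o h) h -> forall y, a y = y) ->
  exists h, forall p, sol p h.
Proof.
move=> sc lpc sopen sgerm sex srigid sinv sfree.
apply: (@global_section R T Y sol) => //.
- move=> p; have [h0 s0] := sex p; exists [set q | sol q h0]; first exact: sopen.
  move=> q h /= sq0 sq; have [a Ga e] := srigid _ _ _ sq0 sq.
  by exists (a \o h0) => // r; exact: sinv.
- move=> p h k sh sk; have [a Ga e] := srigid _ _ _ sh sk.
  apply: filterS2 (germ_eq_open e) (sopen _ _ sh) => q e' shq ehk.
  have aid : forall y, a y = y.
    by apply: sfree Ga shq _; apply: germ_eq_sym; exact: germ_eq_trans ehk e'.
  apply: germ_eq_sym; apply: germ_eq_trans e _; apply: nearW => r; exact: aid.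
Qed.

(** * Changes of charts *)

Section Charts.
Context {R : realType} {S : surface R}.
Local Notation V2 := 'rV[R]_2.
Implicit Types (c : chart R S) (p q : S) (U V : set V2).

Lemma open_preimage (T T' : topologicalType) (h : T -> T') (U : set T) (V : set T') :
  open U -> (forall x, U x -> {for x, continuous h}) -> open V -> open (U `&` h @^-1` V).
Proof.
move=> oU ch oV; rewrite openE => x [Ux Vhx]; apply: filterI; first exact: open_nbhs_nbhs.
by apply: (ch x Ux); exact: open_nbhs_nbhs.
Qed.

Lemma cimg_cmap c p : cdom c p -> cimg c (cmap c p).
Proof. by move=> cp; exists p. Qed.

Lemma cinvK c x : atlas c -> cimg c x -> cmap c (cinv c x) = x /\ cdom c (cinv c x).
Proof. by move=> ac [p cp <-]; rewrite cmapK. Qed.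

Definition overlap c c' : set V2 := cmap c @` (cdom c `&` cdom c').

Lemma overlapE c c' : atlas c -> overlap c c' = cimg c `&` cinv c @^-1` cdom c'.
Proof.
move=> ac; apply/seteqP; split=> [x [p [cp c'p] <-]|x [cx c'x]].
  by split; [exact: cimg_cmap|rewrite /preimage /= cmapK].
by have [e d] := cinvK ac cx; exists (cinv c x).
Qed.

Lemma overlap_open c c' : atlas c -> atlas c' -> open (overlap c c').
Proof.
move=> ac ac'; rewrite overlapE//; apply: open_preimage (cimg_open ac) _ (cdom_open ac') => x cx.
exact: cinv_continuous.
Qed.

(** Every statement proved near a point in one chart is carried to another chart
    by this smooth change of coordinates, defined on an open set of the second
    chart. *)
Lemma transition c c' p V : atlas c -> atlas c' -> cdom c p -> cdom c' p ->
  open V -> V (cmap c p) ->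
  exists V', [/\ open V', V' (cmap c' p), V' `<=` cimg c',
    smooth_on V' (cmap c \o cinv c') &
    forall x, V' x -> [/\ V (cmap c (cinv c' x)), cdom c (cinv c' x) &
                          cinv c (cmap c (cinv c' x)) = cinv c' x]].
Proof.
move=> ac ac' cp c'p oV Vp; have sm := transition_smooth ac' ac.
exists (overlap c' c `&` (cmap c \o cinv c') @^-1` V).
have oO := overlap_open ac' ac; rewrite overlapE// in oO *; split.
- by apply: open_preimage oO _ oV => x Ox; apply: (smooth_on_cont sm); rewrite -/(overlap _ _) overlapE.
- split; first by split; [exact: cimg_cmap|rewrite /preimage /= cmapK].
  by rewrite /preimage /= cmapK.
- by move=> x [[]].
- by apply: smooth_on_sub sm => x [+ _]; rewrite -/(overlap _ _) overlapE.
- by move=> x [[c'x cx] Vx]; split => //; rewrite cmapK.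
Qed.

Lemma pd_id (x : V2) i : pd i (fun y : V2 => y) x = basis_vec i.
Proof.
have E : 'd (id : V2 -> V2) x = id :> (V2 -> V2) by exact: diff_val.
by rewrite pdE; exact: (congr1 (fun F : V2 -> V2 => F (basis_vec i)) E).
Qed.

Definition jacobian (t : V2 -> V2) (x : V2) : R :=
  pd 0 t x 0 0 * pd 1 t x 0 1 - pd 0 t x 0 1 * pd 1 t x 0 0.

Lemma det_basis (j00 j01 j10 j11 : R) (k0 k1 : V2) :
  basis_vec 0 = j00 *: k0 + j01 *: k1 -> basis_vec 1 = j10 *: k0 + j11 *: k1 ->
  j00 * j11 - j01 * j10 != 0.
Proof.
move=> E0 E1.
have E00 := congr1 (fun M : V2 => M 0 0) E0; have E01 := congr1 (fun M : V2 => M 0 1) E0.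
have E10 := congr1 (fun M : V2 => M 0 0) E1; have E11 := congr1 (fun M : V2 => M 0 1) E1.
rewrite !mxE /= in E00 E01 E10 E11; move: E00 E01 E10 E11.
move: (k0 0 0) (k0 0 1) (k1 0 0) (k1 0 1) => k00 k01 k10 k11 E00 E01 E10 E11.
apply/eqP => D0; have : (1 : R) = (j00 * j11 - j01 * j10) * (k00 * k11 - k01 * k10).
  transitivity ((j00 * k00 + j01 * k10) * (j10 * k01 + j11 * k11)
             - (j00 * k01 + j01 * k11) * (j10 * k00 + j11 * k10)); last by ring.
  by rewrite -E00 -E01 -E10 -E11; ring.
by rewrite D0 mul0r => /eqP; rewrite oner_eq0.
Qed.

(** The inverse change of coordinates is differentiable as well, so the product
    of the two Jacobian matrices is the identity. *)
Lemma transition_jacobian c c' p : atlas c -> atlas c' -> cdom c p -> cdom c' p ->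
  jacobian (cmap c \o cinv c') (cmap c' p) != 0.
Proof.
move=> ac ac' cp c'p; rewrite /jacobian.
set t := cmap c \o cinv c'; set x := cmap c' p; pose t' := cmap c' \o cinv c.
have Ox : overlap c' c x by exists p.
have Otx : overlap c c' (t x) by exists p => //; rewrite /t /x /= cmapK.
have dt : differentiable t x by exact: smooth_on_diff (transition_smooth ac' ac) Ox.
have dt' : differentiable t' (t x) by exact: smooth_on_diff (transition_smooth ac ac') Otx.
have E i : basis_vec i = pd i t x 0 0 *: pd 0 t' (t x) + pd i t x 0 1 *: pd 1 t' (t x).
  apply: etrans (pd_comp i dt dt'); rewrite -(pd_id x i).
  apply: esym; apply: (pd_open_eq i (overlap_open ac' ac) Ox); last exact: differentiable_comp.
  move=> y [q [c'q cq] <-]; by rewrite /t' /t /= !cmapK.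
exact: det_basis (E 0) (E 1).
Qed.

Lemma tdiffE (W : normedModType R) (F : S -> W) c p X :
  tdiff c F p X = X 0 0 *: pd 0 (F \o cinv c) (cmap c p) + X 0 1 *: pd 1 (F \o cinv c) (cmap c p).
Proof. exact: diff_pd. Qed.

(** The vector J X represents X in the other chart; it depends neither on the
    map F nor on its values, so that relations between several differentials are
    independent of the chart. *)
Lemma tdiff_chart c c' p : atlas c -> atlas c' -> cdom c p -> cdom c' p ->
  exists J : V2 -> V2, forall (W : normedModType R) (F : S -> W),
    differentiable (F \o cinv c) (cmap c p) -> forall X, tdiff c' F p X = tdiff c F p (J X).
Proof.
move=> ac ac' cp c'p; pose t := cmap c \o cinv c'; pose x := cmap c' p.
have Ox : overlap c' c x by exists p.
have dt : differentiable t x by exact: smooth_on_diff (transition_smooth ac' ac) Ox.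
exists ('d t x) => W F dF X.
have tx : t x = cmap c p by rewrite /t /x /= cmapK.
rewrite -tx in dF; have dc := differentiable_comp dt dF.
have [|_ E] := @diff_near_eq _ _ _ ((F \o cinv c) \o t) (F \o cinv c') x _ dc.
  apply: (open_near (overlap_open ac' ac) Ox) => y [q [c'q cq] <-].
  by rewrite /t /= !cmapK.
rewrite /tdiff -/x -tx; apply: (etrans (congr1 (fun H : V2 -> W => H X) E)).
exact: (congr1 (fun H : V2 -> W => H X) (diff_comp dt dF)).
Qed.

Lemma Ck_local (W : normedModType R) k U (h : V2 -> W) :
  (forall x, U x -> exists V, V x /\ Ck k V h) -> Ck k U h.
Proof.
elim: k h => [|k IH] h H /=.
  by move=> x /H [V [Vx]]; apply.
split=> [x /H [V [Vx [dh _]]]|i]; first exact: dh.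
by apply: IH => x /H [V [Vx [_ ph]]]; exists V; split=> //; exact: ph.
Qed.

Lemma smooth_local (F : S -> R) :
  (forall p, exists c V, [/\ atlas c, cdom c p, open V, V (cmap c p) & smooth_on V (F \o cinv c)]) ->
  smooth F.
Proof.
move=> H c' ac' k; apply: Ck_local => _ [p c'p <-].
have [c [V [ac cp oV Vp sF]]] := H p.
have [V' [oV' V'p V'c st H']] := transition ac ac' cp c'p oV Vp.
exists V'; split=> //.
have VV x : V' x -> V ((cmap c \o cinv c') x) by move=> /H' [].
apply: (smooth_on_eq oV' _ (smooth_on_comp oV oV' VV st sF)).
by move=> x /H' [_ _ e] /=; rewrite e.
Qed.

Lemma tangent_plane_chart (W : normedModType R) (F : S -> W) c p w : smooth F -> atlas c ->
  cdom c p -> tangent_plane F p w -> exists X, w = tdiff c F p X.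
Proof.
move=> sF ac cp [c' [X [ac' c'p ->]]].
have [J JE] := tdiff_chart ac ac' cp c'p; exists (J X); apply: JE.
exact: smooth_on_diff (sF c ac) (cimg_cmap cp).
Qed.

End Charts.

(** * Orthonormal frames of Euclidean four-space *)

Section Frames.
Context {R : realType}.
Local Notation V2 := 'rV[R]_2.
Local Notation V4 := 'rV[R]_4.

Lemma dotpC n (x y : 'rV[R]_n) : dotp x y = dotp y x.
Proof. by apply: eq_bigr => i _; rewrite mulrC. Qed.

Lemma dotpDl n (x y z : 'rV[R]_n) : dotp (x + y) z = dotp x z + dotp y z.
Proof. by rewrite /dotp -big_split; apply: eq_bigr => i _; rewrite mxE mulrDl. Qed.

Lemma dotpZl n k (x z : 'rV[R]_n) : dotp (k *: x) z = k * dotp x z.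
Proof. by rewrite /dotp mulr_sumr; apply: eq_bigr => i _; rewrite mxE mulrA. Qed.

Lemma dotpNl n (x z : 'rV[R]_n) : dotp (- x) z = - dotp x z.
Proof. by rewrite -scaleN1r dotpZl mulN1r. Qed.

Lemma dotpDr n (x y z : 'rV[R]_n) : dotp z (x + y) = dotp z x + dotp z y.
Proof. by rewrite dotpC dotpDl !(dotpC z). Qed.

Lemma dotpZr n k (x z : 'rV[R]_n) : dotp z (k *: x) = k * dotp z x.
Proof. by rewrite dotpC dotpZl (dotpC z). Qed.

Lemma dotpNr n (x z : 'rV[R]_n) : dotp z (- x) = - dotp z x.
Proof. by rewrite dotpC dotpNl (dotpC z). Qed.

Definition dotpE := (dotpDl, dotpDr, dotpZl, dotpZr, dotpNl, dotpNr).

Lemma dotp0l n (z : 'rV[R]_n) : dotp 0 z = 0.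
Proof. by rewrite -(scale0r 0) dotpZl mul0r. Qed.

Lemma dotp_ge0 n (x : 'rV[R]_n) : 0 <= dotp x x.
Proof. by apply: sumr_ge0 => i _; rewrite -expr2 sqr_ge0. Qed.

Lemma dotp_eq0 n (x : 'rV[R]_n) : dotp x x = 0 -> x = 0.
Proof.
move=> /eqP; rewrite psumr_eq0 => [/allP x0|i _]; last by rewrite -expr2 sqr_ge0.
apply/rowP => i; rewrite mxE; apply/eqP.
by have := x0 i (mem_index_enum i); rewrite /= mulf_eq0 orbb.
Qed.

Lemma dotp_gt0 n (x : 'rV[R]_n) : x != 0 -> 0 < dotp x x.
Proof.
move=> x0; rewrite lt_neqAle dotp_ge0 andbT eq_sym; apply/eqP => /dotp_eq0 /eqP.
by rewrite (negbTE x0).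
Qed.

Record oframe (e1 e2 n1 n2 : V4) : Prop := OFrame {
  of11 : dotp e1 e1 = 1; of12 : dotp e1 e2 = 0;
  of13 : dotp e1 n1 = 0; of14 : dotp e1 n2 = 0;
  of22 : dotp e2 e2 = 1; of23 : dotp e2 n1 = 0; of24 : dotp e2 n2 = 0;
  of33 : dotp n1 n1 = 1; of34 : dotp n1 n2 = 0; of44 : dotp n2 n2 = 1 }.

Definition j0 : 'I_4 := @Ordinal 4 0 isT.
Definition j1 : 'I_4 := @Ordinal 4 1 isT.
Definition j2 : 'I_4 := @Ordinal 4 2 isT.
Definition j3 : 'I_4 := @Ordinal 4 3 isT.

Lemma sum_I4 (V : nmodType) (F : 'I_4 -> V) : \sum_i F i = F j0 + F j1 + F j2 + F j3.
Proof.
rewrite !big_ord_recl big_ord0 addr0 !addrA.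
by congr (F _ + F _ + F _ + F _); apply: val_inj.
Qed.

Lemma forall_I4 (P : 'I_4 -> Prop) : P j0 -> P j1 -> P j2 -> P j3 -> forall i, P i.
Proof.
move=> P0 P1 P2 P3 [[|[|[|[|//]]]] Hi].
- by rewrite (_ : Ordinal Hi = j0)//; apply: val_inj.
- by rewrite (_ : Ordinal Hi = j1)//; apply: val_inj.
- by rewrite (_ : Ordinal Hi = j2)//; apply: val_inj.
- by rewrite (_ : Ordinal Hi = j3)//; apply: val_inj.
Qed.

(** A matrix with orthonormal rows has orthonormal columns. *)
Lemma oframe_expand e1 e2 n1 n2 (x : V4) : oframe e1 e2 n1 n2 ->
  x = dotp x e1 *: e1 + dotp x e2 *: e2 + dotp x n1 *: n1 + dotp x n2 *: n2.
Proof.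
move=> o; have [q11 q12 q13 q14 q22 q23 q24 q33 q34 q44] := o.
pose F (i : 'I_4) : V4 := match val i with 0 => e1 | 1 => e2 | 2 => n1 | _ => n2 end.
pose M : 'M[R]_4 := \matrix_(i, j) F i 0 j.
have MM : M *m M^T = 1%:M.
  apply/matrixP => i k; rewrite !mxE (_ : \sum_j _ = dotp (F i) (F k)); last first.
    by apply: eq_bigr => j _; rewrite !mxE.
  have qE := (q11, q12, q13, q14, q22, q23, q24, q33, q34, q44).
  by move: i k; apply: forall_I4; apply: forall_I4; rewrite /F /=; rewrite ?qE // dotpC qE.
have Ex : x = (x *m M^T) *m M by rewrite -mulmxA (mulmx1C MM) mulmx1.
rewrite {1}Ex; apply/rowP => k; rewrite mxE sum_I4 !mxE.
by congr (_ * _ + _ * _ + _ * _ + _ * _); apply: eq_bigr => j _; rewrite !mxE.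
Qed.

Lemma oframe_dotp e1 e2 n1 n2 (x y : V4) : oframe e1 e2 n1 n2 ->
  dotp x y = dotp x e1 * dotp y e1 + dotp x e2 * dotp y e2
    + dotp x n1 * dotp y n1 + dotp x n2 * dotp y n2.
Proof.
by move=> o; rewrite {1}(oframe_expand x o) !dotpE !(dotpC _ y).
Qed.

(** The contraction of the vector c with the Hodge dual of the bivector G. For G
    = a /\ b it is the vector product of a, b and c, which provides the fourth
    vector of an orthonormal frame in a smooth way. *)
Definition star (G : 'M[R]_4) (c : V4) : V4 :=
  \row_k match val k with
  | 0 => G j1 j2 * c 0 j3 - G j1 j3 * c 0 j2 + G j2 j3 * c 0 j1
  | 1 => - (G j0 j2 * c 0 j3 - G j0 j3 * c 0 j2 + G j2 j3 * c 0 j0)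
  | 2 => G j0 j1 * c 0 j3 - G j0 j3 * c 0 j1 + G j1 j3 * c 0 j0
  | _ => - (G j0 j1 * c 0 j2 - G j0 j2 * c 0 j1 + G j1 j2 * c 0 j0)
  end.

Lemma wedgeE (a b : V4) i j : wedge a b i j = a 0 i * b 0 j - b 0 i * a 0 j.
Proof. by rewrite !mxE !big_ord1 !mxE. Qed.

Lemma star_orth (a b c : V4) :
  [/\ dotp (star (wedge a b) c) a = 0, dotp (star (wedge a b) c) b = 0
    & dotp (star (wedge a b) c) c = 0].
Proof.
by split; rewrite /dotp sum_I4 /star !mxE /= !big_ord1 !mxE; ring.
Qed.

(** The right-hand side is the Gram determinant of a, b and c. *)
Lemma star_norm (a b c : V4) :
  dotp (star (wedge a b) c) (star (wedge a b) c) =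
  dotp a a * (dotp b b * dotp c c - dotp b c * dotp b c)
  - dotp a b * (dotp a b * dotp c c - dotp b c * dotp a c)
  + dotp a c * (dotp a b * dotp b c - dotp b b * dotp a c).
Proof.
by rewrite /dotp !sum_I4 /star !mxE /= !big_ord1 !mxE; ring.
Qed.

Lemma star_oframe (a b c : V4) : dotp a a = 1 -> dotp b b = 1 -> dotp c c = 1 ->
  dotp a b = 0 -> dotp a c = 0 -> dotp b c = 0 -> oframe a b c (star (wedge a b) c).
Proof.
move=> aa bb cc ab ac bc; have [sa sb sc] := star_orth a b c.
split => //; rewrite 1?dotpC// star_norm aa bb cc ab ac bc; ring.
Qed.

End Frames.

(** * Connection forms *)

Section LocalFrames.
Context {R : realType}.
Local Notation V2 := 'rV[R]_2.
Local Notation V4 := 'rV[R]_4.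
Implicit Types (U V : set V2) (A B : V2 -> V4).

Definition om (i : 'I_2) A B (x : V2) : R := dotp (pd i A x) (B x).

Definition frame_on V (e1 e2 n1 n2 : V2 -> V4) :=
  [/\ smooth_on V e1, smooth_on V e2, smooth_on V n1, smooth_on V n2
    & forall x, V x -> oframe (e1 x) (e2 x) (n1 x) (n2 x)].

Lemma om_skew V A B (k : R) i x : open V -> smooth_on V A -> smooth_on V B ->
  (forall y, V y -> dotp (A y) (B y) = k) -> V x -> om i A B x = - om i B A x.
Proof.
move=> oV sA sB AB Vx.
have dA := smooth_on_diff sA Vx; have dB := smooth_on_diff sB Vx.
have E := pd_dotp i dA dB.
have E0 : pd i (fun y => dotp (A y) (B y)) x = 0.
  rewrite -(pd_cst k x i); apply: (pd_open_eq i oV Vx) => //.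
  exact: differentiable_dotp.
have E' : om i A B x + dotp (A x) (pd i B x) = 0 := etrans (esym E) E0.
move/eqP: E'; rewrite addr_eq0 => /eqP ->; congr (- _); exact: dotpC.
Qed.

Lemma om_self V A (k : R) i x : open V -> smooth_on V A ->
  (forall y, V y -> dotp (A y) (A y) = k) -> V x -> om i A A x = 0.
Proof. by move=> oV sA AA Vx; have := om_skew i oV sA sA AA Vx; lra. Qed.

Lemma smooth_om V A B i : open V -> smooth_on V A -> smooth_on V B -> smooth_on V (om i A B).
Proof. by move=> oV sA sB; apply: smooth_on_dotp => //; exact: smooth_on_pd. Qed.

(** The exterior derivative of <dA,B> is - <dA /\ dB>, because second
    derivatives commute. *)
Lemma om_curl V A B x : open V -> smooth_on V A -> smooth_on V B -> V x ->
  pd 0 (om 1 A B) x - pd 1 (om 0 A B) x =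
  dotp (pd 1 A x) (pd 0 B x) - dotp (pd 0 A x) (pd 1 B x).
Proof.
move=> oV sA sB Vx.
have dA i := smooth_on_diff (smooth_on_pd i sA) Vx; have dB := smooth_on_diff sB Vx.
have E := (pd_dotp 0 (dA 1) dB, pd_dotp 1 (dA 0) dB).
have -> : pd 0 (om 1 A B) x = dotp (pd 0 (pd 1 A) x) (B x) + dotp (pd 1 A x) (pd 0 B x).
  exact: E.1.
have -> : pd 1 (om 0 A B) x = dotp (pd 1 (pd 0 A) x) (B x) + dotp (pd 0 A x) (pd 1 B x).
  exact: E.2.
by rewrite (pd_comm 0 1 oV Vx sA) opprD addrACA subrr add0r.
Qed.

Lemma om_scale2 V (c s : V2 -> R) A B D i x : smooth_on V c -> smooth_on V s ->
  smooth_on V A -> smooth_on V B -> V x ->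
  om i (fun y => c y *: A y + s y *: B y) D x =
  pd i c x * dotp (A x) (D x) + c x * om i A D x
  + (pd i s x * dotp (B x) (D x) + s x * om i B D x).
Proof.
move=> sc ss sA sB Vx.
have dc := smooth_on_diff sc Vx; have ds := smooth_on_diff ss Vx.
have dA := smooth_on_diff sA Vx; have dB := smooth_on_diff sB Vx.
have lin (a b u v d : V4) (c1 c2 s1 s2 : R) :
    dotp ((c1 *: a + c2 *: u) + (s1 *: b + s2 *: v)) d
    = c1 * dotp a d + c2 * dotp u d + (s1 * dotp b d + s2 * dotp v d).
  by rewrite !dotpDl !dotpZl.
apply: etrans (lin _ _ _ _ _ _ _ _ _); congr (dotp _ _).
apply: (etrans (pdD i (differentiable_scale dc dA) (differentiable_scale ds dB))).
by congr (_ + _); [exact: pdZ|exact: pdZ].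
Qed.

Lemma smooth_scale2 V (c s : V2 -> R) A B : open V -> smooth_on V c -> smooth_on V s ->
  smooth_on V A -> smooth_on V B -> smooth_on V (fun y => c y *: A y + s y *: B y).
Proof. by move=> oV sc ss sA sB; apply: smooth_onD => //; exact: smooth_onZ. Qed.

Lemma open_pos V (h : V2 -> R) : open V -> smooth_on V h ->
  open [set x | V x /\ 0 < h x].
Proof.
move=> oV sh; rewrite openE => x [Vx hx].
have ch := smooth_on_cont sh Vx.
have N1 : \forall y \near x, V y by exact: open_nbhs_nbhs.
have N2 : \forall y \near x, 0 < h y by exact: (cvgr_gt (h x) ch 0 hx).
by apply: filterS2 N1 N2 => y ? ?; split.
Qed.

(** Here (a,b), (c,d) and (e,f), (g,h) are the values on a basis of two vector-
    valued forms P and Q. Each form has rank one and they commute in the sense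
    that <P_1,Q_0> = <P_0,Q_1>. Let Z be the value of Q on the kernel of P: it
    is not zero, since the kernels meet trivially, it spans the range of Q, and
    it is orthogonal to the range of P. So the two ranges are orthogonal, and
    the sum of mixed determinants does not vanish. *)
Lemma rank_one_forms (a b c d e f g h : R) :
  a * d - b * c = 0 -> e * h - f * g = 0 -> c * e + d * f = a * g + b * h ->
  (forall X Y, X * a + Y * c = 0 -> X * b + Y * d = 0 ->
     X * e + Y * g = 0 -> X * f + Y * h = 0 -> X = 0 /\ Y = 0) ->
  [/\ a * e + b * f = 0, a * g + b * h = 0, c * e + d * f = 0, c * g + d * h = 0
    & a * h - b * g + (e * d - f * c) != 0].
Proof.
have main a' b' c' d' e' f' g' h' : (a' != 0) || (b' != 0) ->
  a' * d' - b' * c' = 0 -> e' * h' - f' * g' = 0 -> c' * e' + d' * f' = a' * g' + b' * h' ->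
  (forall X Y : R, X * a' + Y * c' = 0 -> X * b' + Y * d' = 0 ->
     X * e' + Y * g' = 0 -> X * f' + Y * h' = 0 -> X = 0 /\ Y = 0) ->
  [/\ a' * e' + b' * f' = 0, a' * g' + b' * h' = 0, c' * e' + d' * f' = 0, c' * g' + d' * h' = 0
    & a' * h' - b' * g' + (e' * d' - f' * c') != 0].
  move: a' b' c' d' e' f' g' h' => {a b c d e f g h} a b c d e f g h ab0 pp qq sym reg.
  have n0 : a * a + b * b != 0.
    apply/eqP => n0; move: ab0; have := sqr_ge0 a; have := sqr_ge0 b; rewrite !expr2 => h1 h2.
    have a0 : a * a = 0 by lra.
    have b0 : b * b = 0 by lra.
    by move: a0 b0 => /eqP + /eqP; rewrite !mulf_eq0 !orbb => -> ->.
  pose l := (a * c + b * d) / (a * a + b * b).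
  have Ec : c = l * a.
    rewrite /l; apply: (mulfI n0); rewrite mulrA mulrCA mulfV// mulr1.
    have -> : (a * a + b * b) * c = (a * c + b * d) * a - b * (a * d - b * c) by ring.
    by rewrite pp; ring.
  have Ed : d = l * b.
    rewrite /l; apply: (mulfI n0); rewrite mulrA mulrCA mulfV// mulr1.
    have -> : (a * a + b * b) * d = (a * c + b * d) * b + a * (a * d - b * c) by ring.
    by rewrite pp; ring.
  (* The vector (-l, 1) spans the kernel of the first form, and Z is the value
     of the second form on it. *)
  pose Z1 := g - l * e; pose Z2 := h - l * f.
  have Zn : (Z1 != 0) || (Z2 != 0).
    rewrite -negb_and; apply/negP => /andP[/eqP z1 /eqP z2].
    have [||||_] := reg (- l) 1; rewrite ?Ec ?Ed; try ring.
    - by rewrite -z1 /Z1; ring.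
    - by rewrite -z2 /Z2; ring.
    - by move/eqP; rewrite oner_eq0.
  have aZ : a * Z1 + b * Z2 = 0.
    rewrite /Z1 /Z2; move: sym; rewrite Ec Ed; nra.
  have eZ : e * Z2 - f * Z1 = 0 by rewrite -qq /Z1 /Z2; ring.
  have ae : a * e + b * f = 0.
    case/orP: Zn => z0; apply: (mulfI z0); rewrite mulr0.
      have -> : Z1 * (a * e + b * f) = e * (a * Z1 + b * Z2) - b * (e * Z2 - f * Z1) by ring.
      by rewrite aZ eZ; ring.
    have -> : Z2 * (a * e + b * f) = f * (a * Z1 + b * Z2) + a * (e * Z2 - f * Z1) by ring.
    by rewrite aZ eZ; ring.
  have ce : c * e + d * f = 0.
    have -> : c * e + d * f = l * (a * e + b * f) by rewrite Ec Ed; ring.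
    by rewrite ae mulr0.
  have ag : a * g + b * h = 0 by rewrite -sym.
  split=> //.
    have -> : c * g + d * h = l * (a * g + b * h) by rewrite Ec Ed; ring.
    by rewrite ag mulr0.
  apply/eqP => M0; have aZ' : a * Z2 - b * Z1 = 0.
    by rewrite -M0 /Z1 /Z2 Ec Ed; ring.
  have z1 : Z1 = 0.
    apply: (mulfI n0); rewrite mulr0.
    have -> : (a * a + b * b) * Z1 = a * (a * Z1 + b * Z2) - b * (a * Z2 - b * Z1) by ring.
    by rewrite aZ aZ'; ring.
  have z2 : Z2 = 0.
    apply: (mulfI n0); rewrite mulr0.
    have -> : (a * a + b * b) * Z2 = b * (a * Z1 + b * Z2) + a * (a * Z2 - b * Z1) by ring.
    by rewrite aZ aZ'; ring.
  by move: Zn; rewrite z1 z2 eqxx.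
move=> pp qq sym reg.
(* If the first form vanishes on one basis vector, exchange the two basis
   vectors; if it vanishes identically, the second form has a kernel, which is
   then a common kernel. *)
case: (boolP ((a != 0) || (b != 0))) => [ab|]; first exact: main.
rewrite negb_or !negbK => /andP[/eqP a0 /eqP b0].
case: (boolP ((c != 0) || (d != 0))) => [cd|].
  have [|||X Y h1 h2 h3 h4|E1 E2 E3 E4 E5] := main c d a b g h e f cd.
  - by rewrite a0 b0; ring.
  - by rewrite -[RHS]oppr0 -qq; ring.
  - by rewrite -sym.
  - by have [] := reg Y X; rewrite 1?addrC// => -> ->.
  split=> //; move: E5; apply: contra => /eqP E; apply/eqP.
  by rewrite -[RHS]oppr0 -E; ring.
rewrite negb_or !negbK => /andP[/eqP c0 /eqP d0].
have k1 := reg (- g) e; have k2 := reg (- h) f; rewrite a0 b0 c0 d0 in k1 k2.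
have [||||g0 e0] := k1; try ring; first by rewrite -[RHS]qq; ring.
have [||||h0 f0] := k2; try ring; first by rewrite -[RHS]oppr0 -qq; ring.
have g0' : g = 0 by rewrite -[LHS]opprK g0 oppr0.
have h0' : h = 0 by rewrite -[LHS]opprK h0 oppr0.
have [] := reg 1 0; rewrite ?a0 ?b0 ?c0 ?d0 ?e0 ?f0 ?g0' ?h0'; try ring.
by move/eqP; rewrite oner_eq0.
Qed.

End LocalFrames.

#[local] Opaque smooth_on.
(** * Diagonalization of the second fundamental form *)

Section LocalFrames.
Context {R : realType}.
Local Notation V2 := 'rV[R]_2.
Local Notation V4 := 'rV[R]_4.
Implicit Types (U V : set V2) (A B : V2 -> V4).

Definition no_common_kernel (a b c d e f g h : R) :=
  forall X Y, X * a + Y * c = 0 -> X * b + Y * d = 0 ->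
     X * e + Y * g = 0 -> X * f + Y * h = 0 -> X = 0 /\ Y = 0.

(** No nonzero vector is mapped into the normal plane by the derivatives of both
    normal fields; this is regularity of the Gauss map, expressed in a frame. *)
Definition regular_forms (t1 t2 n1 n2 : V2 -> V4) x :=
  no_common_kernel (om 0 n1 t1 x) (om 0 n1 t2 x) (om 1 n1 t1 x) (om 1 n1 t2 x)
    (om 0 n2 t1 x) (om 0 n2 t2 x) (om 1 n2 t1 x) (om 1 n2 t2 x).

(** The normal curvature in a frame: the shape operators of the two normal
    fields commute. *)
Definition ricci_eq (t1 t2 n1 n2 : V2 -> V4) x :=
  om 1 n1 t1 x * om 0 n2 t1 x + om 1 n1 t2 x * om 0 n2 t2 x
  = om 0 n1 t1 x * om 1 n2 t1 x + om 0 n1 t2 x * om 1 n2 t2 x.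

(** The determinant of the tangential part of dn; in an orthonormal normal frame
    the sum of these determinants is the Gauss curvature, up to the area
    element. *)
Definition shape_det (t1 t2 n : V2 -> V4) x :=
  om 0 n t1 x * om 1 n t2 x - om 0 n t2 x * om 1 n t1 x.

Definition mixed_det (t1 t2 n1 n2 : V2 -> V4) x :=
  om 0 n1 t1 x * om 1 n2 t2 x - om 0 n1 t2 x * om 1 n2 t1 x
  + (om 0 n2 t1 x * om 1 n1 t2 x - om 0 n2 t2 x * om 1 n1 t1 x).

Lemma oframe_rot_normal (e1 e2 n1 n2 : V4) (c s : R) : c * c + s * s = 1 ->
  oframe e1 e2 n1 n2 -> oframe e1 e2 (c *: n1 + s *: n2) ((- s) *: n1 + c *: n2).
Proof.
move=> cs [q11 q12 q13 q14 q22 q23 q24 q33 q34 q44].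
have q43 : dotp n2 n1 = 0 by rewrite dotpC.
split=> //; rewrite !dotpE ?q13 ?q14 ?q23 ?q24 ?q33 ?q34 ?q43 ?q44 ?(mulr0, mulr1, addr0, add0r); try rewrite -cs; ring.
Qed.

Lemma oframe_rot_tangent (e1 e2 n1 n2 : V4) (c s : R) : c * c + s * s = 1 ->
  oframe e1 e2 n1 n2 -> oframe (c *: e1 + s *: e2) ((- s) *: e1 + c *: e2) n1 n2.
Proof.
move=> cs [q11 q12 q13 q14 q22 q23 q24 q33 q34 q44].
have q21 : dotp e2 e1 = 0 by rewrite dotpC.
split=> //; rewrite !dotpE ?q11 ?q12 ?q21 ?q22 ?q13 ?q14 ?q23 ?q24 ?(mulr0, mulr1, addr0, add0r); try rewrite -cs; ring.
Qed.

(** The normalization 1 + C > 0 selects a branch of half the angle that is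
    smooth in C and S. *)
Lemma half_angle (C S : R) : C * C + S * S = 1 -> 0 < 1 + C ->
  let c := Num.sqrt ((1 + C) / 2) in let s := S / (2 * c) in
  [/\ 0 < c, c * c + s * s = 1, c * c - s * s = C & 2 * c * s = S].
Proof.
move=> CS C0 c s; have c0 : 0 < c by rewrite sqrtr_gt0 divr_gt0.
have cc : c * c = (1 + C) / 2 by rewrite -expr2 sqr_sqrtr// divr_ge0// ltW.
have cn : c != 0 by rewrite gt_eqF.
have cs : 2 * c * s = S by rewrite /s mulrC divfK// mulf_neq0// pnatr_eq0.
have ss : s * s = (1 - C) / 2.
  have c4 : 4 * (c * c) != 0 by rewrite mulf_neq0 ?pnatr_eq0// mulf_neq0.
  apply: (mulfI c4); rewrite [LHS](_ : _ = (2 * c * s) * (2 * c * s)); last by ring.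
  rewrite cs cc; have -> : S * S = 1 - C * C by rewrite -CS; ring.
  by field.
by split=> //; rewrite cc ss; field.
Qed.

(** Rotating the normal frame by t changes the determinant K of the first normal
    field into cos(2t) K + sin(2t) M, where M is half of the mixed determinant
    and the determinant of the second field is - K. By regularity M and K do not
    vanish together, so a smooth angle annihilating this expression exists. *)
Lemma rotate_normal U t1 t2 m1 m2 x0 : open U -> U x0 -> frame_on U t1 t2 m1 m2 ->
  (forall x, U x -> ricci_eq t1 t2 m1 m2 x) ->
  (forall x, U x -> shape_det t1 t2 m1 x + shape_det t1 t2 m2 x = 0) ->
  (forall x, U x -> regular_forms t1 t2 m1 m2 x) ->
  exists V n1 n2, [/\ open V, V x0, V `<=` U, frame_on V t1 t2 n1 n2 &
    forall x, V x -> [/\ shape_det t1 t2 n1 x = 0, shape_det t1 t2 n2 x = 0,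
      ricci_eq t1 t2 n1 n2 x & regular_forms t1 t2 n1 n2 x]].
Proof.
move=> oU Ux0 [st1 st2 sm1 sm2 fr] ric gau reg.
pose K := shape_det t1 t2 m1; pose M x := mixed_det t1 t2 m1 m2 x / 2.
have som i A B : smooth_on U A -> smooth_on U B -> smooth_on U (om i A B) by exact: smooth_om.
have spr A B t t' : smooth_on U A -> smooth_on U B -> smooth_on U t -> smooth_on U t' ->
    smooth_on U (fun x => om 0 A t x * om 1 B t' x - om 0 A t' x * om 1 B t x).
  by move=> sA sB st st'; apply: (smooth_onB oU); apply: (smooth_onM oU); exact: som.
have sK : smooth_on U K by exact: spr.
have sM : smooth_on U M.
  have s2 := smooth_onD oU (spr _ _ _ _ sm1 sm2 st1 st2) (spr _ _ _ _ sm2 sm1 st1 st2).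
  exact: (smooth_onM oU s2 (smooth_on_cst U (2^-1 : R))).
pose rr x := M x * M x + K x * K x.
have rr0 x : U x -> 0 < rr x.
  move=> Ux; rewrite lt_neqAle; apply/andP; split; last by rewrite addr_ge0// -expr2 sqr_ge0.
  rewrite eq_sym; apply/eqP => r0.
  have := sqr_ge0 (M x); have := sqr_ge0 (K x); rewrite !expr2 => h1 h2.
  have MM : M x * M x = 0 by move: r0; rewrite /rr; lra.
  have KK : K x * K x = 0 by move: r0; rewrite /rr; lra.
  have K0 : K x = 0 by move/eqP: KK; rewrite mulf_eq0 orbb => /eqP.
  have M0 : M x = 0 by move/eqP: MM; rewrite mulf_eq0 orbb => /eqP.
  have K0' : shape_det t1 t2 m2 x = 0 by have := gau _ Ux; rewrite -/(K x) K0 add0r.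
  have [_ _ _ _ /eqP] := rank_one_forms K0 K0' (ric _ Ux) (reg _ Ux); apply.
  by move/eqP: M0; rewrite /M mulf_eq0 invr_eq0 pnatr_eq0 orbF => /eqP.
(* The sign makes C nonnegative at x0, as half_angle requires near x0. *)
pose sg : R := if 0 <= M x0 then 1 else -1.
have sg2 : sg * sg = 1 by rewrite /sg; case: ifP => _; ring.
pose ir x := (Num.sqrt (rr x))^-1.
have srr : smooth_on U rr by apply: smooth_onD => //; exact: smooth_onM.
have sq0 x : U x -> 0 < Num.sqrt (rr x) by move=> /rr0; rewrite sqrtr_gt0.
have sir : smooth_on U ir.
  by apply: smooth_onV => // [x /sq0/gt_eqF->//|]; exact: smooth_on_sqrt.
(* Up to the sign, the cosine and sine of the double angle are proportional to
   M and - K. *)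
pose C x := sg * (M x * ir x); pose S x := - sg * (K x * ir x).
have sC : smooth_on U C.
  by apply: smooth_onM => //; [exact: smooth_on_cst|exact: smooth_onM].
have sS : smooth_on U S.
  by apply: smooth_onM => //; [exact: smooth_on_cst|exact: smooth_onM].
have irr x : U x -> ir x * ir x * rr x = 1.
  move=> Ux; have s0 := sq0 _ Ux; rewrite -[X in _ * X = _](sqr_sqrtr (ltW (rr0 _ Ux))) /ir expr2.
  by rewrite mulrACA mulVf ?mulr1// gt_eqF.
have CS x : U x -> C x * C x + S x * S x = 1.
  move=> Ux; rewrite -(irr _ Ux) -[RHS]mul1r -sg2 /C /S /rr.
  by move: (M x) (K x) (ir x) (sg) => {Ux} m k i g; ring.
have C0 : 0 < 1 + C x0.
  have i0 : 0 < ir x0 by rewrite invr_gt0 sq0.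
  rewrite ltr_wpDr// /C /sg; case: ifPn => h; first by rewrite mul1r mulr_ge0// ltW.
  rewrite mulN1r -mulNr; apply: mulr_ge0; last exact: ltW.
  by rewrite oppr_ge0 ltW// ltNge.
pose V := [set x | U x /\ 0 < 1 + C x].
have s1C : smooth_on U (fun x => 1 + C x) by apply: smooth_onD => //; exact: smooth_on_cst.
have oV : open V by exact: open_pos.
have VU : V `<=` U by move=> x [].
pose c x := Num.sqrt ((1 + C x) / 2); pose s x := S x / (2 * c x).
have HA x : V x -> [/\ 0 < c x, c x * c x + s x * s x = 1, c x * c x - s x * s x = C x
    & 2 * c x * s x = S x].
  by move=> [Ux hx]; apply: half_angle => //; exact: CS.
have sc : smooth_on V c.
  apply: smooth_on_sqrt => // [x [_ h]|]; first by rewrite divr_gt0.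
  apply: smooth_onM => //; last exact: smooth_on_cst.
  exact: smooth_on_sub s1C.
have ss : smooth_on V s.
  apply: smooth_onM => //; first exact: smooth_on_sub sS.
  apply: smooth_onV => // [x Vx|].
    by have [h _ _ _] := HA _ Vx; rewrite gt_eqF// mulr_gt0.
  by apply: smooth_onM => //; exact: smooth_on_cst.
have sns : smooth_on V (fun x => - s x) by exact: smooth_onN.
have vt1 : smooth_on V t1 by exact: smooth_on_sub st1.
have vt2 : smooth_on V t2 by exact: smooth_on_sub st2.
have vm1 : smooth_on V m1 by exact: smooth_on_sub sm1.
have vm2 : smooth_on V m2 by exact: smooth_on_sub sm2.
pose n1 x := c x *: m1 x + s x *: m2 x; pose n2 x := (- s x) *: m1 x + c x *: m2 x.
have lin0 (p u q v : R) : p * 0 + u + (q * 0 + v) = u + v by rewrite !mulr0 !add0r.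
have E1 i t x : V x -> (t = t1 \/ t = t2) -> om i n1 t x = c x * om i m1 t x + s x * om i m2 t x.
  move=> Vx ht; rewrite /n1 (om_scale2 t i sc ss vm1 vm2 Vx).
  have [q11 q12 q13 q14 q22 q23 q24 q33 q34 q44] := fr _ (VU _ Vx).
  have -> : dotp (m1 x) (t x) = 0 by case: ht => ->; rewrite dotpC.
  have -> : dotp (m2 x) (t x) = 0 by case: ht => ->; rewrite dotpC.
  exact: lin0.
have E2 i t x : V x -> (t = t1 \/ t = t2) -> om i n2 t x = - s x * om i m1 t x + c x * om i m2 t x.
  move=> Vx ht; rewrite /n2 (om_scale2 t i sns sc vm1 vm2 Vx).
  have [q11 q12 q13 q14 q22 q23 q24 q33 q34 q44] := fr _ (VU _ Vx).
  have -> : dotp (m1 x) (t x) = 0 by case: ht => ->; rewrite dotpC.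
  have -> : dotp (m2 x) (t x) = 0 by case: ht => ->; rewrite dotpC.
  exact: lin0.
exists V, n1, n2; split=> //.
  split=> //; [exact: smooth_scale2|exact: smooth_scale2|move=> x Vx].
  apply: oframe_rot_normal; first by have [] := HA _ Vx.
  by apply: fr; exact: VU.
move=> x Vx; have Ux := VU _ Vx; have [c0 cs c2 s2] := HA _ Vx.
have e1 i := (E1 i t1 x Vx (or_introl erefl), E1 i t2 x Vx (or_intror erefl)).
have e2 i := (E2 i t1 x Vx (or_introl erefl), E2 i t2 x Vx (or_intror erefl)).
have gx := gau _ Ux; have ricx := ric _ Ux.
have CK : C x * K x + S x * M x = 0.
  by rewrite /C /S; move: (M x) (K x) (ir x) (sg) => m k i g; ring.
rewrite -c2 -s2 /M /mixed_det /K /shape_det in CK.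
rewrite /shape_det in gx; rewrite /ricci_eq in ricx.
split.
- rewrite /shape_det !e1; move: CK gx.
  move: (om 0 m1 t1 x) (om 0 m1 t2 x) (om 1 m1 t1 x) (om 1 m1 t2 x)
   (om 0 m2 t1 x) (om 0 m2 t2 x) (om 1 m2 t1 x) (om 1 m2 t2 x) (c x) (s x).
  move=> {c2 s2 e1 e2 ricx} a b p d e f g h cc ss' CK gx.
  by rewrite -[RHS]CK -[RHS]addr0 -(mulr0 (ss' * ss')) -gx; field; rewrite ?pnatr_eq0.
- rewrite /shape_det !e2; move: CK gx.
  move: (om 0 m1 t1 x) (om 0 m1 t2 x) (om 1 m1 t1 x) (om 1 m1 t2 x)
   (om 0 m2 t1 x) (om 0 m2 t2 x) (om 1 m2 t1 x) (om 1 m2 t2 x) (c x) (s x).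
  move=> {c2 s2 e1 e2 ricx} a b p d e f g h cc ss' CK gx.
  by rewrite -[RHS]oppr0 -[in RHS]CK -[RHS]addr0 -(mulr0 (cc * cc)) -gx; field; rewrite ?pnatr_eq0.
- rewrite /ricci_eq !e1 !e2; move: ricx cs.
  move: (om 0 m1 t1 x) (om 0 m1 t2 x) (om 1 m1 t1 x) (om 1 m1 t2 x)
   (om 0 m2 t1 x) (om 0 m2 t2 x) (om 1 m2 t1 x) (om 1 m2 t2 x) (c x) (s x).
  move=> {c2 s2 e1 e2 gx CK} a b p d e f g h cc ss' ricx cs.
  apply/eqP; rewrite -subr_eq0; apply/eqP.
  rewrite [LHS](_ : _ = (cc * cc + ss' * ss') * ((p * e + d * f) - (a * g + b * h))); last by ring.
  by rewrite ricx subrr mulr0.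
- have := reg _ Ux; rewrite /regular_forms !e1 !e2; move: cs.
  move: (om 0 m1 t1 x) (om 0 m1 t2 x) (om 1 m1 t1 x) (om 1 m1 t2 x)
   (om 0 m2 t1 x) (om 0 m2 t2 x) (om 1 m2 t1 x) (om 1 m2 t2 x) (c x) (s x).
  move=> {c2 s2 e1 e2 gx CK ricx} a b p d e f g h cc ss' cs regx X Y h1 h2 h3 h4.
  have unrot u v : cc * u + ss' * v = 0 -> - ss' * u + cc * v = 0 -> u = 0 /\ v = 0.
    move=> k1 k2; split.
      have -> : u = cc * (cc * u + ss' * v) - ss' * (- ss' * u + cc * v).
        by rewrite -[LHS]mul1r -cs; ring.
      by rewrite k1 k2; ring.
    have -> : v = ss' * (cc * u + ss' * v) + cc * (- ss' * u + cc * v).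
      by rewrite -[LHS]mul1r -cs; ring.
    by rewrite k1 k2; ring.
  have [u1 v1] : X * a + Y * p = 0 /\ X * e + Y * g = 0.
    by apply: unrot; [rewrite -[RHS]h1; ring|rewrite -[RHS]h3; ring].
  have [u2 v2] : X * b + Y * d = 0 /\ X * f + Y * h = 0.
    by apply: unrot; [rewrite -[RHS]h2; ring|rewrite -[RHS]h4; ring].
  exact: regx.
Qed.

End LocalFrames.

Section LocalFrames.
Context {R : realType}.
Local Notation V2 := 'rV[R]_2.
Local Notation V4 := 'rV[R]_4.
Implicit Types (U V : set V2) (A B : V2 -> V4).

(** The frame diagonalizes the second fundamental form, and a, b are primitives
    of the two forms on the diagonal; by df_jac they are local coordinates. *)
Record diag_frame V (e1 e2 n1 n2 : V2 -> V4) (a b : V2 -> R) : Prop := DiagFrame {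
  df_frame : frame_on V e1 e2 n1 n2;
  df_a : smooth_on V a;
  df_b : smooth_on V b;
  df_12 : forall x i, V x -> om i e1 n2 x = 0;
  df_21 : forall x i, V x -> om i e2 n1 x = 0;
  df_da : forall x i, V x -> om i e1 n1 x = pd i a x;
  df_db : forall x i, V x -> om i e2 n2 x = pd i b x;
  df_jac : forall x, V x -> pd 0 a x * pd 1 b x - pd 1 a x * pd 0 b x != 0 }.

(** Two pairs of vectors spanning the same plane, in terms of the orthogonal
    complement, which is how tangency is used. *)
Definition same_plane (t1 t2 e1 e2 : V4) :=
  forall w, (dotp w t1 = 0 /\ dotp w t2 = 0) <-> (dotp w e1 = 0 /\ dotp w e2 = 0).

Lemma same_plane_rot (t1 t2 : V4) (c s : R) : c * c + s * s = 1 ->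
  same_plane t1 t2 (c *: t1 + s *: t2) ((- s) *: t1 + c *: t2).
Proof.
move=> cs w; rewrite !dotpE; move: (dotp w t1) (dotp w t2) => u v; split.
  by move=> [-> ->]; rewrite !mulr0 addr0.
move=> [h1 h2]; split.
  have -> : u = c * (c * u + s * v) - s * (- s * u + c * v) by rewrite -[LHS]mul1r -cs; ring.
  by rewrite h1 h2; ring.
have -> : v = s * (c * u + s * v) + c * (- s * u + c * v) by rewrite -[LHS]mul1r -cs; ring.
by rewrite h1 h2; ring.
Qed.

Lemma om_lin_r i A (c s : R) (t1 t2 : V4) x :
  dotp (pd i A x) (c *: t1 + s *: t2) = c * dotp (pd i A x) t1 + s * dotp (pd i A x) t2.
Proof. by rewrite dotpDr !dotpZr. Qed.

(** In the structure equation for <de1,n1> every term contains <de1,n2>,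
    <de2,n1> or a diagonal coefficient, and all of them vanish. *)
Lemma closed_diag V e1 e2 n1 n2 x : open V -> frame_on V e1 e2 n1 n2 ->
  (forall x i, V x -> om i e1 n2 x = 0) -> (forall x i, V x -> om i e2 n1 x = 0) -> V x ->
  pd 0 (om 1 e1 n1) x = pd 1 (om 0 e1 n1) x.
Proof.
move=> oV [s1 s2 sn1 sn2 fr] H12 H21 Vx.
have C := om_curl oV s1 sn1 Vx.
apply/eqP; rewrite -subr_eq0; apply/eqP; apply: (etrans C).
have z1 i : dotp (pd i e1 x) (e1 x) = 0 by apply: (om_self (k := 1) i oV s1 _ Vx) => y /fr [].
have z2 i : dotp (pd i n1 x) (n1 x) = 0 by apply: (om_self (k := 1) i oV sn1 _ Vx) => y /fr [].
have z3 i : dotp (pd i e1 x) (n2 x) = 0 by exact: H12.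
have z4 i : dotp (pd i n1 x) (e2 x) = 0.
  have E : om i n1 e2 x = - om i e2 n1 x.
    by apply: (om_skew (k := 0) i oV sn1 s2 _ Vx) => y Vy; rewrite dotpC; have [] := fr _ Vy.
  by rewrite H21// oppr0 in E.
have z (p1 q1 p2 q2 p3 q3 p4 q4 : R) : p1 = 0 -> q2 = 0 -> q3 = 0 -> p4 = 0 ->
    p1 * q1 + p2 * q2 + p3 * q3 + p4 * q4 = 0.
  by move=> -> -> -> ->; rewrite !mulr0 !mul0r !addr0.
have D i j : dotp (pd i e1 x) (pd j n1 x) = 0.
  apply: (etrans (oframe_dotp _ _ (fr _ Vx))); apply: z; [exact: z1|exact: z4|exact: z2|exact: z3].
by rewrite !D subrr.
Qed.

Lemma frame_swap V e1 e2 n1 n2 : frame_on V e1 e2 n1 n2 -> frame_on V e2 e1 n2 n1.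
Proof.
move=> [s1 s2 sn1 sn2 fr]; split=> // x /fr [q11 q12 q13 q14 q22 q23 q24 q33 q34 q44].
by split=> //; rewrite dotpC.
Qed.

Lemma sum_sqr_not_gt0 (u v : R) : ~ (0 < u * u + v * v) -> u = 0 /\ v = 0.
Proof.
move=> /negP; rewrite -leNgt => h; have := sqr_ge0 u; have := sqr_ge0 v.
rewrite !expr2 => h1 h2; have u0 : u * u = 0 by lra.
have v0 : v * v = 0 by lra.
by move: u0 v0 => /eqP + /eqP; rewrite !mulf_eq0 !orbb => /eqP -> /eqP ->.
Qed.

(** The vector e1 is the direction of a value of the tangential part of dn1 that
    does not vanish at x0. Since the ranges of the two tangential parts are
    orthogonal lines, e1 spans the first and e2 the second. *)
Lemma rotate_tangent V t1 t2 n1 n2 x0 : open V -> V x0 -> frame_on V t1 t2 n1 n2 ->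
  (forall x, V x -> [/\ shape_det t1 t2 n1 x = 0, shape_det t1 t2 n2 x = 0,
      ricci_eq t1 t2 n1 n2 x & regular_forms t1 t2 n1 n2 x]) ->
  exists V' e1 e2, [/\ open V', V' x0, V' `<=` V, frame_on V' e1 e2 n1 n2 &
    forall x, V' x -> [/\ forall i, om i e1 n2 x = 0, forall i, om i e2 n1 x = 0,
      om 0 e1 n1 x * om 1 e2 n2 x - om 1 e1 n1 x * om 0 e2 n2 x != 0 &
      same_plane (t1 x) (t2 x) (e1 x) (e2 x)]].
Proof.
move=> oV Vx0 [st1 st2 sn1 sn2 fr] H.
pose w i x := om i n1 t1 x * om i n1 t1 x + om i n1 t2 x * om i n1 t2 x.
have [i wi] : exists i, 0 < w i x0.
  have [d1 d2 ric reg] := H _ Vx0.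
  have [_ _ _ _] := rank_one_forms d1 d2 ric reg.
  have [w0|/sum_sqr_not_gt0[a0 b0]] := pselect (0 < w 0 x0); first by move=> _; exists 0.
  have [w1|/sum_sqr_not_gt0[c0 d0]] := pselect (0 < w 1 x0); first by move=> _; exists 1.
  by rewrite a0 b0 c0 d0 !mul0r !mulr0 !subr0 addr0 eqxx.
have sw : smooth_on V (w i).
  have s1 := smooth_om i oV sn1 st1; have s2 := smooth_om i oV sn1 st2.
  exact: (smooth_onD oV (smooth_onM oV s1 s1) (smooth_onM oV s2 s2)).
pose V' := [set x | V x /\ 0 < w i x].
have oV' : open V' by exact: open_pos.
have V'V : V' `<=` V by move=> x [].
pose ir x := (Num.sqrt (w i x))^-1.
have ir0 x : V' x -> 0 < ir x by move=> [_ h]; rewrite invr_gt0 sqrtr_gt0.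
have sir : smooth_on V' ir.
  apply: smooth_onV => // [x [_ h]|]; first by rewrite gt_eqF// sqrtr_gt0.
  by apply: smooth_on_sqrt => // [x []//|]; exact: smooth_on_sub sw.
pose c x := om i n1 t1 x * ir x; pose s x := om i n1 t2 x * ir x.
have vt1 : smooth_on V' t1 by exact: smooth_on_sub st1.
have vt2 : smooth_on V' t2 by exact: smooth_on_sub st2.
have vn1 : smooth_on V' n1 by exact: smooth_on_sub sn1.
have vn2 : smooth_on V' n2 by exact: smooth_on_sub sn2.
have sc : smooth_on V' c by apply: smooth_onM => //; exact: smooth_om.
have ss : smooth_on V' s by apply: smooth_onM => //; exact: smooth_om.
have sns : smooth_on V' (fun x => - s x) by exact: smooth_onN.
have cs x : V' x -> c x * c x + s x * s x = 1.
  move=> V'x; have [_ h] := V'x; have h0 := ltW h.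
  have -> : c x * c x + s x * s x = w i x * (ir x * ir x).
    rewrite /c /s /w; move: (om i n1 t1 x) (om i n1 t2 x) (ir x) => u v r; ring.
  rewrite -[X in X * _](sqr_sqrtr h0) /ir expr2 mulrACA mulfV ?mulr1//.
  by rewrite gt_eqF// sqrtr_gt0.
pose e1 x := c x *: t1 x + s x *: t2 x; pose e2 x := (- s x) *: t1 x + c x *: t2 x.
have se1 : smooth_on V' e1 by exact: smooth_scale2.
have se2 : smooth_on V' e2 by exact: smooth_scale2.
have fr' : frame_on V' e1 e2 n1 n2.
  split=> // x V'x; apply: oframe_rot_tangent; first exact: cs.
  by apply: fr; exact: V'V.
exists V', e1, e2; split=> // x V'x; have Vx := V'V _ V'x.
have [d1 d2 ric reg] := H _ Vx.
have [g1 g2 g3 g4 J] := rank_one_forms d1 d2 ric reg.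
have [_ _ _ _ frx] := fr'.
have sk e n j : smooth_on V' e -> smooth_on V' n -> (forall y, V' y -> dotp (e y) (n y) = 0) ->
    om j e n x = - om j n e x.
  by move=> se sn en; exact: (om_skew j oV' se sn en V'x).
have E1 n j : om j n e1 x = c x * om j n t1 x + s x * om j n t2 x by exact: om_lin_r.
have E2 n j : om j n e2 x = - s x * om j n t1 x + c x * om j n t2 x by exact: om_lin_r.
have k11 j : om j e1 n1 x = - om j n1 e1 x by apply: sk => // y /frx [].
have k12 j : om j e1 n2 x = - om j n2 e1 x by apply: sk => // y /frx [].
have k21 j : om j e2 n1 x = - om j n1 e2 x by apply: sk => // y /frx [].
have k22 j : om j e2 n2 x = - om j n2 e2 x by apply: sk => // y /frx [].
have csx := cs _ V'x.
have PQ j : om j n2 e1 x = 0.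
  rewrite E1 /c /s.
  have -> : om i n1 t1 x * ir x * om j n2 t1 x + om i n1 t2 x * ir x * om j n2 t2 x
     = ir x * (om i n1 t1 x * om j n2 t1 x + om i n1 t2 x * om j n2 t2 x).
    by move: (om i n1 t1 x) (om i n1 t2 x) (om j n2 t1 x) (om j n2 t2 x) (ir x) => *; ring.
  have -> : om i n1 t1 x * om j n2 t1 x + om i n1 t2 x * om j n2 t2 x = 0.
    by move: (i) (j); apply: forall_I2; apply: forall_I2.
  by rewrite mulr0.
have PP j : om j n1 e2 x = 0.
  rewrite E2 /c /s.
  have -> : - (om i n1 t2 x * ir x) * om j n1 t1 x + om i n1 t1 x * ir x * om j n1 t2 x
     = ir x * (om i n1 t1 x * om j n1 t2 x - om i n1 t2 x * om j n1 t1 x).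
    by move: (om i n1 t1 x) (om i n1 t2 x) (om j n1 t1 x) (om j n1 t2 x) (ir x) => *; ring.
  have -> : om i n1 t1 x * om j n1 t2 x - om i n1 t2 x * om j n1 t1 x = 0; last by rewrite mulr0.
  move: (i) (j); apply: forall_I2; apply: forall_I2.
  - by rewrite [X in _ - X]mulrC subrr.
  - exact: d1.
  - rewrite -[RHS]oppr0 -d1 /shape_det opprB.
    by rewrite [X in X - _]mulrC [X in _ - X]mulrC.
  - by rewrite [X in _ - X]mulrC subrr.
split.
- by move=> j; rewrite k12 PQ oppr0.
- by move=> j; rewrite k21 PP oppr0.
- rewrite !k11 !k22 !mulrNN; move: J; apply: contra => /eqP J0; apply/eqP.
  have R1 j : om j n1 t1 x = c x * om j n1 e1 x.
    have -> : om j n1 t1 x = c x * om j n1 e1 x - s x * om j n1 e2 x.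
      rewrite E1 E2 -[LHS]mul1r -csx; move: (om j n1 t1 x) (om j n1 t2 x) (c x) (s x) => *; ring.
    by rewrite PP mulr0 subr0.
  have R2 j : om j n1 t2 x = s x * om j n1 e1 x.
    have -> : om j n1 t2 x = s x * om j n1 e1 x + c x * om j n1 e2 x.
      rewrite E1 E2 -[LHS]mul1r -csx; move: (om j n1 t1 x) (om j n1 t2 x) (c x) (s x) => *; ring.
    by rewrite PP mulr0 addr0.
  have R3 j : om j n2 t1 x = - s x * om j n2 e2 x.
    have -> : om j n2 t1 x = c x * om j n2 e1 x - s x * om j n2 e2 x.
      rewrite E1 E2 -[LHS]mul1r -csx; move: (om j n2 t1 x) (om j n2 t2 x) (c x) (s x) => *; ring.
    by rewrite PQ mulr0 sub0r mulNr.
  have R4 j : om j n2 t2 x = c x * om j n2 e2 x.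
    have -> : om j n2 t2 x = s x * om j n2 e1 x + c x * om j n2 e2 x.
      rewrite E1 E2 -[LHS]mul1r -csx; move: (om j n2 t1 x) (om j n2 t2 x) (c x) (s x) => *; ring.
    by rewrite PQ mulr0 add0r.
  rewrite !R1 !R2 !R3 !R4; move: J0.
  move: (om 0 n1 e1 x) (om 1 n1 e1 x) (om 0 n2 e2 x) (om 1 n2 e2 x) (c x) (s x) csx.
  move=> {R1 R2 R3 R4 E1 E2} p q u v cc s1 csx J0.
  rewrite [LHS](_ : _ = (cc * cc + s1 * s1) * (p * v - q * u)); last by ring.
  by rewrite J0 mulr0.
- exact: same_plane_rot.
Qed.

Lemma diag_frame_exists U t1 t2 m1 m2 x0 : open U -> U x0 -> frame_on U t1 t2 m1 m2 ->
  (forall x, U x -> ricci_eq t1 t2 m1 m2 x) ->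
  (forall x, U x -> shape_det t1 t2 m1 x + shape_det t1 t2 m2 x = 0) ->
  (forall x, U x -> regular_forms t1 t2 m1 m2 x) ->
  exists r e1 e2 n1 n2 a b, [/\ 0 < r, ball x0 r `<=` U, diag_frame (ball x0 r) e1 e2 n1 n2 a b &
    forall x, ball x0 r x -> same_plane (t1 x) (t2 x) (e1 x) (e2 x)].
Proof.
move=> oU Ux0 fr ric gau reg.
have [V [n1 [n2 [oV Vx0 VU frV HV]]]] := rotate_normal oU Ux0 fr ric gau reg.
have [V' [e1 [e2 [oV' V'x0 V'V frV' HV']]]] := rotate_tangent oV Vx0 frV HV.
have h12 x i : V' x -> om i e1 n2 x = 0 by move=> /HV'[].
have h21 x i : V' x -> om i e2 n1 x = 0 by move=> /HV'[].
have [se1 se2 sn1 sn2 _] := frV'.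
have [|x V'x|r1 [a [r10 br1 sa pa]]] := poincare oV' V'x0 (al := fun i => om i e1 n1).
- by move=> i; exact: smooth_om.
- exact: (closed_diag oV' frV' h12 h21 V'x).
have [|x V'x|r2 [b [r20 br2 sb pb]]] := poincare oV' V'x0 (al := fun i => om i e2 n2).
- by move=> i; exact: smooth_om.
- exact: (closed_diag oV' (frame_swap frV') h21 h12 V'x).
pose r := Num.min r1 r2; have r0 : 0 < r by rewrite lt_min r10.
have b1 : ball x0 r `<=` ball x0 r1 by apply: le_ball; rewrite ge_min lexx.
have b2 : ball x0 r `<=` ball x0 r2 by apply: le_ball; rewrite ge_min lexx orbT.
have bV : ball x0 r `<=` V' by exact: subset_trans br1.
exists r, e1, e2, n1, n2, a, b; split=> //.
- by apply: subset_trans bV _; apply: subset_trans V'V _.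
- have [_ _ _ _ fr'] := frV'.
  split.
  + by split; try exact: smooth_on_sub bV _; move=> x /bV /fr'.
  + exact: smooth_on_sub sa.
  + exact: smooth_on_sub sb.
  + by move=> x i /bV; exact: h12.
  + by move=> x i /bV; exact: h21.
  + by move=> x i /b1 bx; rewrite pa.
  + by move=> x i /b2 bx; rewrite pb.
  + move=> x bx; have [_ _ J _] := HV' _ (bV _ bx).
    by rewrite !pa ?pb//; [exact: b2|exact: b2|exact: b1|exact: b1].
- by move=> x /bV /HV'[].
Qed.

End LocalFrames.

(** * The Gauss and Ricci equations *)

Section TangentFrame.
Context {R : realType}.
Local Notation V2 := 'rV[R]_2.
Local Notation V4 := 'rV[R]_4.
Implicit Types (U V : set V2) (A B : V2 -> V4).

Definition unitv A (x : V2) : V4 := (Num.sqrt (dotp (A x) (A x)))^-1 *: A x.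

Lemma smooth_unitv V A : open V -> (forall x, V x -> 0 < dotp (A x) (A x)) ->
  smooth_on V A -> smooth_on V (unitv A).
Proof.
move=> oV A0 sA; apply: smooth_onZ => //; apply: smooth_onV => // [x Vx|].
  by rewrite gt_eqF// sqrtr_gt0 A0.
by apply: smooth_on_sqrt => //; exact: smooth_on_dotp.
Qed.

Lemma unitv_norm A x : 0 < dotp (A x) (A x) -> dotp (unitv A x) (unitv A x) = 1.
Proof.
move=> A0; rewrite /unitv dotpZl dotpZr -[X in _ * (_ * X)](sqr_sqrtr (ltW A0)) expr2.
have n0 : Num.sqrt (dotp (A x) (A x)) != 0 by rewrite gt_eqF// sqrtr_gt0.
by rewrite mulKf// mulVf.
Qed.

Lemma dotp_unitv A x w : 0 < dotp (A x) (A x) -> (dotp w (unitv A x) = 0 <-> dotp w (A x) = 0).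
Proof.
move=> A0; have n0 : (Num.sqrt (dotp (A x) (A x)))^-1 != 0 by rewrite invr_neq0// gt_eqF// sqrtr_gt0.
rewrite /unitv dotpZr; split=> [/eqP|->]; last by rewrite mulr0.
by rewrite mulf_eq0 (negbTE n0) => /eqP.
Qed.

Lemma smooth_star V (G : V2 -> 'M[R]_4) (c : V2 -> V4) : open V ->
  smooth_on V G -> smooth_on V c -> smooth_on V (fun x => star (G x) (c x)).
Proof.
move=> oV /(smooth_on_mxP _ oV) sG /(smooth_on_mxP _ oV) sc.
apply/(smooth_on_mxP _ oV) => a k.
have P i j l : smooth_on V (fun x => G x i j * c x 0 l) by exact: smooth_onM.
have Q i j l i' j' l' i'' j'' l'' : smooth_on V
    (fun x => G x i j * c x 0 l - G x i' j' * c x 0 l' + G x i'' j'' * c x 0 l'').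
  exact: (smooth_onD oV (smooth_onB oV (P i j l) (P i' j' l')) (P i'' j'' l'')).
have N f : smooth_on V f -> smooth_on V (fun x => - f x : R) by exact: smooth_onN.
move: k; apply: forall_I4.
- apply: smooth_on_eq oV _ (Q j1 j2 j3 j1 j3 j2 j2 j3 j1) => x _; by rewrite mxE.
- apply: smooth_on_eq oV _ (N _ (Q j0 j2 j3 j0 j3 j2 j2 j3 j0)) => x _; by rewrite mxE.
- apply: smooth_on_eq oV _ (Q j0 j1 j3 j0 j3 j1 j1 j3 j0) => x _; by rewrite mxE.
- apply: smooth_on_eq oV _ (N _ (Q j0 j1 j2 j0 j2 j1 j1 j2 j0)) => x _; by rewrite mxE.
Qed.

Lemma smooth_wedge V A B : open V -> smooth_on V A -> smooth_on V B ->
  smooth_on V (fun x => wedge (A x) (B x)).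
Proof.
move=> oV /(smooth_on_mxP _ oV) sA /(smooth_on_mxP _ oV) sB.
apply/(smooth_on_mxP _ oV) => i j.
have P k l := smooth_onM oV (sA 0 k) (sB 0 l).
have P' k l := smooth_onM oV (sB 0 k) (sA 0 l).
apply: smooth_on_eq oV _ (smooth_onB oV (P i j) (P' i j)) => x _.
by rewrite wedgeE.
Qed.

Lemma orth_residual (w u v : V4) : dotp u u = 1 -> dotp v v = 1 -> dotp u v = 0 ->
  dotp u (w - dotp w u *: u - dotp w v *: v) = 0 /\
  dotp v (w - dotp w u *: u - dotp w v *: v) = 0.
Proof.
move=> uu vv uv; rewrite !dotpDr !dotpNr !dotpZr uu vv (dotpC v u) uv.
by rewrite (dotpC u w) (dotpC v w); split; ring.
Qed.

(** Otherwise t1 and t2 would span the whole space; every vector of the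
    canonical basis would lie in their span, and summing the squared coordinates
    of t1 and t2 would give 4 = 2. *)
Lemma exists_normal_vector (t1 t2 : V4) : dotp t1 t1 = 1 -> dotp t2 t2 = 1 -> dotp t1 t2 = 0 ->
  exists w : V4, w - dotp w t1 *: t1 - dotp w t2 *: t2 != 0.
Proof.
move=> h1 h2 h12; apply: contrapT => H.
have K k : t1 0 k * t1 0 k + t2 0 k * t2 0 k = 1.
  have D v : dotp (delta_mx 0 k) v = v 0 k.
    rewrite /dotp (bigD1 k)//= big1 => [|i ik]; rewrite !mxE !eqxx /=.
      by rewrite mul1r addr0.
    by rewrite (negbTE ik) mul0r.
  have E : delta_mx 0 k - t1 0 k *: t1 - t2 0 k *: t2 = 0 :> V4.
    by apply: contrapT => /eqP ne; apply: H; exists (delta_mx 0 k); rewrite !D.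
  have := congr1 (fun M : V4 => M 0 k) E; rewrite !mxE !eqxx /=; lra.
have := K j0; have := K j1; have := K j2; have := K j3.
move: h1 h2; rewrite /dotp !sum_I4; lra.
Qed.

(** Equality of the plane spanned by t1 and t2 with the image of the
    differential, in terms of orthogonal complements. *)
Definition tangent_to (phi : V2 -> V4) x (t1 t2 : V4) :=
  forall w, (forall i, dotp w (pd i phi x) = 0) <-> (dotp w t1 = 0 /\ dotp w t2 = 0).

Lemma diff_indep (W : normedModType R) (h : V2 -> W) x (X Y : R) : injective ('d h x) ->
  X *: pd 0 h x + Y *: pd 1 h x = 0 -> X = 0 /\ Y = 0.
Proof.
move=> inj E; pose v : V2 := X *: basis_vec 0 + Y *: basis_vec 1.
have e0 : v 0 0 = X by rewrite /v /basis_vec !mxE /=; ring.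
have e1 : v 0 1 = Y by rewrite /v /basis_vec !mxE /=; ring.
have v0 : v = 0.
  apply: inj; have E' : 'd h x v = v 0 0 *: pd 0 h x + v 0 1 *: pd 1 h x by exact: diff_pd.
  rewrite e0 e1 in E'; apply: (etrans E'); apply: (etrans E).
  by apply/esym; exact: linear0.
by rewrite -e0 -e1 v0 !mxE.
Qed.

(** Gram-Schmidt applied to the partial derivatives gives the tangent frame; a
    constant vector that is not tangent at x0 gives the first normal field, and
    the vector product the second. *)
Lemma tangent_frame_exists (phi : V2 -> V4) U x0 : open U -> U x0 -> smooth_on U phi ->
  (forall x, U x -> injective ('d phi x)) ->
  exists V t1 t2 m1 m2, [/\ open V, V x0, V `<=` U, frame_on V t1 t2 m1 m2 &
    forall x, V x -> tangent_to phi x (t1 x) (t2 x)].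
Proof.
move=> oU Ux0 sphi inj.
pose E i := pd i phi; have sE i : smooth_on U (E i) by exact: smooth_on_pd.
have ind x X Y : U x -> X *: E 0 x + Y *: E 1 x = 0 -> X = 0 /\ Y = 0.
  by move=> Ux; apply: diff_indep; exact: inj.
have E0 x : U x -> 0 < dotp (E 0 x) (E 0 x).
  move=> Ux; apply: dotp_gt0; apply/eqP => e0.
  by have [|/eqP] := ind x 1 0 Ux; rewrite ?e0 ?scaler0 ?scale0r ?addr0// oner_eq0.
pose t1 := unitv (E 0); have st1 : smooth_on U t1 by exact: smooth_unitv.
pose F x := E 1 x + (- dotp (E 1 x) (t1 x)) *: t1 x.
have sF : smooth_on U F.
  have sk := smooth_onN oU (smooth_on_dotp oU (sE 1) st1).
  exact: (smooth_onD oU (sE 1) (smooth_onZ oU sk st1)).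
have F0 x : U x -> 0 < dotp (F x) (F x).
  move=> Ux; apply: dotp_gt0; apply/eqP => e0.
  have [|_ /eqP] := ind x (- dotp (E 1 x) (t1 x) * (Num.sqrt (dotp (E 0 x) (E 0 x)))^-1) 1 Ux.
    by rewrite scale1r -scalerA addrC.
  by rewrite oner_eq0.
pose t2 := unitv F; have st2 : smooth_on U t2 by exact: smooth_unitv.
have t11 x : U x -> dotp (t1 x) (t1 x) = 1 by move=> Ux; apply: unitv_norm; exact: E0.
have t22 x : U x -> dotp (t2 x) (t2 x) = 1 by move=> Ux; apply: unitv_norm; exact: F0.
have t12 x : U x -> dotp (t1 x) (t2 x) = 0.
  move=> Ux; apply/(dotp_unitv _ (F0 _ Ux)).
  by rewrite /F dotpDr dotpZr t11// mulr1 (dotpC (t1 x)) subrr.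
have [w w0] := exists_normal_vector (t11 _ Ux0) (t22 _ Ux0) (t12 _ Ux0).
pose N x := w - dotp w (t1 x) *: t1 x - dotp w (t2 x) *: t2 x.
have sw : smooth_on U (fun=> w) by exact: smooth_on_cst.
have sN : smooth_on U N.
  have k1 := smooth_onZ oU (smooth_on_dotp oU sw st1) st1.
  have k2 := smooth_onZ oU (smooth_on_dotp oU sw st2) st2.
  exact: (smooth_onB oU (smooth_onB oU sw k1) k2).
pose V := [set x | U x /\ 0 < dotp (N x) (N x)].
have oV : open V by apply: open_pos => //; exact: smooth_on_dotp.
have VU : V `<=` U by move=> x [].
have Vx0 : V x0 by split=> //; exact: dotp_gt0.
pose m1 := unitv N.
have vt1 : smooth_on V t1 by exact: smooth_on_sub st1.
have vt2 : smooth_on V t2 by exact: smooth_on_sub st2.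
have sm1 : smooth_on V m1.
  by apply: smooth_unitv => // [x []//|]; exact: smooth_on_sub sN.
have m11 x : V x -> dotp (m1 x) (m1 x) = 1 by move=> [_ h]; exact: unitv_norm.
have tN x : U x -> dotp (t1 x) (N x) = 0 /\ dotp (t2 x) (N x) = 0.
  by move=> Ux; exact: (orth_residual w (t11 _ Ux) (t22 _ Ux) (t12 _ Ux)).
have t1m x : V x -> dotp (t1 x) (m1 x) = 0.
  by move=> Vx; have [_ h] := Vx; apply/(dotp_unitv _ h); have [] := tN _ (VU _ Vx).
have t2m x : V x -> dotp (t2 x) (m1 x) = 0.
  by move=> Vx; have [_ h] := Vx; apply/(dotp_unitv _ h); have [] := tN _ (VU _ Vx).
exists V, t1, t2, m1, (fun x => star (wedge (t1 x) (t2 x)) (m1 x)); split=> //.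
- split=> //; first by apply: smooth_star => //; exact: smooth_wedge.
  move=> x Vx; have Ux := VU _ Vx.
  by apply: star_oframe; [exact: t11|exact: t22|exact: m11|exact: t12|exact: t1m|exact: t2m].
- move=> x Vx z; have Ux := VU _ Vx; split.
    move=> h; have h1 : dotp z (t1 x) = 0 by apply/(dotp_unitv _ (E0 _ Ux)); exact: h.
    split=> //; apply/(dotp_unitv _ (F0 _ Ux)).
    by rewrite /F dotpDr dotpZr h1 mulr0 addr0; exact: h.
  move=> [/(dotp_unitv _ (E0 _ Ux)) h0 /(dotp_unitv _ (F0 _ Ux))].
  have h1 : dotp z (t1 x) = 0 by apply/(dotp_unitv _ (E0 _ Ux)).
  rewrite /F dotpDr dotpZr h1 mulr0 addr0 => h2.
  by apply: forall_I2.
Qed.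

End TangentFrame.

Section RicciGauss.
Context {R : realType}.
Local Notation V2 := 'rV[R]_2.
Local Notation V4 := 'rV[R]_4.

Definition det2 (M : 'M[R]_2) : R := M 0 0 * M 1 1 - M 0 1 * M 1 0.

Lemma invmx2 (M : 'M[R]_2) : det2 M != 0 ->
  [/\ M *m invmx M = 1%:M, invmx M *m M = 1%:M & [/\
   invmx M 0 0 = (det2 M)^-1 * M 1 1, invmx M 0 1 = (det2 M)^-1 * - M 0 1,
   invmx M 1 0 = (det2 M)^-1 * - M 1 0 & invmx M 1 1 = (det2 M)^-1 * M 0 0]].
Proof.
move=> D0.
pose B : 'M[R]_2 := \matrix_(i, j) ((det2 M)^-1 *
  (if i == 0 then (if j == 0 then M 1 1 else - M 0 1) else (if j == 0 then - M 1 0 else M 0 0))).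
have BM : B *m M = 1%:M.
  have key : (det2 M)^-1 * det2 M = 1 by rewrite mulVf.
  apply/matrixP => i j; rewrite !mxE sum_I2 !mxE; move: key; rewrite {2}/det2.
  by move: i j; apply: forall_I2; apply: forall_I2 => /=;
    move: (det2 M)^-1 (M 0 0) (M 0 1) (M 1 0) (M 1 1) => d p q r s key; rewrite -?key; ring.
have [_ Mu] := mulmx1_unit BM.
have E : invmx M = B by rewrite -[LHS]mul1mx -BM -mulmxA mulmxV// mulmx1.
split; first exact: mulmxV.
- exact: mulVmx.
- by split; rewrite E mxE.
Qed.

Lemma gram2 (u v : V4) :
  let z := (- dotp u v) *: u + dotp u u *: v in
  dotp z z = dotp u u * (dotp u u * dotp v v - dotp u v * dotp u v).
Proof.
move=> z; rewrite /z !dotpDl !dotpDr !dotpZl !dotpZr (dotpC v u).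
by move: (dotp v v) (dotp u u) (dotp u v) => a b c; ring.
Qed.

(** The elimination behind the Gauss equation: derivatives of the Christoffel
    symbols cancel against the vanishing curvature, and the third derivatives of
    the immersion cancel because they are symmetric. What remains compares
    products of second derivatives with their tangential parts. *)
Lemma gauss_algebra (t t' f1 f2 d0 d1 d2 d3 e0 e1 e2 e3 g0 g1 : R)
    (G000 G100 G001 G101 G010 G110 G011 G111 p00 p01 p10 p11 : R) :
  t = t' ->
  t + f1 = d0 * g0 + G011 * (p00 + e0) + (d1 * g1 + G111 * (p01 + e1)) ->
  t' + f2 = d2 * g0 + G001 * (p10 + e2) + (d3 * g1 + G101 * (p11 + e3)) ->
  p00 = G000 * g0 + G100 * g1 -> p01 = G001 * g0 + G101 * g1 ->
  p10 = G010 * g0 + G110 * g1 -> p11 = G011 * g0 + G111 * g1 ->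
  d0 - d2 + (G000 * G011 - G010 * G001 + (G001 * G111 - G011 * G101)) = 0 ->
  d1 - d3 + (G100 * G011 - G110 * G001 + (G101 * G111 - G111 * G101)) = 0 ->
  f1 - f2 = G011 * e0 + G111 * e1 - (G001 * e2 + G101 * e3).
Proof.
move=> E D1 D2 E00 E01 E10 E11 R0 R1; rewrite {}E {}E00 {}E01 in D1; rewrite {}E10 {}E11 in D2.
have -> : f1 = t' + f1 - t' by ring.
have -> : f2 = t' + f2 - t' by ring.
rewrite D1 D2; apply/eqP; rewrite -subr_eq0; apply/eqP.
have Z := congr2 (fun a b => a * g0 + b * g1) R0 R1.
rewrite !mul0r addr0 in Z; rewrite -[RHS]Z; ring.
Qed.

Lemma normal_part_algebra (f1 f2 A C x1 x2 x3 x4 y1 y2 y3 y4 : R) : f1 - f2 = A - C ->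
  A = x1 + x2 -> C = y1 + y2 -> f1 = x1 + x2 + x3 + x4 -> f2 = y1 + y2 + y3 + y4 ->
  x3 - y3 + (x4 - y4) = 0.
Proof. by move=> ? ? ? ? ?; lra. Qed.

(** Change of basis from the partial derivatives to an orthonormal tangent
    frame: the determinant of the second fundamental form is multiplied by the
    nonzero determinant of the change of basis. *)
Lemma gauss_algebra_det (e f g h a b c d p q r s : R)
    (x11 x00 x01 x10 y11 y00 y01 y10 g00 g01 g10 g11 : R) :
  x11 * x00 - x01 * x10 + (y11 * y00 - y01 * y10) = 0 ->
  x11 = - (r * c + s * d) -> x00 = - (p * a + q * b) ->
  x01 = - (r * a + s * b) -> x10 = - (p * c + q * d) ->
  y11 = - (r * g + s * h) -> y00 = - (p * e + q * f) ->
  y01 = - (r * e + s * f) -> y10 = - (p * g + q * h) ->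
  g00 * g11 - g01 * g10 != 0 ->
  g00 = p * p + q * q -> g01 = p * r + q * s -> g10 = r * p + s * q -> g11 = r * r + s * s ->
  a * d - b * c + (e * h - f * g) = 0.
Proof.
move=> + E1 E2 E3 E4 E5 E6 E7 E8 + E9 E10 E11 E12.
rewrite {}E1 {}E2 {}E3 {}E4 {}E5 {}E6 {}E7 {}E8 {}E9 {}E10 {}E11 {}E12 => H D0.
have k : p * s - q * r != 0.
  apply: contra D0 => /eqP k; apply/eqP.
  rewrite [LHS](_ : _ = (p * s - q * r) * (p * s - q * r)); last by ring.
  by rewrite k mul0r.
apply: (mulfI k); rewrite mulr0 -H; ring.
Qed.

Variables (phi m1 m2 t1 t2 : V2 -> V4) (V : set V2).
Hypothesis oV : open V.
Hypothesis sphi : smooth_on V phi.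
Hypothesis inj : forall x, V x -> injective ('d phi x).
Hypothesis fr : frame_on V t1 t2 m1 m2.
Hypothesis tan : forall x, V x -> tangent_to phi x (t1 x) (t2 x).

Let E i := pd i phi.
Let F i j := pd i (pd j phi).
Let g := induced_metric phi.

Let sE i : smooth_on V (E i). Proof. exact: smooth_on_pd. Qed.
Let sF i j : smooth_on V (F i j). Proof. by do 2!apply: smooth_on_pd. Qed.
Let gE x i j : g x i j = dotp (E i x) (E j x). Proof. by rewrite /g mxE. Qed.
Let gfE i j : (fun y => g y i j) = (fun y => dotp (E i y) (E j y)).
Proof. by apply/funext => y; exact: gE. Qed.

Let EM x i : V x -> dotp (E i x) (m1 x) = 0 /\ dotp (E i x) (m2 x) = 0.
Proof.
move=> Vx; have [_ _ _ _ /(_ x Vx) o] := fr.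
have [q11 q12 q13 q14 q22 q23 q24 q33 q34 q44] := o.
split; rewrite dotpC; move: (i); apply/(tan Vx); split; by rewrite dotpC.
Qed.

Let det_g x : V x -> det2 (g x) != 0.
Proof.
move=> Vx; pose g00 := dotp (E 0 x) (E 0 x); pose g01 := dotp (E 0 x) (E 1 x).
have ind X Y : X *: E 0 x + Y *: E 1 x = 0 -> X = 0 /\ Y = 0.
  by apply: diff_indep; exact: inj.
have g0 : g00 != 0.
  apply/eqP => /dotp_eq0 e0.
  by have [|/eqP] := ind 1 0; rewrite ?e0 ?scaler0 ?scale0r ?addr0// oner_eq0.
pose z := (- g01) *: E 0 x + g00 *: E 1 x.
have z0 : z != 0 by apply/eqP => /ind[_] /eqP; rewrite (negbTE g0).
have zz : dotp z z = g00 * (g00 * dotp (E 1 x) (E 1 x) - g01 * g01) by exact: gram2.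
have := dotp_gt0 z0; rewrite zz => h; apply/eqP => D0; move: h.
by move: D0; rewrite /det2 !gE (dotpC (E 1 x) (E 0 x)) -/g00 -/g01 => ->; rewrite mulr0 ltxx.
Qed.

(** Both sides have the same scalar products with the tangent vectors and with
    the normal frame. *)
Lemma normal_projE x w : V x ->
  normal_proj phi x w = dotp w (m1 x) *: m1 x + dotp w (m2 x) *: m2 x.
Proof.
move=> Vx; have [_ _ _ _ /(_ x Vx) o] := fr.
have [_ hg _] := invmx2 (det_g Vx).
set v := normal_proj phi x w.
have vE : v = w - (invmx (g x) 0 0 * dotp w (E 0 x) *: E 0 x + invmx (g x) 0 1 * dotp w (E 0 x) *: E 1 x
   + (invmx (g x) 1 0 * dotp w (E 1 x) *: E 0 x + invmx (g x) 1 1 * dotp w (E 1 x) *: E 1 x)).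
  by rewrite /v /normal_proj !sum_I2.
have hgE i k : invmx (g x) i 0 * g x 0 k + invmx (g x) i 1 * g x 1 k = (i == k)%:R.
  by have := congr1 (fun M : 'M[R]_2 => M i k) hg; rewrite mxE sum_I2 => ->; rewrite mxE.
have lin (w' e0 e1 z : V4) (c00 c01 c10 c11 : R) :
  dotp (w' - (c00 *: e0 + c01 *: e1 + (c10 *: e0 + c11 *: e1))) z =
  dotp w' z - (c00 * dotp e0 z + c01 * dotp e1 z + (c10 * dotp e0 z + c11 * dotp e1 z)).
  by rewrite !(dotpDl, dotpNl, dotpZl).
have vt k : dotp v (E k x) = 0.
  rewrite vE lin -!gE.
  have h0 := hgE 0 k; have h1 := hgE 1 k.
  have -> : invmx (g x) 0 0 * dotp w (E 0 x) * g x 0 k + invmx (g x) 0 1 * dotp w (E 0 x) * g x 1 k +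
     (invmx (g x) 1 0 * dotp w (E 1 x) * g x 0 k + invmx (g x) 1 1 * dotp w (E 1 x) * g x 1 k)
     = dotp w (E 0 x) * (0 == k)%:R + dotp w (E 1 x) * (1 == k)%:R.
    rewrite -h0 -h1; by move: (g x) (invmx (g x)) (dotp w (E 0 x)) (dotp w (E 1 x)) => N M a b; ring.
  by move: k {h0 h1}; apply: forall_I2; rewrite /= ?mulr1 ?mulr0 ?addr0 ?add0r subrr.
have [v1 v2] : dotp v (t1 x) = 0 /\ dotp v (t2 x) = 0 by apply/(tan Vx).
have [e01 e02] := EM 0 Vx; have [e11 e12] := EM 1 Vx.
have vm1 : dotp v (m1 x) = dotp w (m1 x) by rewrite vE lin e01 e11 !mulr0 !addr0 subr0.
have vm2 : dotp v (m2 x) = dotp w (m2 x) by rewrite vE lin e02 e12 !mulr0 !addr0 subr0.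
by rewrite (oframe_expand v o) v1 v2 vm1 vm2 !scale0r !add0r.
Qed.

(** In the frame m1, m2 the normal connection is the form psi = <dm1,m2>, and
    the normal curvature of m1 is dpsi times m2. The structure equation of dpsi
    then gives the commutation relation. *)
Lemma ricci_of_flat x : V x ->
  (forall y, V y -> normal_curvature phi 0 1 m1 y = 0) -> ricci_eq t1 t2 m1 m2 x.
Proof.
move=> Vx flat; have [st1 st2 sm1 sm2 fr'] := fr.
have o := fr' _ Vx.
have z11 i y : V y -> om i m1 m1 y = 0.
  by move=> Vy; apply: (om_self (k := 1) i oV sm1 _ Vy) => z /fr' [].
have z22 i y : V y -> om i m2 m2 y = 0.
  by move=> Vy; apply: (om_self (k := 1) i oV sm2 _ Vy) => z /fr' [].
pose psi i := om i m1 m2; have spsi i : smooth_on V (psi i) by exact: smooth_om.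
have np i y : V y -> nabla_perp phi i m1 y = psi i y *: m2 y.
  move=> Vy; rewrite /nabla_perp normal_projE//.
  have -> : dotp (pd i m1 y) (m1 y) = 0 by exact: z11.
  by rewrite scale0r add0r.
have pdnp i j : pd i (nabla_perp phi j m1) x = pd i (psi j) x *: m2 x + psi j x *: pd i m2 x.
  have e y : V y -> psi j y *: m2 y = nabla_perp phi j m1 y by move=> /np ->.
  have ds := differentiable_scale (smooth_on_diff (spsi j) Vx) (smooth_on_diff sm2 Vx).
  rewrite -(pd_open_eq i oV Vx e ds).
  by rewrite (pdZ i (smooth_on_diff (spsi j) Vx) (smooth_on_diff sm2 Vx)).
have key i j : dotp (nabla_perp phi i (nabla_perp phi j m1) x) (m2 x) = pd i (psi j) x.
  rewrite /nabla_perp normal_projE// -/(nabla_perp phi j m1) pdnp.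
  have lin (u v a b : V4) (p q : R) : dotp b b = 1 -> dotp a b = 0 -> dotp v b = 0 ->
     dotp (dotp (p *: b + q *: v) a *: a + dotp (p *: b + q *: v) b *: b) b = p.
    move=> bb ab vb; rewrite !(dotpDl, dotpZl) bb ab vb; ring.
  apply: lin; [exact: m1|by case: o|by case: o|exact: z22].
have E0 : pd 0 (psi 1) x - pd 1 (psi 0) x = 0.
  by rewrite -!key -dotpNl -dotpDl -[_ - _]/(normal_curvature phi 0 1 m1 x) flat// dotp0l.
have C := etrans (esym (om_curl oV sm1 sm2 Vx)) E0.
have D i j : dotp (pd i m1 x) (pd j m2 x) = om i m1 t1 x * om j m2 t1 x + om i m1 t2 x * om j m2 t2 x.
  apply: (etrans (oframe_dotp _ _ o)).
  have z (p q r s a b c d : R) : r = 0 -> d = 0 -> p * a + q * b + r * c + s * d = p * a + q * b.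
    by move=> -> ->; rewrite mul0r mulr0 !addr0.
  by apply: z; [exact: z11|exact: z22].
move: C; rewrite !D /ricci_eq => /eqP; rewrite subr_eq0 => /eqP C.
exact: C.
Qed.

Let F_comm i j x : V x -> F i j x = pd j (E i) x.
Proof. by move=> Vx; exact: (pd_comm i j oV Vx sphi). Qed.

Let pdg k i j x : V x -> pd k (fun y => g y i j) x = dotp (F k i x) (E j x) + dotp (E i x) (F k j x).
Proof.
move=> Vx; rewrite gfE.
exact: (pd_dotp k (smooth_on_diff (sE i) Vx) (smooth_on_diff (sE j) Vx)).
Qed.

Let smooth_inv i j : smooth_on V (fun y => invmx (g y) i j).
Proof.
have sg k l : smooth_on V (fun y => g y k l).
  by apply: smooth_on_eq oV _ (smooth_on_dotp oV (sE k) (sE l)) => y _; rewrite gE.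
have sD : smooth_on V (fun y => (det2 (g y))^-1).
  apply: (smooth_onV oV det_g).
  exact: (smooth_onB oV (smooth_onM oV (sg 0 0) (sg 1 1)) (smooth_onM oV (sg 0 1) (sg 1 0))).
have sgN k l : smooth_on V (fun y => - g y k l) by exact: (smooth_onN oV (sg k l)).
move: i j; apply: forall_I2; apply: forall_I2.
- apply: smooth_on_eq oV _ (smooth_onM oV sD (sg 1 1)) => y Vy.
  by have [_ _ [-> _ _ _]] := invmx2 (det_g Vy).
- apply: smooth_on_eq oV _ (smooth_onM oV sD (sgN 0 1)) => y Vy.
  by have [_ _ [_ -> _ _]] := invmx2 (det_g Vy).
- apply: smooth_on_eq oV _ (smooth_onM oV sD (sgN 1 0)) => y Vy.
  by have [_ _ [_ _ -> _]] := invmx2 (det_g Vy).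
- apply: smooth_on_eq oV _ (smooth_onM oV sD (sg 0 0)) => y Vy.
  by have [_ _ [_ _ _ ->]] := invmx2 (det_g Vy).
Qed.

Let Gam k i j x := christoffel g k i j x.

(** The formula is the usual one for an induced metric: Gamma is the tangential
    part of the second derivatives. *)
Lemma christoffelE k i j x : V x ->
  Gam k i j x = \sum_l invmx (g x) k l * dotp (F i j x) (E l x).
Proof.
move=> Vx; rewrite /Gam /christoffel mulr_sumr; apply: eq_bigr => l _.
rewrite mulrCA; congr (_ * _).
have -> : pd i (fun y => g y j l) x + pd j (fun y => g y i l) x - pd l (fun y => g y i j) x
   = dotp (F i j x) (E l x) + dotp (E j x) (F i l x) + (dotp (F j i x) (E l x) + dotp (E i x) (F j l x))
     - (dotp (F l i x) (E j x) + dotp (E i x) (F l j x)).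
  by congr (_ + _ - _); exact: pdg.
have -> : F j i x = F i j x by exact: F_comm.
have -> : F l i x = F i l x by exact: F_comm.
have -> : F l j x = F j l x by exact: F_comm.
have half (a b b' c : R) : b = b' -> 2^-1 * (a + b + (a + c) - (b' + c)) = a.
  by move=> ->; field.
apply: half; exact: dotpC.
Qed.

Let smooth_Gam k i j : smooth_on V (Gam k i j).
Proof.
have P l := smooth_onM oV (smooth_inv k l) (smooth_on_dotp oV (sF i j) (sE l)).
apply: smooth_on_eq oV _ (smooth_onD oV (P 0) (P 1)) => y Vy.
by rewrite christoffelE// sum_I2.
Qed.

Let gC x i j : g x i j = g x j i. Proof. by rewrite !gE dotpC. Qed.

Let Gam_proj i j m x : V x ->
  dotp (F i j x) (E m x) = Gam 0 i j x * g x 0 m + Gam 1 i j x * g x 1 m.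
Proof.
move=> Vx; rewrite !christoffelE// !sum_I2.
have [_ hg _] := invmx2 (det_g Vx); have [gh _ _] := invmx2 (det_g Vx).
have ghE a b : g x a 0 * invmx (g x) 0 b + g x a 1 * invmx (g x) 1 b = (a == b)%:R.
  by have := congr1 (fun M : 'M[R]_2 => M a b) gh; rewrite mxE sum_I2 => ->; rewrite mxE.
rewrite (gC x 0 m) (gC x 1 m).
have h0 := ghE m 0; have h1 := ghE m 1.
have -> : dotp (F i j x) (E m x) =
   (m == 0)%:R * dotp (F i j x) (E 0 x) + (m == 1)%:R * dotp (F i j x) (E 1 x).
  by move: (m); apply: forall_I2; rewrite /= ?mul1r ?mul0r ?addr0 ?add0r.
rewrite -h0 -h1.
by move: (g x) (invmx (g x)) (dotp (F i j x) (E 0 x)) (dotp (F i j x) (E 1 x)) => N M a b; ring.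
Qed.

(** The curvature of the induced metric is the determinant of the second
    fundamental form; it is obtained by differentiating the decomposition of the
    second derivatives into tangential and normal parts. *)
Lemma gauss_det x : V x -> (forall y, V y -> forall l, riemann g l 0 1 1 y = 0) ->
  dotp (F 1 1 x) (m1 x) * dotp (F 0 0 x) (m1 x) - dotp (F 0 1 x) (m1 x) * dotp (F 1 0 x) (m1 x)
  + (dotp (F 1 1 x) (m2 x) * dotp (F 0 0 x) (m2 x) - dotp (F 0 1 x) (m2 x) * dotp (F 1 0 x) (m2 x)) = 0.
Proof.
move=> Vx flat; have [st1 st2 sm1 sm2 fr'] := fr; have o := fr' _ Vx.
have dG k i j := smooth_on_diff (smooth_Gam k i j) Vx.
have dg i j : differentiable (fun y => g y i j) x.
  by rewrite gfE; exact: smooth_on_diff (smooth_on_dotp oV (sE i) (sE j)) Vx.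
have D k i j : dotp (pd k (F i j) x) (E 0 x) + dotp (F i j x) (F k 0 x) =
   pd k (Gam 0 i j) x * g x 0 0 + Gam 0 i j x * (dotp (F k 0 x) (E 0 x) + dotp (E 0 x) (F k 0 x))
   + (pd k (Gam 1 i j) x * g x 1 0 + Gam 1 i j x * (dotp (F k 1 x) (E 0 x) + dotp (E 1 x) (F k 0 x))).
  have dF := smooth_on_diff (sF i j) Vx; have dE := smooth_on_diff (sE 0) Vx.
  apply: (etrans (esym (pd_dotp k dF dE))).
  apply: (etrans (pd_open_eq k oV Vx (fun y Vy => Gam_proj i j 0 Vy) (differentiable_dotp dF dE))).
  apply: (etrans (pdD k (differentiableM (dG 0 i j) (dg 0 0)) (differentiableM (dG 1 i j) (dg 1 0)))).
  congr (_ + _).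
    by apply: (etrans (pdM k (dG 0 i j) (dg 0 0))); congr (_ + _ * _); exact: pdg.
  by apply: (etrans (pdM k (dG 1 i j) (dg 1 0))); congr (_ + _ * _); exact: pdg.
have S : pd 0 (F 1 1) x = pd 1 (F 0 1) x by exact: (pd_comm 0 1 oV Vx (sE 1)).
have RE l : pd 0 (Gam l 1 1) x - pd 1 (Gam l 0 1) x +
    (Gam l 0 0 x * Gam 0 1 1 x - Gam l 1 0 x * Gam 0 0 1 x
     + (Gam l 0 1 x * Gam 1 1 1 x - Gam l 1 1 x * Gam 1 0 1 x)) = 0.
  by have := flat _ Vx l; rewrite /riemann sum_I2.
have key := gauss_algebra (congr1 (dotp^~ (E 0 x)) S) (D 0 1 1) (D 1 0 1)
  (Gam_proj 0 0 0 Vx) (Gam_proj 0 1 0 Vx) (Gam_proj 1 0 0 Vx) (Gam_proj 1 1 0 Vx) (RE 0) (RE 1).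
have tpart i j (t : V4) : (t = t1 x \/ t = t2 x) ->
    dotp (Gam 0 i j x *: E 0 x + Gam 1 i j x *: E 1 x) t = dotp (F i j x) t.
  move=> ht; apply/eqP; rewrite eq_sym -subr_eq0 -dotpNl -dotpDl; apply/eqP.
  have [h1 h2] : dotp (F i j x - (Gam 0 i j x *: E 0 x + Gam 1 i j x *: E 1 x)) (t1 x) = 0 /\
      dotp (F i j x - (Gam 0 i j x *: E 0 x + Gam 1 i j x *: E 1 x)) (t2 x) = 0.
    apply/(tan Vx) => k; rewrite dotpDl dotpNl dotpDl !dotpZl -/(E k).
    by rewrite Gam_proj// !gE subrr.
  by case: ht => ->.
have npart i j (n : V4) : (n = m1 x \/ n = m2 x) ->
    dotp (Gam 0 i j x *: E 0 x + Gam 1 i j x *: E 1 x) n = 0.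
  move=> hn; rewrite dotpDl !dotpZl.
  have [e01 e02] := EM 0 Vx; have [e11 e12] := EM 1 Vx.
  by case: hn => ->; rewrite ?e01 ?e02 ?e11 ?e12 !mulr0 addr0.
have split_dot i j w : Gam 0 i j x * dotp (E 0 x) w + Gam 1 i j x * dotp (E 1 x) w =
    dotp (F i j x) (t1 x) * dotp w (t1 x) + dotp (F i j x) (t2 x) * dotp w (t2 x).
  have lin (a b : V4) (p q : R) : p * dotp a w + q * dotp b w = dotp (p *: a + q *: b) w.
    by rewrite dotpDl !dotpZl.
  rewrite lin; apply: (etrans (oframe_dotp _ _ o)).
  rewrite (tpart i j _ (or_introl erefl)) (tpart i j _ (or_intror erefl)).
  rewrite (npart i j _ (or_introl erefl)) (npart i j _ (or_intror erefl)).
  by rewrite !mul0r !addr0.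
exact: (normal_part_algebra key (split_dot 1 1 (F 0 0 x)) (split_dot 0 1 (F 1 0 x))
  (oframe_dotp _ _ o) (oframe_dotp _ _ o)).
Qed.

Lemma gauss_of_flat x : V x -> (forall y, V y -> forall l, riemann g l 0 1 1 y = 0) ->
  shape_det t1 t2 m1 x + shape_det t1 t2 m2 x = 0.
Proof.
move=> Vx flat; have H := gauss_det Vx flat.
have [st1 st2 sm1 sm2 fr'] := fr; have o := fr' _ Vx.
have Fm m i j : (m = m1 \/ m = m2) -> dotp (F i j x) (m x) =
   - (dotp (E j x) (t1 x) * om i m t1 x + dotp (E j x) (t2 x) * om i m t2 x).
  move=> hm; have sm : smooth_on V m by case: hm => ->.
  have e0 y : V y -> dotp (E j y) (m y) = 0.
    by move=> Vy; have [h1 h2] := EM j Vy; case: hm => ->.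
  have -> : dotp (F i j x) (m x) = - om i m (E j) x by exact: (om_skew i oV (sE j) sm e0 Vx).
  congr (- _); rewrite /om (oframe_dotp (pd i m x) _ o).
  have [h1 h2] := EM j Vx; rewrite h1 h2 !mulr0 !addr0.
  by rewrite [X in X + _]mulrC [X in _ + X]mulrC.
have D0 := det_g Vx; rewrite /det2 !gE in D0.
have B i j : dotp (E i x) (E j x) = dotp (E i x) (t1 x) * dotp (E j x) (t1 x)
   + dotp (E i x) (t2 x) * dotp (E j x) (t2 x).
  rewrite (oframe_dotp (E i x) _ o); have [h1 h2] := EM i Vx.
  by rewrite h1 h2 !mul0r !addr0.
have L1 := fun i j => Fm m1 i j (or_introl erefl).
have L2 := fun i j => Fm m2 i j (or_intror erefl).
exact: (gauss_algebra_det H (L1 1 1) (L1 0 0) (L1 0 1) (L1 1 0) (L2 1 1) (L2 0 0) (L2 0 1) (L2 1 0)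
  D0 (B 0 0) (B 0 1) (B 1 0) (B 1 1)).
Qed.

End RicciGauss.

(** * The diagonal frame of the surface *)

Section Regular.
Context {R : realType}.
Local Notation V2 := 'rV[R]_2.
Local Notation V4 := 'rV[R]_4.
Implicit Types (U V : set V2).

(** An orthonormal basis of the plane gives the bivector t1 /\ t2 up to sign.
    Products of two entries do not see this sign, which avoids choosing an
    orientation. *)
Lemma wedge_in_plane (t1 t2 m1 m2 a b : V4) : oframe t1 t2 m1 m2 ->
  dotp a m1 = 0 -> dotp a m2 = 0 -> dotp b m1 = 0 -> dotp b m2 = 0 ->
  dotp a a = 1 -> dotp b b = 1 -> dotp a b = 0 ->
  forall i j k l, wedge a b i j * wedge a b k l = wedge t1 t2 i j * wedge t1 t2 k l.
Proof.
move=> o a1 a2 b1 b2 aa bb ab.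
have Ea := oframe_expand a o; have Eb := oframe_expand b o.
have aa' := oframe_dotp a a o; have bb' := oframe_dotp b b o; have ab' := oframe_dotp a b o.
rewrite a1 a2 !scale0r !addr0 in Ea; rewrite b1 b2 !scale0r !addr0 in Eb.
rewrite aa a1 a2 !mul0r !addr0 in aa'; rewrite bb b1 b2 !mul0r !addr0 in bb'.
rewrite ab a1 a2 !mul0r !addr0 in ab'.
move: Ea Eb aa' bb' ab'.
move: (dotp a t1) (dotp a t2) (dotp b t1) (dotp b t2) => p q r s Ea Eb aa' bb' ab'.
have W i j : wedge a b i j = (p * s - q * r) * wedge t1 t2 i j.
  by rewrite !wedgeE Ea Eb !mxE; ring.
have d2 : (p * s - q * r) * (p * s - q * r) = 1.
  have -> : (p * s - q * r) * (p * s - q * r) =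
     (p * p + q * q) * (r * r + s * s) - (p * r + q * s) * (p * r + q * s) by ring.
  by rewrite -aa' -bb' -ab'; ring.
by move=> i j k l; rewrite !W mulrACA d2 mul1r.
Qed.

Let neg_lin (X Y p q p' q' : R) : p = - p' -> q = - q' -> X * p + Y * q = - (X * p' + Y * q').
Proof. by move=> -> ->; rewrite !mulrN opprD. Qed.

Let zero_lin (X Y p q : R) : p = 0 -> q = 0 -> X * p + Y * q = 0.
Proof. by move=> -> ->; rewrite !mulr0 addr0. Qed.

(** On a vector where the derivatives of both normal fields are normal, the
    derivative of the bivector t1 /\ t2 vanishes. The entries of G satisfy G_ij
    G_kl = W_ij W_kl with W = t1 /\ t2, so the derivative of G vanishes on this
    vector too. *)
Lemma regular_of_gauss V (t1 t2 m1 m2 : V2 -> V4) (G : V2 -> 'M[R]_4) x :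
  open V -> V x -> frame_on V t1 t2 m1 m2 -> smooth_on V G ->
  (forall y, V y -> forall i j k l,
     G y i j * G y k l = wedge (t1 y) (t2 y) i j * wedge (t1 y) (t2 y) k l) ->
  injective ('d G x) -> regular_forms t1 t2 m1 m2 x.
Proof.
move=> oV Vx [st1 st2 sm1 sm2 fr] sG GW inj X Y h1 h2 h3 h4.
have o := fr _ Vx.
have sk e n i : smooth_on V e -> smooth_on V n -> (forall y, V y -> dotp (e y) (n y) = 0) ->
    om i e n x = - om i n e x.
  by move=> se sn en; exact: (om_skew i oV se sn en Vx).
pose D (h : V2 -> V4) := X *: pd 0 h x + Y *: pd 1 h x.
have DE h n : dotp (D h) (n x) = X * om 0 h n x + Y * om 1 h n x.
  by rewrite /D dotpDl !dotpZl.
have Dz e n : smooth_on V e -> smooth_on V n -> (forall y, V y -> dotp (e y) (n y) = 0) ->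
    X * om 0 n e x + Y * om 1 n e x = 0 -> dotp (D e) (n x) = 0.
  move=> se sn en h; apply: (etrans (DE e n)).
  apply: (etrans (neg_lin X Y (sk e n 0 se sn en) (sk e n 1 se sn en))).
  by rewrite h oppr0.
have D1m1 : dotp (D t1) (m1 x) = 0 by apply: Dz => // y /fr [].
have D1m2 : dotp (D t1) (m2 x) = 0 by apply: Dz => // y /fr [].
have D2m1 : dotp (D t2) (m1 x) = 0 by apply: Dz => // y /fr [].
have D2m2 : dotp (D t2) (m2 x) = 0 by apply: Dz => // y /fr [].
have self e : smooth_on V e -> (forall y, V y -> dotp (e y) (e y) = 1) -> dotp (D e) (e x) = 0.
  move=> se ee; apply: (etrans (DE e e)).
  exact: (zero_lin X Y (om_self 0 oV se ee Vx) (om_self 1 oV se ee Vx)).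
have D11 : dotp (D t1) (t1 x) = 0 by apply: self => // y /fr [].
have D22 : dotp (D t2) (t2 x) = 0 by apply: self => // y /fr [].
pose rho := dotp (D t1) (t2 x).
have D21 : dotp (D t2) (t1 x) = - rho.
  have s12 i : om i t2 t1 x = - om i t1 t2 x by apply: sk => // y /fr []; rewrite dotpC.
  apply: (etrans (DE t2 t1)); apply: (etrans (neg_lin X Y (s12 0) (s12 1))).
  by congr (- _); exact: (esym (DE t1 t2)).
have E1 : D t1 = rho *: t2 x.
  by rewrite (oframe_expand (D t1) o) D11 D1m1 D1m2 !scale0r !addr0 add0r.
have E2 : D t2 = (- rho) *: t1 x.
  by rewrite (oframe_expand (D t2) o) D22 D21 D2m1 D2m2 !scale0r !addr0.
have st (e : V2 -> V4) i : smooth_on V e -> smooth_on V (fun y => e y 0 i).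
  by move=> /(smooth_on_mxP _ oV); apply.
(* The derivative of a function along the vector (X, Y). *)
pose Dr (h : V2 -> R) := X * pd 0 h x + Y * pd 1 h x.
have DrM (h k : V2 -> R) : smooth_on V h -> smooth_on V k ->
    Dr (fun y => h y * k y) = Dr h * k x + h x * Dr k.
  move=> sh sk'; have dh := smooth_on_diff sh Vx; have dk := smooth_on_diff sk' Vx.
  rewrite /Dr (pdM 0 dh dk) (pdM 1 dh dk).
  by move: (pd 0 h x) (pd 1 h x) (pd 0 k x) (pd 1 k x) (h x) (k x) => *; ring.
have DrB (h k : V2 -> R) : smooth_on V h -> smooth_on V k -> Dr (fun y => h y - k y) = Dr h - Dr k.
  move=> sh sk'; have dh := smooth_on_diff sh Vx; have dk := smooth_on_diff sk' Vx.
  rewrite /Dr (pdB 0 dh dk) (pdB 1 dh dk).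
  by move: (pd 0 h x) (pd 1 h x) (pd 0 k x) (pd 1 k x) => *; ring.
have Drc (e : V2 -> V4) i : smooth_on V e -> Dr (fun y => e y 0 i) = D e 0 i.
  move=> se; rewrite /Dr /D !mxE.
  by rewrite (pd_mx 0 0 i (smooth_on_diff se Vx)) (pd_mx 1 0 i (smooth_on_diff se Vx)).
pose w i j y := wedge (t1 y) (t2 y) i j.
have wE i j : w i j = fun y => t1 y 0 i * t2 y 0 j - t2 y 0 i * t1 y 0 j.
  by apply/funext => y; rewrite /w wedgeE.
have sw i j : smooth_on V (w i j).
  rewrite wE; apply: (smooth_onB oV); apply: (smooth_onM oV); exact: st.
have Dw i j : Dr (w i j) = 0.
  rewrite wE DrB; [|by apply: (smooth_onM oV); exact: st..].
  rewrite !DrM; try exact: st.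
  by rewrite !Drc// E1 E2 !mxE; ring.
have sg i j : smooth_on V (fun y => G y i j) by move/(smooth_on_mxP _ oV): sG; apply.
have DGG i j k l : Dr (fun y => G y i j) * G x k l + G x i j * Dr (fun y => G y k l) = 0.
  rewrite -(DrM _ _ (sg i j) (sg k l)).
  have -> : Dr (fun y => G y i j * G y k l) = Dr (fun y => w i j y * w k l y).
    have dG := smooth_on_diff (smooth_onM oV (sg i j) (sg k l)) Vx.
    have e y : V y -> G y i j * G y k l = w i j y * w k l y by move=> Vy; exact: GW.
    by rewrite /Dr (pd_open_eq 0 oV Vx e dG) (pd_open_eq 1 oV Vx e dG).
  by rewrite (DrM _ _ (sw i j) (sw k l)) !Dw mul0r mulr0 addr0.
(* Some entry of the bivector does not vanish; dividing by the same entry of G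
   gives the derivatives of all the entries of G. *)
have [k [l wkl]] : exists k l, w k l x != 0.
  apply: contrapT => H.
  have w0 k l : w k l x = 0 by apply: contrapT => /eqP ne; apply: H; exists k, l.
  have t0 k : t1 x 0 k = 0.
    have -> : t1 x 0 k = t1 x 0 k * dotp (t2 x) (t2 x) - t2 x 0 k * dotp (t1 x) (t2 x).
      by rewrite (of22 o) (of12 o) mulr1 mulr0 subr0.
    rewrite /dotp !mulr_sumr -sumrB big1// => l _.
    by have := w0 k l; rewrite wE !mulrA -mulrBl => ->; rewrite mul0r.
  have := of11 o; rewrite /dotp big1 => [/eqP|l _]; last by rewrite t0 mul0r.
  by rewrite eq_sym oner_eq0.
have gkl : G x k l != 0.
  apply: contra wkl => /eqP g0; have := GW _ Vx k l k l.
  by rewrite g0 mul0r => /esym/eqP; rewrite mulf_eq0 orbb.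
have Dkl : Dr (fun y => G y k l) = 0.
  have := DGG k l k l; rewrite mulrC -mulrDr => /eqP.
  rewrite mulf_eq0 (negbTE gkl) /= -mulr2n -mulr_natl mulf_eq0 pnatr_eq0 /=.
  by move=> /eqP.
have DG i j : Dr (fun y => G y i j) = 0.
  have := DGG i j k l; rewrite Dkl mulr0 addr0 => /eqP.
  by rewrite mulf_eq0 (negbTE gkl) orbF => /eqP.
apply: (diff_indep inj); apply/matrixP => i j; have dG := smooth_on_diff sG Vx.
by have := DG i j; rewrite /Dr !mxE (pd_mx 0 i j dG) (pd_mx 1 i j dG).
Qed.

Lemma tangent_to_same_plane (phi : V2 -> V4) x (t1 t2 e1 e2 : V4) :
  tangent_to phi x t1 t2 -> same_plane t1 t2 e1 e2 -> tangent_to phi x e1 e2.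
Proof. by move=> h1 h2 w; rewrite h1; exact: h2. Qed.

Lemma tangent_to_range (phi : V2 -> V4) x (t1 t2 m1 m2 a : V4) v :
  oframe t1 t2 m1 m2 -> tangent_to phi x t1 t2 -> a = 'd phi x v ->
  dotp a m1 = 0 /\ dotp a m2 = 0.
Proof.
move=> [q11 q12 q13 q14 q22 q23 q24 q33 q34 q44] tan ->.
have m1E : forall i, dotp m1 (pd i phi x) = 0 by apply/tan; split; rewrite dotpC.
have m2E : forall i, dotp m2 (pd i phi x) = 0 by apply/tan; split; rewrite dotpC.
have -> : 'd phi x v = v 0 0 *: pd 0 phi x + v 0 1 *: pd 1 phi x by exact: diff_pd.
by rewrite ![dotp (_ + _) _]dotpC !dotpDr !dotpZr !m1E !m2E !mulr0 addr0.
Qed.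

Lemma immersion_diag_frame U (phi : V2 -> V4) (G : V2 -> 'M[R]_4) x0 :
  open U -> U x0 -> smooth_on U phi -> (forall x, U x -> injective ('d phi x)) ->
  (forall x, U x -> forall l i j k, riemann (induced_metric phi) l i j k x = 0) ->
  (forall (V : set V2) xi, open V -> V `<=` U -> smooth_on V xi -> normal_on phi V xi ->
    forall i j x, V x -> normal_curvature phi i j xi x = 0) ->
  smooth_on U G -> (forall x, U x -> injective ('d G x)) ->
  (forall x, U x -> exists a b, [/\ exists v, a = 'd phi x v, exists v, b = 'd phi x v,
    dotp a a = 1, dotp b b = 1 & dotp a b = 0] /\ G x = wedge a b) ->
  exists r e1 e2 n1 n2 a b, [/\ 0 < r, ball x0 r `<=` U, diag_frame (ball x0 r) e1 e2 n1 n2 a b &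
    forall x, ball x0 r x -> tangent_to phi x (e1 x) (e2 x)].
Proof.
move=> oU Ux0 sphi iphi flat nflat sG iG gm.
have [V [t1 [t2 [m1 [m2 [oV Vx0 VU fr tan]]]]]] := tangent_frame_exists oU Ux0 sphi iphi.
have sphiV := smooth_on_sub VU sphi; have sGV := smooth_on_sub VU sG.
have iphiV x : V x -> injective ('d phi x) by move=> /VU; exact: iphi.
have [st1 st2 sm1 sm2 fr'] := fr.
have nm1 : normal_on phi V m1.
  move=> x i Vx; have [q11 q12 q13 q14 q22 q23 q24 q33 q34 q44] := fr' _ Vx.
  by move: i; apply/(tan _ Vx); split; rewrite dotpC.
have ric x : V x -> ricci_eq t1 t2 m1 m2 x.
  move=> Vx; apply: (ricci_of_flat oV iphiV fr tan Vx) => y Vy.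
  exact: (nflat V m1 oV VU sm1 nm1).
have gau x : V x -> shape_det t1 t2 m1 x + shape_det t1 t2 m2 x = 0.
  move=> Vx; apply: (gauss_of_flat oV sphiV iphiV fr tan Vx) => y Vy l.
  by apply: flat; exact: VU.
have reg x : V x -> regular_forms t1 t2 m1 m2 x.
  move=> Vx; apply: (regular_of_gauss oV Vx fr sGV _ (iG _ (VU _ Vx))) => y Vy.
  have [a [b [[[v va] [v' vb] aa bb ab] ->]]] := gm _ (VU _ Vy).
  have [a1 a2] := tangent_to_range (fr' _ Vy) (tan _ Vy) va.
  have [b1 b2] := tangent_to_range (fr' _ Vy) (tan _ Vy) vb.
  exact: (wedge_in_plane (fr' _ Vy)).
have [r [e1 [e2 [n1 [n2 [a [b [r0 bV df sp]]]]]]]] := diag_frame_exists oV Vx0 fr ric gau reg.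
exists r, e1, e2, n1, n2, a, b; split=> //; first exact: subset_trans bV VU.
by move=> x bx; apply: tangent_to_same_plane (tan _ (bV _ bx)) (sp _ bx).
Qed.

End Regular.

(** * Transformations and rigidity of diagonal frames *)

Section Rigidity.
Context {R : realType}.
Local Notation V2 := 'rV[R]_2.
Local Notation V4 := 'rV[R]_4.
Implicit Types (U V : set V2).

Lemma diag_frame_sub V V' e1 e2 n1 n2 (a b : V2 -> R) : V' `<=` V ->
  diag_frame V e1 e2 n1 n2 a b -> diag_frame V' e1 e2 n1 n2 a b.
Proof.
move=> VV [[s1 s2 s3 s4 fr] sa sb h12 h21 da db jac].
split=> [||||x i /VV|x i /VV|x i /VV|x /VV]; [split| | | | | | |].
- exact: smooth_on_sub s1.
- exact: smooth_on_sub s2.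
- exact: smooth_on_sub s3.
- exact: smooth_on_sub s4.
- by move=> x /VV; exact: fr.
- exact: smooth_on_sub sa.
- exact: smooth_on_sub sb.
- by move=> x i /VV; exact: h12.
- exact: h21.
- exact: da.
- exact: db.
- exact: jac.
Qed.

Lemma om_comp V (A B : V2 -> V4) (t : V2 -> V2) i x : smooth_on V A -> V (t x) ->
  differentiable t x ->
  om i (A \o t) (B \o t) x = pd i t x 0 0 * om 0 A B (t x) + pd i t x 0 1 * om 1 A B (t x).
Proof.
move=> sA Vt dt; rewrite /om.
apply: (etrans (congr1 (fun w => dotp w (B (t x))) (pd_comp i dt (smooth_on_diff sA Vt)))).
by apply: (etrans (dotpDl _ _ _)); congr (_ + _); exact: dotpZl.
Qed.

Lemma diag_frame_comp V V' (t : V2 -> V2) e1 e2 n1 n2 (a b : V2 -> R) :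
  open V -> open V' -> (forall x, V' x -> V (t x)) -> smooth_on V' t ->
  (forall x, V' x -> jacobian t x != 0) ->
  diag_frame V e1 e2 n1 n2 a b ->
  diag_frame V' (e1 \o t) (e2 \o t) (n1 \o t) (n2 \o t) (a \o t) (b \o t).
Proof.
move=> oV oV' VV st jt [[s1 s2 s3 s4 fr] sa sb h12 h21 da db jac].
have lin (x y p q r s : R) : p = r -> q = s -> x * p + y * q = x *: r + y *: s.
  by move=> -> ->.
have lin0 (x y p q : R) : p = 0 -> q = 0 -> x * p + y * q = 0.
  by move=> -> ->; rewrite !mulr0 addr0.
split.
- by split; [exact: (smooth_on_comp_mx oV oV' VV st)..|move=> x V'x; exact: fr (VV _ V'x)].
- exact: (smooth_on_comp oV oV' VV st sa).
- exact: (smooth_on_comp oV oV' VV st sb).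
- move=> x i V'x; apply: (etrans (om_comp n2 i s1 (VV _ V'x) (smooth_on_diff st V'x))).
  by apply: lin0; apply: h12; exact: VV.
- move=> x i V'x; apply: (etrans (om_comp n1 i s2 (VV _ V'x) (smooth_on_diff st V'x))).
  by apply: lin0; apply: h21; exact: VV.
- move=> x i V'x; apply: (etrans (om_comp n1 i s1 (VV _ V'x) (smooth_on_diff st V'x))).
  apply: etrans (esym (pd_comp i (smooth_on_diff st V'x) (smooth_on_diff sa (VV _ V'x)))).
  by apply: lin; apply: da; exact: VV.
- move=> x i V'x; apply: (etrans (om_comp n2 i s2 (VV _ V'x) (smooth_on_diff st V'x))).
  apply: etrans (esym (pd_comp i (smooth_on_diff st V'x) (smooth_on_diff sb (VV _ V'x)))).
  by apply: lin; apply: db; exact: VV.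
- move=> x V'x; have dt := smooth_on_diff st V'x; have Vt := VV _ V'x.
  have alg (p0 p1 q0 q1 j00 j01 j10 j11 a0 a1 b0 b1 : R) :
      p0 = j00 *: a0 + j01 *: a1 -> p1 = j10 *: a0 + j11 *: a1 ->
      q0 = j00 *: b0 + j01 *: b1 -> q1 = j10 *: b0 + j11 *: b1 ->
      j00 * j11 - j01 * j10 != 0 -> a0 * b1 - a1 * b0 != 0 -> p0 * q1 - p1 * q0 != 0.
    move=> -> -> -> -> h1 h2; rewrite /GRing.scale /=.
    rewrite [X in X != 0](_ : _ = (j00 * j11 - j01 * j10) * (a0 * b1 - a1 * b0)); last by ring.
    by rewrite mulf_neq0.
  apply: (alg _ _ _ _ _ _ _ _ _ _ _ _ (pd_comp 0 dt (smooth_on_diff sa Vt))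
    (pd_comp 1 dt (smooth_on_diff sa Vt)) (pd_comp 0 dt (smooth_on_diff sb Vt))
    (pd_comp 1 dt (smooth_on_diff sb Vt)) (jt _ V'x) (jac _ Vt)).
Qed.

Lemma tangent_to_comp (phi : V2 -> V4) (t : V2 -> V2) x t1 t2 :
  differentiable t x -> differentiable phi (t x) -> jacobian t x != 0 ->
  tangent_to phi (t x) t1 t2 -> tangent_to (phi \o t) x t1 t2.
Proof.
move=> dt dp jt tan w; apply: iff_trans (tan w).
have E i : dotp w (pd i (phi \o t) x) =
    pd i t x 0 0 * dotp w (pd 0 phi (t x)) + pd i t x 0 1 * dotp w (pd 1 phi (t x)).
  apply: (etrans (congr1 (dotp w) (pd_comp i dt dp))).
  by apply: (etrans (dotpDr _ _ _)); congr (_ + _); exact: dotpZr.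
have alg (p0 p1 q0 q1 j00 j01 j10 j11 : R) :
  p0 = j00 * q0 + j01 * q1 -> p1 = j10 * q0 + j11 * q1 ->
  j00 * j11 - j01 * j10 != 0 -> p0 = 0 -> p1 = 0 -> q0 = 0 /\ q1 = 0.
  move=> E0 E1 D0 z0 z1; split; apply: (mulfI D0); rewrite mulr0.
    transitivity (j11 * p0 - j01 * p1); first by rewrite E0 E1; ring.
    by rewrite z0 z1 !mulr0 subr0.
  transitivity (j00 * p1 - j10 * p0); first by rewrite E0 E1; ring.
  by rewrite z0 z1 !mulr0 subr0.
split=> h.
  by have [h0 h1] := alg _ _ _ _ _ _ _ _ (E 0) (E 1) jt (h 0) (h 1); apply: forall_I2.
move=> i; apply: (etrans (E i)); rewrite (h 0) (h 1); by rewrite !mulr0 addr0.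
Qed.

Lemma om_scaler (A B : V2 -> V4) (k : R) i x : om i A (fun y => k *: B y) x = k * om i A B x.
Proof. exact: dotpZr. Qed.

Lemma pd_affine V (h : V2 -> R) (k l : R) i x : smooth_on V h -> V x ->
  pd i (fun y => k * h y + l) x = k * pd i h x.
Proof.
move=> sh Vx; have dh := smooth_on_diff sh Vx.
have dk : differentiable (fun=> k : R) x by exact: differentiable_cst.
apply: (etrans (pdD i (differentiableM dk dh) (differentiable_cst l x))).
apply: (etrans (congr1 (fun z => z + _) (pdM i dk dh))).
apply: (etrans (congr1 (fun z => _ + z) (pd_cst l x i))).
apply: (etrans (congr1 (fun z => z * _ + _ + _) (pd_cst k x i))).
by rewrite mul0r add0r addr0.
Qed.

Lemma smooth_affine V (h : V2 -> R) (k l : R) : open V -> smooth_on V h ->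
  smooth_on V (fun y => k * h y + l).
Proof.
move=> oV sh; apply: (smooth_onD oV); last exact: smooth_on_cst.
by apply: (smooth_onM oV) => //; exact: smooth_on_cst.
Qed.

(** Changing the signs of the normal vectors changes the signs of the diagonal
    forms; the constants of integration are free. *)
Lemma diag_frame_sign V e1 e2 n1 n2 (a b : V2 -> R) (s1 s2 k1 k2 : R) : open V ->
  s1 * s1 = 1 -> s2 * s2 = 1 -> diag_frame V e1 e2 n1 n2 a b ->
  diag_frame V e1 e2 (fun x => s1 *: n1 x) (fun x => s2 *: n2 x)
    (fun x => s1 * a x + k1) (fun x => s2 * b x + k2).
Proof.
move=> oV ss1 ss2 [[se1 se2 sn1 sn2 fr] sa sb h12 h21 da db jac].
split.
- split=> //; try by apply: (smooth_onZ oV) => //; exact: smooth_on_cst.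
  move=> x /fr [q11 q12 q13 q14 q22 q23 q24 q33 q34 q44].
  by split=> //; rewrite ?dotpZr ?dotpZl ?q13 ?q14 ?q23 ?q24 ?q34 ?q33 ?q44 ?mulr0// mulr1.
- exact: smooth_affine.
- exact: smooth_affine.
- by move=> x i Vx; apply: (etrans (om_scaler _ _ _ _ _)); rewrite h12 ?mulr0.
- by move=> x i Vx; apply: (etrans (om_scaler _ _ _ _ _)); rewrite h21 ?mulr0.
- move=> x i Vx; apply: (etrans (om_scaler _ _ _ _ _)).
  by apply: (etrans _ (esym (pd_affine s1 k1 i sa Vx))); rewrite da.
- move=> x i Vx; apply: (etrans (om_scaler _ _ _ _ _)).
  by apply: (etrans _ (esym (pd_affine s2 k2 i sb Vx))); rewrite db.
- move=> x Vx; have := jac x Vx.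
  have alg (p0 p1 q0 q1 a0 a1 b0 b1 : R) : p0 = s1 * a0 -> p1 = s1 * a1 ->
     q0 = s2 * b0 -> q1 = s2 * b1 -> a0 * b1 - a1 * b0 != 0 -> p0 * q1 - p1 * q0 != 0.
    move=> -> -> -> -> h.
    rewrite [X in X != 0](_ : _ = (s1 * s2) * (a0 * b1 - a1 * b0)); last by ring.
    rewrite mulf_neq0// mulf_neq0//.
      by apply/eqP => z; move: ss1; rewrite z mul0r => /eqP; rewrite eq_sym oner_eq0.
    by apply/eqP => z; move: ss2; rewrite z mul0r => /eqP; rewrite eq_sym oner_eq0.
  exact: (alg _ _ _ _ _ _ _ _ (pd_affine s1 k1 0 sa Vx) (pd_affine s1 k1 1 sa Vx)
     (pd_affine s2 k2 0 sb Vx) (pd_affine s2 k2 1 sb Vx)).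
Qed.

Lemma diag_frame_swap V e1 e2 n1 n2 (a b : V2 -> R) :
  diag_frame V e1 e2 n1 n2 a b -> diag_frame V e2 e1 n2 n1 b a.
Proof.
move=> [fr sa sb h12 h21 da db jac].
split; [exact: frame_swap|exact: sb|exact: sa|exact: h21|exact: h12|exact: db|exact: da|].
move=> x Vx; have := jac x Vx.
have alg (a0 a1 b0 b1 : R) : a0 * b1 - a1 * b0 != 0 -> b0 * a1 - b1 * a0 != 0.
  by rewrite -oppr_eq0 opprB (mulrC a1) (mulrC a0).
exact: alg.
Qed.

End Rigidity.

Section Rigidity.
Context {R : realType}.
Local Notation V2 := 'rV[R]_2.
Local Notation V4 := 'rV[R]_4.
Implicit Types (U V : set V2).

(** The matrices of the transformations that preserve the diagonal form:
    diagonal or antidiagonal, with entries 1 and -1. *)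
Definition signed_perm (m11 m12 m21 m22 : R) :=
  [/\ m12 = 0, m21 = 0, m11 * m11 = 1 & m22 * m22 = 1] \/
  [/\ m11 = 0, m22 = 0, m12 * m12 = 1 & m21 * m21 = 1].

Let om_change_algebra (x f1 f2 f1' f2' a1 a2 b1 b2 y z g11 g12 g21 g22 : R) :
  x = a1 * f1 + a2 * f2 -> f1 = - f1' -> f2 = - f2' ->
  f1' = b1 * g11 + b2 * g12 -> f2' = b1 * g21 + b2 * g22 ->
  g11 = - y -> g12 = 0 -> g21 = 0 -> g22 = - z -> x = a1 * b1 * y + a2 * b2 * z.
Proof. by move=> -> -> -> -> -> -> -> -> ->; ring. Qed.

Let cube_algebra (t d p q : R) : t = 0 \/ t * t = 1 -> p = d * (t * t) + t * q ->
  q = d * t + t * d -> p = d -> d = 0.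
Proof.
move=> [->|tt] -> -> h.
  by move: h; rewrite mul0r mulr0 mul0r add0r => /esym.
have h2 : (d + d + d) * (t * t) = d by rewrite -[RHS]h; ring.
by move: h2; rewrite tt mulr1; clear; lra.
Qed.

(** Expand the normal field M and, after exchanging the roles of the two fields,
    the tangent field E: no derivative of a change-of-frame coefficient appears. *)
Lemma om_change V e1 e2 n1 n2 (a b : V2 -> R) (E M : V2 -> V4) x i : open V ->
  diag_frame V e1 e2 n1 n2 a b -> smooth_on V E ->
  (forall y, V y -> dotp (E y) (n1 y) = 0 /\ dotp (E y) (n2 y) = 0) -> V x ->
  dotp (M x) (e1 x) = 0 -> dotp (M x) (e2 x) = 0 ->
  om i E M x = dotp (M x) (n1 x) * dotp (E x) (e1 x) * pd i a x
             + dotp (M x) (n2 x) * dotp (E x) (e2 x) * pd i b x.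
Proof.
move=> oV [[se1 se2 sn1 sn2 fr] sa sb h12 h21 da db jac] sE En Vx M1 M2.
have o := fr _ Vx; have [En1 En2] := En _ Vx.
have EM : om i E M x = dotp (M x) (n1 x) * om i E n1 x + dotp (M x) (n2 x) * om i E n2 x.
  rewrite /om; have eM := oframe_expand (M x) o.
  rewrite M1 M2 !scale0r !add0r in eM; rewrite {1}eM.
  by apply: (etrans (dotpDr _ _ _)); congr (_ + _); exact: dotpZr.
have Ee (n : V2 -> V4) : om i n E x = dotp (E x) (e1 x) * om i n e1 x + dotp (E x) (e2 x) * om i n e2 x.
  rewrite /om; have eE := oframe_expand (E x) o.
  rewrite En1 En2 !scale0r !addr0 in eE; rewrite {1}eE.
  by apply: (etrans (dotpDr _ _ _)); congr (_ + _); exact: dotpZr.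
have k1 : om i E n1 x = - om i n1 E x by apply: (om_skew (k := 0) i oV sE sn1 _ Vx) => y /En [].
have k2 : om i E n2 x = - om i n2 E x by apply: (om_skew (k := 0) i oV sE sn2 _ Vx) => y /En [].
have q11 : om i n1 e1 x = - pd i a x.
  rewrite -(da x i Vx); apply: (om_skew (k := 0) i oV sn1 se1 _ Vx) => y /fr [] *; by rewrite dotpC.
have q12 : om i n1 e2 x = 0.
  rewrite -oppr0 -(h21 x i Vx).
  by apply: (om_skew (k := 0) i oV sn1 se2 _ Vx) => y /fr [] *; rewrite dotpC.
have q21 : om i n2 e1 x = 0.
  rewrite -oppr0 -(h12 x i Vx).
  by apply: (om_skew (k := 0) i oV sn2 se1 _ Vx) => y /fr [] *; rewrite dotpC.
have q22 : om i n2 e2 x = - pd i b x.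
  rewrite -(db x i Vx); apply: (om_skew (k := 0) i oV sn2 se2 _ Vx) => y /fr [] *; by rewrite dotpC.
exact: om_change_algebra EM k1 k2 (Ee n1) (Ee n2) q11 q12 q21 q22.
Qed.

(** Differentiating T^3 = T gives (3 T^2 - 1) dT = 0, and 3 T^2 - 1 is -1 or 2. *)
Lemma sign_or_zero_cst V (T : V2 -> R) : convex_set V -> open V -> smooth_on V T ->
  (forall x, V x -> T x = 0 \/ T x * T x = 1) -> forall x y, V x -> V y -> T x = T y.
Proof.
move=> cV oV sT T01; apply: (pd0_cst cV) => [x Vx|x i Vx]; first exact: smooth_on_diff sT Vx.
have dT := smooth_on_diff sT Vx.
have dTT := smooth_on_diff (smooth_onM oV sT sT) Vx.
have E := pdM i dT dTT; have E2 := pdM i dT dT.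
have E3 : pd i (fun y => T y * (T y * T y)) x = pd i T x.
  apply: (pd_open_eq i oV Vx) => [y /T01 [->|->]|]; [by rewrite !mul0r|by rewrite mulr1|].
  exact: smooth_on_diff (smooth_onM oV sT (smooth_onM oV sT sT)) Vx.
exact: cube_algebra (T01 _ Vx) E E2 E3.
Qed.

(** A nonzero tangential coefficient kills the other normal coefficient that
    multiplies it, hence both orthogonal matrices are diagonal or both are
    antidiagonal. *)
Lemma frame_change_algebra (b11 b12 b21 b22 a11 a12 a21 a22 : R) :
  b11 * b11 + b12 * b12 = 1 -> b21 * b21 + b22 * b22 = 1 ->
  b11 * b11 + b21 * b21 = 1 -> b12 * b12 + b22 * b22 = 1 ->
  a11 * a11 + a12 * a12 = 1 -> a21 * a21 + a22 * a22 = 1 ->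
  a11 * a11 + a21 * a21 = 1 -> a12 * a12 + a22 * a22 = 1 ->
  a21 * b11 = 0 -> a22 * b12 = 0 -> a11 * b21 = 0 -> a12 * b22 = 0 ->
  signed_perm (a11 * b11) (a12 * b12) (a21 * b21) (a22 * b22).
Proof.
move=> B1 B2 B3 B4 A1 A2 A3 A4 h1 h2 h3 h4.
have sq (p q r s : R) : p * p + q * q = 1 -> r * r + s * s = 1 -> q = 0 -> s = 0 ->
    (p * r) * (p * r) = 1.
  move=> E1 E2 q0 s0; move: E1 E2; rewrite q0 s0 mulr0 !addr0 => E1 E2.
  by rewrite mulrACA E1 E2 mulr1.
have ne0 (p q : R) : p * p + q * q = 1 -> p = 0 -> q != 0.
  move=> + p0; rewrite p0 mul0r add0r => E1; apply/eqP => q0.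
  by move: E1; rewrite q0 mul0r => /eqP; rewrite eq_sym oner_eq0.
have cancel (p q : R) : p * q = 0 -> q != 0 -> p = 0.
  by move=> /eqP; rewrite mulf_eq0 => /orP [/eqP|/eqP ->]//; rewrite eqxx.
have cancel' (p q : R) : p * q = 0 -> p != 0 -> q = 0 by move=> h; rewrite mulrC in h; exact: cancel.
case: (eqVneq b11 0) => [b0|b0].
  have b12n := ne0 _ _ B1 b0; have b21n := ne0 _ _ B3 b0.
  have a22z := cancel _ _ h2 b12n; have a11z := cancel _ _ h3 b21n.
  have b22z : b22 = 0 by apply: cancel' h4 _; exact: ne0 A1 a11z.
  right; split; [by rewrite b0 mulr0|by rewrite a22z mul0r| |].
    by apply: sq (etrans (addrC _ _) A1) (etrans (addrC _ _) B1) a11z b0.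
  by apply: sq A2 B2 a22z b22z.
have a21z := cancel _ _ h1 b0.
have a22n : a22 != 0 by apply: ne0 A2 a21z.
have a11n : a11 != 0 by apply: (ne0 a21); rewrite ?[_ + a11 * a11]addrC.
have b12z := cancel' _ _ h2 a22n; have b21z := cancel' _ _ h3 a11n.
left; split; [by rewrite b12z mulr0|by rewrite b21z mulr0| |].
  by apply: sq A3 B1 a21z b12z.
by apply: sq (etrans (addrC _ _) A2) (etrans (addrC _ _) B2) a21z b21z.
Qed.

Lemma linear_indep_jac (x y a0 a1 b0 b1 : R) : a0 * b1 - a1 * b0 != 0 ->
  x * a0 + y * b0 = 0 -> x * a1 + y * b1 = 0 -> x = 0 /\ y = 0.
Proof.
move=> D h0 h1; split; apply: (mulfI D); rewrite mulr0.
  transitivity (b1 * (x * a0 + y * b0) - b0 * (x * a1 + y * b1)); first by ring.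
  by rewrite h0 h1 !mulr0 subr0.
transitivity (a0 * (x * a1 + y * b1) - a1 * (x * a0 + y * b0)); first by ring.
by rewrite h0 h1 !mulr0 subr0.
Qed.

Lemma affine_primitive V (a b a' : V2 -> R) (m1 m2 : R) x0 : convex_set V -> V x0 ->
  smooth_on V a -> smooth_on V b -> smooth_on V a' -> open V ->
  (forall x i, V x -> pd i a' x = m1 * pd i a x + m2 * pd i b x) ->
  exists k, forall x, V x -> a' x = m1 * a x + m2 * b x + k.
Proof.
move=> cV Vx0 sa sb sa' oV H.
pose h y := a' y - ((m1 * a y + 0) + (m2 * b y + 0)).
have s1 := smooth_affine m1 0 oV sa; have s2 := smooth_affine m2 0 oV sb.
have C : forall x y, V x -> V y -> h x = h y.
  apply: (pd0_cst cV) => [x Vx|x i Vx].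
    by apply: (smooth_on_diff _ Vx); apply: (smooth_onB oV sa'); exact: smooth_onD.
  have d1 := smooth_on_diff s1 Vx; have d2 := smooth_on_diff s2 Vx.
  apply: (etrans (pdB i (smooth_on_diff sa' Vx) (differentiableD d1 d2))).
  apply/eqP; rewrite subr_eq0; apply/eqP; apply: (etrans (H x i Vx)); apply: esym.
  apply: (etrans (pdD i d1 d2)).
  by congr (_ + _); [exact: pd_affine sa Vx|exact: pd_affine sb Vx].
exists (h x0) => x Vx; rewrite (C x0 x Vx0 Vx) /h !addr0.
by rewrite [RHS]addrC subrK.
Qed.

(** The off-diagonal forms of the second frame vanish; as da and db are
    independent, this forces the change of frame to be a signed permutation. Its
    entries are smooth with values in {-1, 0, 1}, so they are constant, and the
    primitives differ by constants. *)
Lemma diag_frame_rigid V (phi : V2 -> V4) e1 e2 n1 n2 (a b : V2 -> R) e1' e2' n1' n2' a' b' x0 :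
  open V -> convex_set V -> V x0 ->
  diag_frame V e1 e2 n1 n2 a b -> diag_frame V e1' e2' n1' n2' a' b' ->
  (forall x, V x -> tangent_to phi x (e1 x) (e2 x)) ->
  (forall x, V x -> tangent_to phi x (e1' x) (e2' x)) ->
  exists m11 m12 m21 m22 k1 k2, signed_perm m11 m12 m21 m22 /\
    forall x, V x -> a' x = m11 * a x + m12 * b x + k1 /\ b' x = m21 * a x + m22 * b x + k2.
Proof.
move=> oV cV Vx0 df df' tan tan'.
have [[se1 se2 sn1 sn2 fr] sa sb _ _ _ _ jac] := df.
have [[se1' se2' sn1' sn2' fr'] sa' sb' h12' h21' da' db' _] := df'.
have pl w x : V x -> (dotp w (e1 x) = 0 /\ dotp w (e2 x) = 0) <->
   (dotp w (e1' x) = 0 /\ dotp w (e2' x) = 0).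
  by move=> Vx; apply: iff_trans (tan' _ Vx w); apply: iff_sym; exact: tan.
have nN x : V x -> [/\ dotp (e1' x) (n1 x) = 0, dotp (e1' x) (n2 x) = 0,
   dotp (e2' x) (n1 x) = 0 & dotp (e2' x) (n2 x) = 0].
  move=> Vx; have [q11 q12 q13 q14 q22 q23 q24 q33 q34 q44] := fr _ Vx.
  have [|u1 u2] := (pl (n1 x) x Vx).1; first by rewrite dotpC q13 dotpC q23.
  have [|u3 u4] := (pl (n2 x) x Vx).1; first by rewrite dotpC q14 dotpC q24.
  by split; rewrite dotpC.
have eN x : V x -> [/\ dotp (n1' x) (e1 x) = 0, dotp (n1' x) (e2 x) = 0,
   dotp (n2' x) (e1 x) = 0 & dotp (n2' x) (e2 x) = 0].
  move=> Vx; have [q11 q12 q13 q14 q22 q23 q24 q33 q34 q44] := fr' _ Vx.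
  have [|u1 u2] := (pl (n1' x) x Vx).2; first by rewrite dotpC q13 dotpC q23.
  have [|u3 u4] := (pl (n2' x) x Vx).2; first by rewrite dotpC q14 dotpC q24.
  by split.
pose A1 x := dotp (n1' x) (n1 x); pose A2 x := dotp (n1' x) (n2 x).
pose A3 x := dotp (n2' x) (n1 x); pose A4 x := dotp (n2' x) (n2 x).
pose B1 x := dotp (e1' x) (e1 x); pose B2 x := dotp (e1' x) (e2 x).
pose B3 x := dotp (e2' x) (e1 x); pose B4 x := dotp (e2' x) (e2 x).
have E11 x i : V x -> om i e1' n1' x = A1 x * B1 x * pd i a x + A2 x * B2 x * pd i b x.
  move=> Vx; have [z1 z2 _ _] := eN _ Vx.
  by apply: (om_change i oV df se1' _ Vx z1 z2) => y /nN [].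
have E12 x i : V x -> om i e1' n2' x = A3 x * B1 x * pd i a x + A4 x * B2 x * pd i b x.
  move=> Vx; have [_ _ z1 z2] := eN _ Vx.
  by apply: (om_change i oV df se1' _ Vx z1 z2) => y /nN [].
have E21 x i : V x -> om i e2' n1' x = A1 x * B3 x * pd i a x + A2 x * B4 x * pd i b x.
  move=> Vx; have [z1 z2 _ _] := eN _ Vx.
  by apply: (om_change i oV df se2' _ Vx z1 z2) => y /nN [].
have E22 x i : V x -> om i e2' n2' x = A3 x * B3 x * pd i a x + A4 x * B4 x * pd i b x.
  move=> Vx; have [_ _ z1 z2] := eN _ Vx.
  by apply: (om_change i oV df se2' _ Vx z1 z2) => y /nN [].
have sp x : V x -> signed_perm (A1 x * B1 x) (A2 x * B2 x) (A3 x * B3 x) (A4 x * B4 x).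
  move=> Vx; have o := fr _ Vx; have o' := fr' _ Vx.
  have [m1 m2 m3 m4] := nN _ Vx; have [l1 l2 l3 l4] := eN _ Vx.
  have [z1 z2] := linear_indep_jac (jac _ Vx) (etrans (esym (E12 x 0 Vx)) (h12' x 0 Vx))
    (etrans (esym (E12 x 1 Vx)) (h12' x 1 Vx)).
  have [z3 z4] := linear_indep_jac (jac _ Vx) (etrans (esym (E21 x 0 Vx)) (h21' x 0 Vx))
    (etrans (esym (E21 x 1 Vx)) (h21' x 1 Vx)).
  have S (d e f g w z : V4) : oframe d e f g -> dotp w f = 0 -> dotp w g = 0 ->
     dotp w w = 1 -> dotp w d * dotp w d + dotp w e * dotp w e = 1.
    by move=> oo w1 w2 ww; have := oframe_dotp w w oo; rewrite w1 w2 ww !mul0r !addr0.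
  have S' (d e f g w z : V4) : oframe d e f g -> dotp w d = 0 -> dotp w e = 0 ->
     dotp w w = 1 -> dotp w f * dotp w f + dotp w g * dotp w g = 1.
    by move=> oo w1 w2 ww; have := oframe_dotp w w oo; rewrite w1 w2 ww !mul0r !add0r.
  have C (w v : V4) (r : R) : dotp w v = r -> dotp v w = r by rewrite dotpC.
  apply: frame_change_algebra z1 z2 z3 z4.
  - exact: (S _ _ _ _ _ 0 o m1 m2 (of11 o')).
  - exact: (S _ _ _ _ _ 0 o m3 m4 (of22 o')).
  - rewrite /B1 /B3 !(dotpC _ (e1 x)).
    exact: (S _ _ _ _ _ 0 o' (C _ _ _ l1) (C _ _ _ l3) (of11 o)).
  - rewrite /B2 /B4 !(dotpC _ (e2 x)).
    exact: (S _ _ _ _ _ 0 o' (C _ _ _ l2) (C _ _ _ l4) (of22 o)).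
  - exact: (S' _ _ _ _ _ 0 o l1 l2 (of33 o')).
  - exact: (S' _ _ _ _ _ 0 o l3 l4 (of44 o')).
  - rewrite /A1 /A3 !(dotpC _ (n1 x)).
    exact: (S' _ _ _ _ _ 0 o' (C _ _ _ m1) (C _ _ _ m3) (of33 o)).
  - rewrite /A2 /A4 !(dotpC _ (n2 x)).
    exact: (S' _ _ _ _ _ 0 o' (C _ _ _ m2) (C _ _ _ m4) (of44 o)).
have cst (T : V2 -> R) : smooth_on V T -> (forall x, V x -> T x = 0 \/ T x * T x = 1) ->
   forall x, V x -> T x = T x0.
  by move=> sT T01 x Vx; exact: (sign_or_zero_cst cV oV sT T01).
have sm (e e' n n' : V2 -> V4) : smooth_on V e -> smooth_on V e' -> smooth_on V n -> smooth_on V n' ->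
   smooth_on V (fun x : V2 => dotp (n x) (n' x) * dotp (e x) (e' x)).
  by move=> ? ? ? ?; apply: (smooth_onM oV); apply: smooth_on_dotp.
have c1 := cst _ (sm _ _ _ _ se1' se1 sn1' sn1).
have c2 := cst _ (sm _ _ _ _ se1' se2 sn1' sn2).
have c3 := cst _ (sm _ _ _ _ se2' se1 sn2' sn1).
have c4 := cst _ (sm _ _ _ _ se2' se2 sn2' sn2).
have [k1 K1] : exists k, forall x, V x -> a' x = A1 x0 * B1 x0 * a x + A2 x0 * B2 x0 * b x + k.
  apply: (affine_primitive cV Vx0 sa sb sa' oV) => x i Vx.
  apply: (etrans (esym (da' x i Vx))); apply: (etrans (E11 x i Vx)).
  congr (_ * _ + _ * _); first by apply: c1 => // y /sp [[]|[]]; auto.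
  by apply: c2 => // y /sp [[]|[]]; auto.
have [k2 K2] : exists k, forall x, V x -> b' x = A3 x0 * B3 x0 * a x + A4 x0 * B4 x0 * b x + k.
  apply: (affine_primitive cV Vx0 sa sb sb' oV) => x i Vx.
  apply: (etrans (esym (db' x i Vx))); apply: (etrans (E22 x i Vx)).
  congr (_ * _ + _ * _); first by apply: c3 => // y /sp [[]|[]]; auto.
  by apply: c4 => // y /sp [[]|[]]; auto.
exists (A1 x0 * B1 x0), (A2 x0 * B2 x0), (A3 x0 * B3 x0), (A4 x0 * B4 x0), k1, k2.
by split; [exact: sp|move=> x Vx; split; [exact: K1|exact: K2]].
Qed.

End Rigidity.

(** * The global primitives *)

Section Global.
Context {R : realType} {S : surface R}.
Local Notation V2 := 'rV[R]_2.
Local Notation V4 := 'rV[R]_4.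
Implicit Types (c : chart R S) (p q : S) (U V : set V2).

(** Segments in a chart, parametrized by the retraction clamp so that the path
    is constant before 0 and after 1. *)
Lemma locally_path_connected p (U : set S) : nbhs p U ->
  \forall q \near p, exists g : R -> S,
    [/\ continuous g, forall t : R, t <= 0 -> g t = p, forall t : R, 1 <= t -> g t = q &
        forall t : R, U (g t)].
Proof.
move=> nU; have [c ac cp] := atlas_cover p; set x := cmap c p.
have Ix : cimg c x by exact: cimg_cmap.
have nx : nbhs x (cimg c `&` cinv c @^-1` U).
  apply: filterI; first by apply: open_nbhs_nbhs; split; [exact: cimg_open|].
  by apply: (cinv_continuous ac Ix); rewrite /x cmapK.
have [r br] := nbhs_ex nx.
have nc : \forall q \near p, cdom c q.
  by apply: open_nbhs_nbhs; split; [exact: cdom_open|].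
have nb : \forall q \near p, ball x r%:num (cmap c q).
  by apply: (cmap_continuous ac cp); apply: nbhsx_ballx.
near=> q; have cq : cdom c q by near: q.
have bq : ball x r%:num (cmap c q) by near: q.
have bt (t : R) : ball x r%:num (x + clamp t *: (cmap c q - x)).
  by apply: (@ball_convex _ x r%:num); [exact: ballxx|exact: bq|exact: clamp_itv].
exists (fun t => cinv c (x + clamp t *: (cmap c q - x))); split.
- move=> t; apply: (@continuous_comp _ _ _ (fun t : R => x + clamp t *: (cmap c q - x)) (cinv c)).
    apply: continuousD; first exact: cst_continuous.
    by apply: continuousZl; exact: clamp_continuous.
  by apply: (cinv_continuous ac); exact: (br _ (bt t)).1.
- by move=> t t0; rewrite clamp0// scale0r addr0 /x cmapK.
- by move=> t t1; rewrite clamp1// scale1r addrC subrK cmapK.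
- by move=> t; exact: (br _ (bt t)).2.
Unshelve. all: end_near. Qed.

Lemma diag_frame_ext V e1 e2 n1 n2 (a b a' b' : V2 -> R) : open V ->
  (forall x, V x -> a x = a' x) -> (forall x, V x -> b x = b' x) ->
  diag_frame V e1 e2 n1 n2 a b -> diag_frame V e1 e2 n1 n2 a' b'.
Proof.
move=> oV aa bb [fr sa sb h12 h21 da db jac].
have pa i x : V x -> pd i a x = pd i a' x.
  by move=> Vx; exact: (pd_open_eq i oV Vx aa (smooth_on_diff sa Vx)).
have pb i x : V x -> pd i b x = pd i b' x.
  by move=> Vx; exact: (pd_open_eq i oV Vx bb (smooth_on_diff sb Vx)).
split; [exact: fr|exact: smooth_on_eq aa sa|exact: smooth_on_eq bb sb|exact: h12|exact: h21| | |].
- by move=> x i Vx; apply: (etrans (da x i Vx)); exact: pa.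
- by move=> x i Vx; apply: (etrans (db x i Vx)); exact: pb.
- have alg (a0 a1 b0 b1 c0 c1 d0 d1 : R) : a0 = c0 -> a1 = c1 -> b0 = d0 -> b1 = d1 ->
    a0 * b1 - a1 * b0 != 0 -> c0 * d1 - c1 * d0 != 0 by move=> -> -> -> ->.
  move=> x Vx.
  exact: (alg _ _ _ _ _ _ _ _ (pa 0 x Vx) (pa 1 x Vx) (pb 0 x Vx) (pb 1 x Vx) (jac x Vx)).
Qed.

Lemma tangent_to_ext V (phi psi : V2 -> V4) x t1 t2 : open V -> V x ->
  (forall y, V y -> phi y = psi y) -> differentiable phi x ->
  tangent_to phi x t1 t2 -> tangent_to psi x t1 t2.
Proof.
move=> oV Vx e dp tan w; apply: iff_trans (tan w).
by split=> h i; [rewrite (pd_open_eq i oV Vx e dp)|rewrite -(pd_open_eq i oV Vx e dp)]; exact: h.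
Qed.

Variable f : S -> V4.
Hypothesis sf : smooth f.
Implicit Types (h : S -> R * R).

(** The primitives are read off from a map h defined on the surface, so that
    solutions in different charts can be compared. *)
Definition framed c V h e1 e2 n1 n2 :=
  [/\ open V, V `<=` cimg c,
    diag_frame V e1 e2 n1 n2 (fun x => (h (cinv c x)).1) (fun x => (h (cinv c x)).2) &
    forall x, V x -> tangent_to (f \o cinv c) x (e1 x) (e2 x)].

Lemma framed_sub c V V' h e1 e2 n1 n2 : open V' -> V' `<=` V ->
  framed c V h e1 e2 n1 n2 -> framed c V' h e1 e2 n1 n2.
Proof.
move=> oV' VV [oV Vc df tan]; split=> //.
- exact: subset_trans Vc.
- exact: diag_frame_sub df.
- by move=> x /VV; exact: tan.
Qed.

Lemma framed_chart c c' p V h e1 e2 n1 n2 : atlas c -> atlas c' -> cdom c p -> cdom c' p ->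
  V (cmap c p) -> framed c V h e1 e2 n1 n2 ->
  exists V' e1' e2' n1' n2', V' (cmap c' p) /\ framed c' V' h e1' e2' n1' n2'.
Proof.
move=> ac ac' cp c'p Vp [oV Vc df tan].
have [V' [oV' V'p V'c st H]] := transition ac ac' cp c'p oV Vp.
pose t := cmap c \o cinv c'.
have VV x : V' x -> V (t x) by move=> /H [].
have jt x : V' x -> jacobian t x != 0.
  move=> V'x; have [e d] := cinvK ac' (V'c _ V'x); have [_ cx _] := H _ V'x.
  by rewrite -e; exact: transition_jacobian.
exists V', (e1 \o t), (e2 \o t), (n1 \o t), (n2 \o t); split=> //; split=> //.
  apply: diag_frame_ext (diag_frame_comp oV oV' VV st jt df) => //.
    by move=> x /H [_ _ e] /=; rewrite e.
  by move=> x /H [_ _ e] /=; rewrite e.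
move=> x V'x; have dt := smooth_on_diff st V'x.
have df' : differentiable (f \o cinv c) (t x).
  by apply: smooth_on_diff (sf ac) _; apply: Vc; exact: VV.
apply: (@tangent_to_ext V' ((f \o cinv c) \o t)) => //.
- by move=> y /H [_ _ e] /=; rewrite e.
- exact: differentiable_comp.
- by apply: tangent_to_comp => //; [exact: jt|apply: tan; exact: VV].
Qed.

(** The existence of a frame in one chart suffices, by framed_chart. *)
Definition frame_sol p h := exists c V e1 e2 n1 n2,
  [/\ atlas c, cdom c p, V (cmap c p) & framed c V h e1 e2 n1 n2].

Lemma frame_sol_chart p h c : frame_sol p h -> atlas c -> cdom c p ->
  exists r e1 e2 n1 n2, 0 < r /\ framed c (ball (cmap c p) r) h e1 e2 n1 n2.
Proof.
move=> [c' [V [e1 [e2 [n1 [n2 [ac' c'p Vp fr]]]]]]] ac cp.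
have [V' [d1 [d2 [m1 [m2 [V'p fr']]]]]] := framed_chart ac' ac c'p cp Vp fr.
have [oV' _ _ _] := fr'; have [r bV] := nbhs_ex (open_nbhs_nbhs (conj oV' V'p)).
exists r%:num, d1, d2, m1, m2; split=> //; apply: framed_sub fr'; first exact: ball_open.
exact: bV.
Qed.

Lemma frame_sol_open p h : frame_sol p h -> \forall q \near p, frame_sol q h.
Proof.
move=> [c [V [e1 [e2 [n1 [n2 [ac cp Vp fr]]]]]]]; have [oV _ _ _] := fr.
have nc : \forall q \near p, cdom c q.
  by apply: open_nbhs_nbhs; split; [exact: cdom_open|].
have nV : \forall q \near p, V (cmap c q).
  by apply: (cmap_continuous ac cp); apply: open_nbhs_nbhs.
near=> q; exists c, V, e1, e2, n1, n2; split=> //; by near: q.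
Unshelve. all: end_near. Qed.

Lemma near_chart c p (P : S -> Prop) : atlas c -> cdom c p -> (\forall q \near p, P q) ->
  exists r, [/\ 0 < r, ball (cmap c p) r `<=` cimg c & forall x, ball (cmap c p) r x -> P (cinv c x)].
Proof.
move=> ac cp nP; have Ix := cimg_cmap cp.
have nx : nbhs (cmap c p) (cimg c `&` cinv c @^-1` P).
  apply: filterI; first by apply: open_nbhs_nbhs; split; [exact: cimg_open|].
  by apply: (cinv_continuous ac Ix); rewrite cmapK.
have [r br] := nbhs_ex nx; exists r%:num; split=> // x /br [] //.
Qed.

Lemma chart_near c p r (P : S -> Prop) : atlas c -> cdom c p -> 0 < r ->
  (forall x, ball (cmap c p) r x -> P (cinv c x)) -> \forall q \near p, P q.
Proof.
move=> ac cp r0 H.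
have nc : \forall q \near p, cdom c q.
  by apply: open_nbhs_nbhs; split; [exact: cdom_open|].
have nb : \forall q \near p, ball (cmap c p) r (cmap c q).
  by apply: (cmap_continuous ac cp); exact: nbhsx_ballx.
near=> q; rewrite -(cmapK (p := q) ac); last by near: q.
by apply: H; near: q.
Unshelve. all: end_near. Qed.

Lemma frame_sol_germ p h k : germ_eq p h k -> frame_sol p h -> frame_sol p k.
Proof.
move=> hk [c [V [e1 [e2 [n1 [n2 [ac cp Vp fr]]]]]]]; have [oV _ _ _] := fr.
have [r [r0 _ H]] := near_chart ac cp hk.
exists c, (V `&` ball (cmap c p) r), e1, e2, n1, n2; split=> //.
  by split=> //; exact: ballxx.
have oV' : open (V `&` ball (cmap c p) r) by apply: openI => //; exact: ball_open.
have [|_ Vc df tan] := framed_sub oV' _ fr; first by move=> x [].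
by split=> //; apply: diag_frame_ext df => // x [_ /H ->].
Qed.

Definition signed_affine (al : R * R -> R * R) := exists m11 m12 m21 m22 k1 k2,
  signed_perm m11 m12 m21 m22 /\
  forall y, al y = (m11 * y.1 + m12 * y.2 + k1, m21 * y.1 + m22 * y.2 + k2).

Lemma frame_sol_rigid p h k : frame_sol p h -> frame_sol p k ->
  exists2 al, signed_affine al & germ_eq p k (al \o h).
Proof.
move=> sh sk; have [c ac cp] := atlas_cover p.
have [r [e1 [e2 [n1 [n2 [r0 fr]]]]]] := frame_sol_chart sh ac cp.
have [r' [e1' [e2' [n1' [n2' [r'0 fr']]]]]] := frame_sol_chart sk ac cp.
pose s := Num.min r r'; have s0 : 0 < s by rewrite lt_min r0.
have os : open (ball (cmap c p) s) by exact: ball_open.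
have [|_ _ df tan] := framed_sub os _ fr.
  by apply: le_ball; rewrite ge_min lexx.
have [|_ _ df' tan'] := framed_sub os _ fr'.
  by apply: le_ball; rewrite ge_min lexx orbT.
have [m11 [m12 [m21 [m22 [k1 [k2 [sp H]]]]]]] :=
  diag_frame_rigid os (@ball_convex _ _ s) (ballxx _ s0) df df' tan tan'.
exists (fun y => (m11 * y.1 + m12 * y.2 + k1, m21 * y.1 + m22 * y.2 + k2)).
  by exists m11, m12, m21, m22, k1, k2.
apply: (chart_near ac cp s0) => x /H [E1 E2] /=.
by rewrite [LHS]surjective_pairing E1 E2.
Qed.

Lemma frame_sol_inv p h al : signed_affine al -> frame_sol p h -> frame_sol p (al \o h).
Proof.
move=> [m11 [m12 [m21 [m22 [k1 [k2 [sp alE]]]]]]] [c [V [e1 [e2 [n1 [n2 [ac cp Vp fr]]]]]]].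
have [oV Vc df tan] := fr.
case: sp => [[z1 z2 s1 s2]|[z1 z2 s1 s2]].
  exists c, V, e1, e2, (fun x => m11 *: n1 x), (fun x => m22 *: n2 x); split=> //; split=> //.
  apply: diag_frame_ext (diag_frame_sign k1 k2 oV s1 s2 df) => // x Vx /=.
    by rewrite alE z1 mul0r addr0.
  by rewrite alE z2 mul0r add0r.
exists c, V, e2, e1, (fun x => m12 *: n2 x), (fun x => m21 *: n1 x); split=> //; split=> //.
  apply: diag_frame_ext (diag_frame_sign k1 k2 oV s1 s2 (diag_frame_swap df)) => // x Vx /=.
    by rewrite alE z1 mul0r add0r.
  by rewrite alE z2 mul0r addr0.
by move=> x Vx w; apply: iff_trans (tan x Vx w) _; split=> -[].
Qed.

(** On the level of differentials the transformation fixes da and db, which form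
    a coframe, so its linear part is the identity; evaluating at p, so is its
    translation part. *)
Lemma frame_sol_free p h al : signed_affine al -> frame_sol p h -> germ_eq p (al \o h) h ->
  forall y, al y = y.
Proof.
move=> [m11 [m12 [m21 [m22 [k1 [k2 [_ alE]]]]]]] sh g; have [c ac cp] := atlas_cover p.
have [r [e1 [e2 [n1 [n2 [r0 [oV Vc df tan]]]]]]] := frame_sol_chart sh ac cp.
have [r' [r'0 _ H]] := near_chart ac cp g.
pose s := Num.min r r'; have s0 : 0 < s by rewrite lt_min r0.
have os : open (ball (cmap c p) s) by exact: ball_open.
have sr : ball (cmap c p) s `<=` ball (cmap c p) r by apply: le_ball; rewrite ge_min lexx.
have sr' : ball (cmap c p) s `<=` ball (cmap c p) r' by apply: le_ball; rewrite ge_min lexx orbT.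
have [_ sa sb _ _ _ _ jac] := diag_frame_sub sr df.
set a := (fun x => _) in sa jac; set b := (fun x => _) in sb jac.
have x0 := ballxx (cmap c p) s0.
have aE x : ball (cmap c p) s x -> m11 * a x + m12 * b x + k1 = a x.
  by move=> /sr' /H; rewrite /= alE /a /b; case: (h (cinv c x)) => u v [].
have bE x : ball (cmap c p) s x -> m21 * a x + m22 * b x + k2 = b x.
  by move=> /sr' /H; rewrite /= alE /a /b; case: (h (cinv c x)) => u v [].
have dlin (m1 m2 k : R) i : pd i (fun x => m1 * a x + m2 * b x + k) (cmap c p) =
    m1 * pd i a (cmap c p) + m2 * pd i b (cmap c p).
  have s1 := smooth_affine m1 0 os sa; have s2 := smooth_affine m2 k os sb.
  have d1 := smooth_on_diff s1 x0; have d2 := smooth_on_diff s2 x0.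
  have -> : (fun x => m1 * a x + m2 * b x + k) = (fun x => (m1 * a x + 0) + (m2 * b x + k)).
    by apply/funext => x; rewrite addr0 addrA.
  apply: (etrans (pdD i d1 d2)).
  by congr (_ + _); [exact: pd_affine sa x0|exact: pd_affine sb x0].
have slin (m1 m2 k : R) : smooth_on (ball (cmap c p) s) (fun x => m1 * a x + m2 * b x + k).
  apply: (smooth_onD os); last exact: smooth_on_cst.
  by apply: (smooth_onD os); apply: (smooth_onM os) => //; exact: smooth_on_cst.
have Da i : m11 * pd i a (cmap c p) + m12 * pd i b (cmap c p) = pd i a (cmap c p).
  apply: (etrans (esym (dlin m11 m12 k1 i))).
  exact: (pd_open_eq i os x0 aE (smooth_on_diff (slin _ _ _) x0)).
have Db i : m21 * pd i a (cmap c p) + m22 * pd i b (cmap c p) = pd i b (cmap c p).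
  apply: (etrans (esym (dlin m21 m22 k2 i))).
  exact: (pd_open_eq i os x0 bE (smooth_on_diff (slin _ _ _) x0)).
have J := jac _ x0.
have sub1 (m1 m2 u v w : R) : m1 * u + m2 * v = u -> (m1 - 1) * u + m2 * v = 0.
  by move=> e; rewrite mulrBl mul1r addrAC e subrr.
have sub2 (m1 m2 u v w : R) : m1 * u + m2 * v = v -> m1 * u + (m2 - 1) * v = 0.
  by move=> e; rewrite mulrBl mul1r addrA e subrr.
have [M1 M2] := linear_indep_jac J (sub1 _ _ _ _ 0 (Da 0)) (sub1 _ _ _ _ 0 (Da 1)).
have [M3 M4] := linear_indep_jac J (sub2 _ _ _ _ 0 (Db 0)) (sub2 _ _ _ _ 0 (Db 1)).
move/eqP: M1; rewrite subr_eq0 => /eqP M1; move/eqP: M4; rewrite subr_eq0 => /eqP M4.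
have K1 := aE _ x0; have K2 := bE _ x0.
rewrite M1 M2 mul1r mul0r addr0 in K1; rewrite M3 M4 mul1r mul0r add0r in K2.
have k10 : k1 = 0 by apply: (addrI (a (cmap c p))); rewrite addr0.
have k20 : k2 = 0 by apply: (addrI (b (cmap c p))); rewrite addr0.
by move=> [y1 y2]; rewrite alE /= M1 M2 M3 M4 k10 k20 !mul1r !mul0r !addr0 add0r.
Qed.

Variable G : S -> 'M[R]_4.
Hypothesis (flat : flat_surface f) (nflat : flat_normal_bundle f).
Hypothesis (gauss : is_gauss_map f G) (regular : immersion G).

Lemma frame_sol_exists p : exists h, frame_sol p h.
Proof.
have [c ac cp] := atlas_cover p; have Ip := cimg_cmap cp; have oI := cimg_open ac.
have [[_ injf] riem] := flat; have [sG injG] := regular; have [_ gm] := gauss.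
have [r [e1 [e2 [n1 [n2 [a [b [r0 bI df tan]]]]]]]] : exists r e1 e2 n1 n2 a b,
    [/\ 0 < r, ball (cmap c p) r `<=` cimg c, diag_frame (ball (cmap c p) r) e1 e2 n1 n2 a b &
    forall x, ball (cmap c p) r x -> tangent_to (f \o cinv c) x (e1 x) (e2 x)].
  apply: (@immersion_diag_frame _ (cimg c) (f \o cinv c) (G \o cinv c) (cmap c p)) => //.
  - exact: sf.
  - by move=> x cx; have [e d] := cinvK ac cx; rewrite -e; exact: injf.
  - by move=> x cx l i j k; exact: riem.
  - by move=> V xi oV VI sxi nxi i j x Vx; exact: (nflat ac oV VI sxi nxi).
  - exact: sG.
  - by move=> x cx; have [e d] := cinvK ac cx; rewrite -e; exact: injG.
  - move=> x cx; have [e d] := cinvK ac cx.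
    have [u [v [[tu tv uu vv uv] GE]]] := gm (cinv c x); exists u, v; split; last exact: GE.
    have [X XE] := tangent_plane_chart sf ac d tu.
    have [Y YE] := tangent_plane_chart sf ac d tv.
    split; [exists X|exists Y|exact: uu|exact: vv|exact: uv].
      exact: (etrans XE (congr1 (fun z => 'd (f \o cinv c) z X) e)).
    exact: (etrans YE (congr1 (fun z => 'd (f \o cinv c) z Y) e)).
exists (fun q => (a (cmap c q), b (cmap c q))), c, (ball (cmap c p) r), e1, e2, n1, n2.
split=> //; first exact: ballxx.
split=> //; first exact: ball_open.
apply: diag_frame_ext df => [|x bx|x bx] /=; first exact: ball_open.
  by have [-> _] := cinvK ac (bI _ bx).
by have [-> _] := cinvK ac (bI _ bx).
Qed.

Lemma global_frame : simply_connected R S -> exists h, forall p, frame_sol p h.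
Proof.
move=> sc; apply: (@rigid_global_section R S (R * R)%type frame_sol signed_affine sc).
- exact: locally_path_connected.
- exact: frame_sol_open.
- exact: frame_sol_germ.
- exact: frame_sol_exists.
- exact: frame_sol_rigid.
- exact: frame_sol_inv.
- exact: frame_sol_free.
Qed.

End Global.

(** * Structure equations of a diagonal frame *)

Section Structure.
Context {R : realType}.
Local Notation V2 := 'rV[R]_2.
Local Notation V4 := 'rV[R]_4.
Variables (V : set V2) (e1 e2 n1 n2 : V2 -> V4) (a b u v : V2 -> R).
Hypothesis oV : open V.
Hypothesis df : diag_frame V e1 e2 n1 n2 a b.
Hypotheses (su : smooth_on V u) (sv : smooth_on V v).
Hypothesis ua : forall x i, V x -> pd i a x = pd i u x + pd i v x.
Hypothesis ub : forall x i, V x -> pd i b x = pd i u x - pd i v x.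

Lemma om_normal x i : V x ->
  [/\ om i n1 e1 x = - pd i a x, om i n1 e2 x = 0, om i n2 e1 x = 0 & om i n2 e2 x = - pd i b x].
Proof.
move=> Vx; have [[se1 se2 sn1 sn2 fr] sa sb h12 h21 da db jac] := df.
split.
- rewrite -(da x i Vx); apply: (om_skew (k := 0) i oV sn1 se1 _ Vx) => y /fr [] *; by rewrite dotpC.
- rewrite -oppr0 -(h21 x i Vx).
  by apply: (om_skew (k := 0) i oV sn1 se2 _ Vx) => y /fr [] *; rewrite dotpC.
- rewrite -oppr0 -(h12 x i Vx).
  by apply: (om_skew (k := 0) i oV sn2 se1 _ Vx) => y /fr [] *; rewrite dotpC.
- rewrite -(db x i Vx); apply: (om_skew (k := 0) i oV sn2 se2 _ Vx) => y /fr [] *; by rewrite dotpC.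
Qed.

Lemma om_diag x i : V x ->
  [/\ om i e1 e1 x = 0, om i e2 e2 x = 0, om i n1 n1 x = 0 & om i n2 n2 x = 0].
Proof.
move=> Vx; have [[se1 se2 sn1 sn2 fr] sa sb h12 h21 da db jac] := df.
by split; [apply: (om_self (k := 1) i oV se1 _ Vx)|apply: (om_self (k := 1) i oV se2 _ Vx)
  |apply: (om_self (k := 1) i oV sn1 _ Vx)|apply: (om_self (k := 1) i oV sn2 _ Vx)] => y /fr [].
Qed.

Lemma om_rotation x i : V x -> om i e2 e1 x = - om i e1 e2 x /\ om i n2 n1 x = - om i n1 n2 x.
Proof.
move=> Vx; have [[se1 se2 sn1 sn2 fr] sa sb h12 h21 da db jac] := df.
by split; [apply: (om_skew (k := 0) i oV se2 se1 _ Vx)|apply: (om_skew (k := 0) i oV sn2 sn1 _ Vx)]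
  => y /fr [] *; rewrite dotpC.
Qed.

Lemma om_dotp (A B : V2 -> V4) i j x : V x ->
  dotp (pd i A x) (pd j B x) = om i A e1 x * om j B e1 x + om i A e2 x * om j B e2 x
    + om i A n1 x * om j B n1 x + om i A n2 x * om j B n2 x.
Proof. by move=> Vx; have [[_ _ _ _ fr] _ _ _ _ _ _ _] := df; exact: oframe_dotp (fr _ Vx). Qed.

Let curl_algebra (l p0 p1 q0 q1 r0 r1 s0 s1 p0' p1' q0' q1' r0' r1' s0' s1' d d' : R) :
  l = d - d' -> d = p1 * p0' + q1 * q0' + r1 * r0' + s1 * s0' ->
  d' = p0 * p1' + q0 * q1' + r0 * r1' + s0 * s1' ->
  l = (p1 * p0' - p0 * p1') + (q1 * q0' - q0 * q1') + (r1 * r0' - r0 * r1') + (s1 * s0' - s0 * s1').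
Proof. by move=> -> -> ->; ring. Qed.

(** The structure equation for <dA,B>, with the scalar products of derivatives
    expanded in the frame. *)
Lemma maurer_cartan (A B : V2 -> V4) x : smooth_on V A -> smooth_on V B -> V x ->
  pd 0 (om 1 A B) x - pd 1 (om 0 A B) x =
    (om 1 A e1 x * om 0 B e1 x - om 0 A e1 x * om 1 B e1 x)
  + (om 1 A e2 x * om 0 B e2 x - om 0 A e2 x * om 1 B e2 x)
  + (om 1 A n1 x * om 0 B n1 x - om 0 A n1 x * om 1 B n1 x)
  + (om 1 A n2 x * om 0 B n2 x - om 0 A n2 x * om 1 B n2 x).
Proof.
move=> sA sB Vx.
exact: curl_algebra (om_curl oV sA sB Vx) (om_dotp A B 1 0 Vx) (om_dotp A B 0 1 Vx).
Qed.

Let quad_algebra (l p1 p0 p1' p0' q1 q0 q1' q0' r1 r0 r1' r0' s1 s0 s1' s0' P Q U W : R) :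
  l = (p1 * p0' - p0 * p1') + (q1 * q0' - q0 * q1') + (r1 * r0' - r0 * r1') + (s1 * s0' - s0 * s1') ->
  p1 * p0' - p0 * p1' = P -> q1 * q0' - q0 * q1' = Q -> r1 * r0' - r0 * r1' = U ->
  s1 * s0' - s0 * s1' = W -> l = P + Q + U + W.
Proof. by move=> -> -> -> -> ->. Qed.

Let z_left (p1 p0 p1' p0' : R) : p1 = 0 -> p0 = 0 -> p1 * p0' - p0 * p1' = 0.
Proof. by move=> -> ->; rewrite !mul0r subr0. Qed.

Let z_right (p1 p0 p1' p0' : R) : p1' = 0 -> p0' = 0 -> p1 * p0' - p0 * p1' = 0.
Proof. by move=> -> ->; rewrite !mulr0 subr0. Qed.

Lemma psi_closed x : V x -> pd 0 (om 1 n1 n2) x = pd 1 (om 0 n1 n2) x.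
Proof.
move=> Vx; have [[se1 se2 sn1 sn2 fr] sa sb h12 h21 da db jac] := df.
have [_ _ q0 _] := om_normal 0 Vx; have [_ p1 q1 _] := om_normal 1 Vx; have [_ p0 _ _] := om_normal 0 Vx.
have [_ _ r0 s0] := om_diag 0 Vx; have [_ _ r1 s1] := om_diag 1 Vx.
apply/eqP; rewrite -subr_eq0; apply/eqP.
apply: (etrans (quad_algebra (maurer_cartan sn1 sn2 Vx) (z_right _ _ q1 q0) (z_left _ _ p1 p0)
  (z_left _ _ r1 r0) (z_right _ _ s1 s0))).
by rewrite !addr0.
Qed.

Lemma rho_closed x : V x -> pd 0 (om 1 e1 e2) x = pd 1 (om 0 e1 e2) x.
Proof.
move=> Vx; have [[se1 se2 sn1 sn2 fr] sa sb h12 h21 da db jac] := df.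
have [r0 s0 _ _] := om_diag 0 Vx; have [r1 s1 _ _] := om_diag 1 Vx.
apply/eqP; rewrite -subr_eq0; apply/eqP.
apply: (etrans (quad_algebra (maurer_cartan se1 se2 Vx) (z_left _ _ r1 r0) (z_right _ _ s1 s0)
  (z_right _ _ (h21 x 1 Vx) (h21 x 0 Vx)) (z_left _ _ (h12 x 1 Vx) (h12 x 0 Vx)))).
by rewrite !addr0.
Qed.

Let mixed_algebra (A1 A0 f1 f0 g1 g0 h1 h0 a1 a0 b1 b0 : R) :
  h1 = - b1 -> h0 = - b0 -> g1 = - f1 -> g0 = - f0 ->
  0 + (A1 * h0 - A0 * h1) + (a1 * g0 - a0 * g1) + 0 = 0 ->
  a0 * f1 - a1 * f0 = A1 * b0 - A0 * b1.
Proof.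
move=> -> -> -> -> h; apply/eqP; rewrite -subr_eq0; apply/eqP; rewrite -[RHS]h; ring.
Qed.

Let mixed_algebra2 (A1 A0 f1 f0 r1 r0 a1 a0 b1 b0 h1 h0 : R) :
  A1 = - r1 -> A0 = - r0 -> h1 = - a1 -> h0 = - a0 ->
  (A1 * h0 - A0 * h1) + 0 + 0 + (b1 * f0 - b0 * f1) = 0 ->
  b0 * f1 - b1 * f0 = r1 * a0 - r0 * a1.
Proof.
move=> -> -> -> -> h; apply/eqP; rewrite -subr_eq0 -oppr_eq0; apply/eqP; rewrite -[RHS]h; ring.
Qed.

Let curl0 (A B : V2 -> V4) x : smooth_on V (om 1 A B) -> smooth_on V (om 0 A B) -> V x ->
  (forall y i, V y -> om i A B y = 0) -> pd 0 (om 1 A B) x - pd 1 (om 0 A B) x = 0.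
Proof.
move=> s1 s0 Vx H.
have E i j : smooth_on V (om i A B) -> pd j (om i A B) x = 0.
  move=> s; apply: (etrans _ (pd_cst (0 : R) x j)).
  by apply: (pd_open_eq j oV Vx _ (smooth_on_diff s Vx)) => y Vy; exact: H.
by rewrite (E _ _ s1) (E _ _ s0) subrr.
Qed.

(** The structure equations of the vanishing forms <de1,n2> and <de2,n1>: with
    psi = <dn1,n2> and rho = <de1,e2> they read da /\ psi = db /\ rho and db /\
    psi = da /\ rho. *)
Lemma mixed_structure x : V x ->
  pd 0 a x * om 1 n1 n2 x - pd 1 a x * om 0 n1 n2 x =
    om 1 e1 e2 x * pd 0 b x - om 0 e1 e2 x * pd 1 b x /\
  pd 0 b x * om 1 n1 n2 x - pd 1 b x * om 0 n1 n2 x =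
    om 1 e1 e2 x * pd 0 a x - om 0 e1 e2 x * pd 1 a x.
Proof.
move=> Vx; have [[se1 se2 sn1 sn2 fr] sa sb h12 h21 da db jac] := df.
have [a0 z0 y0 b0] := om_normal 0 Vx; have [a1 z1 y1 b1] := om_normal 1 Vx.
have [r0 s0 t0 w0] := om_diag 0 Vx; have [r1 s1 t1 w1] := om_diag 1 Vx.
have [R0 S0] := om_rotation 0 Vx; have [R1 S1] := om_rotation 1 Vx.
split.
  have E := quad_algebra (maurer_cartan se1 sn2 Vx) (z_left _ _ r1 r0) (erefl _) (erefl _) (z_right _ _ w1 w0).
  have C := curl0 (smooth_om 1 oV se1 sn2) (smooth_om 0 oV se1 sn2) Vx h12.
  have F := etrans (esym E) C; rewrite (da x 1 Vx) (da x 0 Vx) in F.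
  exact: mixed_algebra b1 b0 S1 S0 F.
have E := quad_algebra (maurer_cartan se2 sn1 Vx) (erefl _) (z_left _ _ s1 s0) (z_right _ _ t1 t0) (erefl _).
have C := curl0 (smooth_om 1 oV se2 sn1) (smooth_om 0 oV se2 sn1) Vx h21.
have F := etrans (esym E) C; rewrite (db x 1 Vx) (db x 0 Vx) in F.
exact: mixed_algebra2 R1 R0 a1 a0 F.
Qed.

Lemma uv_jacobian x : V x -> pd 0 u x * pd 1 v x - pd 1 u x * pd 0 v x != 0.
Proof.
move=> Vx; have [_ _ _ _ _ _ _ jac] := df.
have alg (a0 a1 b0 b1 u0 u1 v0 v1 : R) : a0 = u0 + v0 -> a1 = u1 + v1 -> b0 = u0 - v0 ->
   b1 = u1 - v1 -> a0 * b1 - a1 * b0 != 0 -> u0 * v1 - u1 * v0 != 0.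
  move=> -> -> -> ->; apply: contra => /eqP h.
  rewrite [X in X == 0](_ : _ = - (u0 * v1 - u1 * v0) * 2); last by ring.
  by rewrite h oppr0 mul0r.
exact: alg (ua 0 Vx) (ua 1 Vx) (ub 0 Vx) (ub 1 Vx) (jac x Vx).
Qed.

Let D x := pd 0 u x * pd 1 v x - pd 1 u x * pd 0 v x.
(** The coefficient of dv in psi = <dn1,n2>, by Cramer's rule. *)
Definition kappa x := (pd 0 u x * om 1 n1 n2 x - pd 1 u x * om 0 n1 n2 x) * (D x)^-1.
Let lam x := (pd 1 v x * om 0 n1 n2 x - pd 0 v x * om 1 n1 n2 x) * (D x)^-1.

Lemma smooth_kappa : smooth_on V kappa.
Proof.
have [[se1 se2 sn1 sn2 fr] sa sb h12 h21 da db jac] := df.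
have pu i := smooth_on_pd i su; have pv i := smooth_on_pd i sv.
have so i := smooth_om i oV sn1 sn2.
apply: (smooth_onM oV).
  by apply: (smooth_onB oV); apply: (smooth_onM oV); [exact: pu|exact: so|exact: pu|exact: so].
apply: (smooth_onV oV) => [x Vx|]; first exact: uv_jacobian.
by apply: (smooth_onB oV); apply: (smooth_onM oV); [exact: pu|exact: pv|exact: pu|exact: pv].
Qed.

Let cramer (u0 u1 v0 v1 p0 p1 : R) : let d := u0 * v1 - u1 * v0 in d != 0 ->
  p0 = (v1 * p0 - v0 * p1) * d^-1 * u0 + (u0 * p1 - u1 * p0) * d^-1 * v0 /\
  p1 = (v1 * p0 - v0 * p1) * d^-1 * u1 + (u0 * p1 - u1 * p0) * d^-1 * v1.
Proof.
move=> d d0; split; apply: (mulIf d0).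
  rewrite mulrDl ![_ * d^-1 * _ * d]mulrAC !mulfVK// /d; ring.
rewrite mulrDl ![_ * d^-1 * _ * d]mulrAC !mulfVK// /d; ring.
Qed.

Lemma psi_uv x i : V x -> om i n1 n2 x = lam x * pd i u x + kappa x * pd i v x.
Proof.
move=> Vx; have [h0 h1] := cramer (om 0 n1 n2 x) (om 1 n1 n2 x) (uv_jacobian Vx).
by move: i; apply: forall_I2; [exact: h0|exact: h1].
Qed.

Let sum_algebra (a0 a1 b0 b1 u0 u1 v0 v1 f0 f1 r0 r1 : R) : let d := u0 * v1 - u1 * v0 in d != 0 ->
  a0 = u0 + v0 -> a1 = u1 + v1 -> b0 = u0 - v0 -> b1 = u1 - v1 ->
  a0 * f1 - a1 * f0 = r1 * b0 - r0 * b1 -> b0 * f1 - b1 * f0 = r1 * a0 - r0 * a1 ->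
  f0 + r0 = 2 * ((u0 * f1 - u1 * f0) * d^-1 * v0) /\ f1 + r1 = 2 * ((u0 * f1 - u1 * f0) * d^-1 * v1).
Proof.
move=> d d0 -> -> -> -> h1 h2.
have k1 : v0 * (f1 + r1) = v1 * (f0 + r0).
  have h3 : (u0 + v0) * f1 - (u1 + v1) * f0 - ((u0 - v0) * f1 - (u1 - v1) * f0) =
    r1 * (u0 - v0) - r0 * (u1 - v1) - (r1 * (u0 + v0) - r0 * (u1 + v1)) by rewrite h1 h2.
  have {h1 h2} : 2 * (v0 * (f1 + r1) - v1 * (f0 + r0)) = 0 by lra.
  by move=> /eqP; rewrite mulf_eq0 pnatr_eq0 /= subr_eq0 => /eqP.
have k2 : u0 * r1 - u1 * r0 = u0 * f1 - u1 * f0 by lra.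
split; apply: (mulIf d0); rewrite -[RHS]mulrA [_ * d^-1 * _ * d]mulrAC mulfVK//.
  transitivity (u0 * (v1 * (f0 + r0)) - u1 * v0 * (f0 + r0)); first by rewrite /d; ring.
  rewrite -k1; transitivity (v0 * (u0 * f1 - u1 * f0 + (u0 * r1 - u1 * r0))); first by ring.
  by rewrite k2; ring.
transitivity (u0 * v1 * (f1 + r1) - u1 * (v0 * (f1 + r1))); first by rewrite /d; ring.
rewrite k1; transitivity (v1 * (u0 * f1 - u1 * f0 + (u0 * r1 - u1 * r0))); first by ring.
by rewrite k2; ring.
Qed.

(** In terms of u and v the mixed structure equations say that psi + rho is
    proportional to dv and psi - rho to du; comparing with psi, the factor of dv
    is 2 kappa. *)
Lemma psi_rho x i : V x -> om i n1 n2 x + om i e1 e2 x = 2 * (kappa x * pd i v x).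
Proof.
move=> Vx; have [m1 m2] := mixed_structure Vx.
have [h0 h1] := sum_algebra (uv_jacobian Vx) (ua 0 Vx) (ua 1 Vx) (ub 0 Vx) (ub 1 Vx) m1 m2.
by move: i; apply: forall_I2; [exact: h0|exact: h1].
Qed.

Let closed_algebra (k0 k1 k v0 v1 w01 w10 P0 P1 R0 R1 : R) : P0 = P1 -> R0 = R1 ->
  P0 + R0 = 2 * (k0 * v1 + k * w01) -> P1 + R1 = 2 * (k1 * v0 + k * w10) -> w01 = w10 ->
  v0 * k1 = v1 * k0.
Proof.
move=> -> -> -> + w; rewrite w => h; have : k1 * v0 + k * w10 = k0 * v1 + k * w10.
  by apply: (@mulfI _ (2 : R)); [rewrite pnatr_eq0|rewrite h].
by move/addIr; rewrite mulrC => ->; rewrite mulrC.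
Qed.

Let prop_algebra (u0 u1 v0 v1 k0 k1 : R) : let d := u0 * v1 - u1 * v0 in d != 0 ->
  v0 * k1 = v1 * k0 -> k0 = (u0 * k1 - u1 * k0) * d^-1 * v0 /\ k1 = (u0 * k1 - u1 * k0) * d^-1 * v1.
Proof.
move=> d d0 h; have [h0 h1] := cramer k0 k1 d0.
have z : v1 * k0 - v0 * k1 = 0 by rewrite h subrr.
by split; [rewrite {1}h0|rewrite {1}h1]; rewrite -/d z !mul0r add0r.
Qed.

(** The form 2 kappa dv = psi + rho is closed, so d kappa is proportional to dv. *)
Lemma kappa_v x : V x -> exists mu, forall i, pd i kappa x = mu * pd i v x.
Proof.
move=> Vx; have [[se1 se2 sn1 sn2 fr] sa sb h12 h21 da db jac] := df.
have E i j : pd j (om i n1 n2) x + pd j (om i e1 e2) x =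
    2 * (pd j kappa x * pd i v x + kappa x * pd j (pd i v) x).
  have dk := smooth_on_diff smooth_kappa Vx; have dv := smooth_on_diff (smooth_on_pd i sv) Vx.
  have d1 := smooth_on_diff (smooth_om i oV sn1 sn2) Vx.
  have d2 := smooth_on_diff (smooth_om i oV se1 se2) Vx.
  apply: (etrans (esym (pdD j d1 d2))).
  have e y : V y -> om i n1 n2 y + om i e1 e2 y = 2 * (kappa y * pd i v y) + 0.
    by move=> Vy; rewrite addr0; exact: psi_rho.
  apply: (etrans (pd_open_eq j oV Vx e (differentiableD d1 d2))).
  apply: (etrans (pd_affine 2 0 j (smooth_onM oV smooth_kappa (smooth_on_pd i sv)) Vx)).
  by congr (_ * _); exact: pdM.
have h := closed_algebra (psi_closed Vx) (rho_closed Vx) (E 1 0) (E 0 1) (pd_comm_real 0 1 oV Vx sv).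
have [h0 h1] := prop_algebra (uv_jacobian Vx) h.
by eexists; apply: forall_I2; [exact: h0|exact: h1].
Qed.

End Structure.

(** * Parallel normal fields in a diagonal frame *)

Section Angle.
Context {R : realType}.
Local Notation V2 := 'rV[R]_2.
Local Notation V4 := 'rV[R]_4.
Let sq_algebra (C S Ch : R) : C * C + S * S = 1 -> C * C + Ch * Ch = 1 ->
    (C * C - S * S) * (C * C - S * S) + 2 * (C * Ch) * (2 * (C * Ch)) = 1.
Proof.
move=> e1' e2'; transitivity ((C * C - S * S) * (C * C - S * S) + 4 * (C * C) * (Ch * Ch)); first by ring.
have -> : Ch * Ch = S * S by lra.
by transitivity ((C * C + S * S) * (C * C + S * S)); [ring|rewrite e1' mulr1].
Qed.

Let orient_algebra (z C S Ch Sh C' S' Ch' Sh' w : R) :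
   z = C' * Sh + C * Sh' - (S' * Ch + S * Ch') -> C' = S * w -> S' = - (C * w) ->
   Ch' = Sh * w -> Sh' = - (Ch * w) -> z = 0.
Proof.
by move=> -> -> -> -> ->; ring.
Qed.

Let cosw_algebra (z C S Ch Sh C' S' w : R) :
   z = C' * C + C * C' - (S' * S + S * S') -> C' = S * w -> S' = - (C * w) ->
   C * C + S * S = 1 -> C * C + Ch * Ch = 1 -> C * S + Ch * Sh = 0 ->
   z = - (2 * ((C * Sh - S * Ch) * w) * (2 * (C * Ch))).
Proof.
move=> -> -> -> g1 g2 g3; transitivity (4 * (C * w) * S); first by ring.
have k : (C * Sh - S * Ch) * Ch = - S.
  transitivity (C * (Ch * Sh) - S * (Ch * Ch)); first by ring.
  have -> : Ch * Sh = - (C * S) by lra.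
  have -> : Ch * Ch = S * S by lra.
  by transitivity (- (S * (C * C + S * S))); [ring|rewrite g1 mulr1].
transitivity (- (4 * (C * w) * ((C * Sh - S * Ch) * Ch))); last by ring.
by rewrite k mulrN opprK.
Qed.

Let sinw_algebra (z z' z'' C S Ch Sh C' Ch' w : R) : z = z' -> z' = 2 * z'' -> z'' = C' * Ch + C * Ch' ->
   C' = S * w -> Ch' = Sh * w -> C * C + S * S = 1 -> Ch * Ch + Sh * Sh = 1 -> C * Ch + S * Sh = 0 ->
   S * S + Sh * Sh = 1 -> C * S + Ch * Sh = 0 ->
   z = 2 * ((C * Sh - S * Ch) * w) * (C * C - S * S).
Proof.
move=> -> -> -> -> -> g1 g2 g3 g4 g5.
have kC : (C * Sh - S * Ch) * C = Sh.
  transitivity (C * C * Sh - S * (C * Ch)); first by ring.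
  have -> : C * Ch = - (S * Sh) by lra.
  by transitivity ((C * C + S * S) * Sh); [ring|rewrite g1 mul1r].
have kS : (C * Sh - S * Ch) * S = - Ch.
  transitivity (C * S * Sh - S * S * Ch); first by ring.
  have -> : C * S = - (Ch * Sh) by lra.
  by transitivity (- ((S * S + Sh * Sh) * Ch)); [ring|rewrite g4 mul1r].
transitivity (2 * w * ((C * Sh - S * Ch) * C * C - (C * Sh - S * Ch) * S * S)); last by ring.
by rewrite kC kS; ring.
Qed.

Variables (V : set V2) (e1 e2 n1 n2 : V2 -> V4) (a b u v : V2 -> R) (N Nh : V2 -> V4).
Hypothesis oV : open V.
Hypothesis df : diag_frame V e1 e2 n1 n2 a b.
Hypotheses (su : smooth_on V u) (sv : smooth_on V v).
Hypothesis ua : forall x i, V x -> pd i a x = pd i u x + pd i v x.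
Hypothesis ub : forall x i, V x -> pd i b x = pd i u x - pd i v x.
Hypotheses (sN : smooth_on V N) (sNh : smooth_on V Nh).
Hypothesis oN : forall x, V x -> oframe (e1 x) (e2 x) (N x) (Nh x).
Hypothesis dN : forall x i, V x -> om i N n1 x = 0 /\ om i N n2 x = 0.

Let fr x (Vx : V x) : oframe (e1 x) (e2 x) (n1 x) (n2 x).
Proof. by have [[_ _ _ _ H] _ _ _ _ _ _ _] := df; exact: H. Qed.

Lemma dotp_expand_normal (M : V2 -> V4) (w : V4) x : V x ->
  dotp (M x) (e1 x) = 0 -> dotp (M x) (e2 x) = 0 ->
  dotp w (M x) = dotp (M x) (n1 x) * dotp w (n1 x) + dotp (M x) (n2 x) * dotp w (n2 x).
Proof.
move=> Vx M1 M2; apply: (etrans (oframe_dotp w (M x) (fr Vx))).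
rewrite M1 M2; move: (dotp w (e1 x)) (dotp w (e2 x)) (dotp w (n1 x)) (dotp w (n2 x)) => p q r s.
by rewrite !mulr0 !add0r mulrC [s * _]mulrC.
Qed.

Lemma om_normal_field (M : V2 -> V4) x i : smooth_on V M ->
  (forall y, V y -> dotp (M y) (e1 y) = 0 /\ dotp (M y) (e2 y) = 0) -> V x ->
  om i M e1 x = - (dotp (M x) (n1 x) * pd i a x) /\ om i M e2 x = - (dotp (M x) (n2 x) * pd i b x).
Proof.
move=> sM Mt Vx; have [[se1 se2 sn1 sn2 _] sa sb h12 h21 da db jac] := df.
have [M1 M2] := Mt _ Vx.
have alg1 (z y p q r s t : R) : z = - y -> y = p * r + q * s -> r = t -> s = 0 -> z = - (p * t).
  by move=> -> -> -> ->; rewrite mulr0 addr0.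
have alg2 (z y p q r s t : R) : z = - y -> y = p * r + q * s -> r = 0 -> s = t -> z = - (q * t).
  by move=> -> -> -> ->; rewrite mulr0 add0r.
split.
  apply: (alg1 _ _ _ _ _ _ _ _ (dotp_expand_normal (pd i e1 x) Vx M1 M2) (da x i Vx) (h12 x i Vx)).
  by apply: (om_skew (k := 0) i oV sM se1 _ Vx) => y /Mt [].
apply: (alg2 _ _ _ _ _ _ _ _ (dotp_expand_normal (pd i e2 x) Vx M1 M2) (h21 x i Vx) (db x i Vx)).
by apply: (om_skew (k := 0) i oV sM se2 _ Vx) => y /Mt [].
Qed.

Let Nt x (Vx : V x) : dotp (N x) (e1 x) = 0 /\ dotp (N x) (e2 x) = 0.
Proof. by have [*] := oN Vx; split; rewrite dotpC. Qed.
Let Nht x (Vx : V x) : dotp (Nh x) (e1 x) = 0 /\ dotp (Nh x) (e2 x) = 0.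
Proof. by have [*] := oN Vx; split; rewrite dotpC. Qed.

Lemma om_N_Nh x i : V x -> om i N Nh x = 0 /\ om i Nh N x = 0.
Proof.
move=> Vx; have [M1 M2] := Nht Vx; have [z1 z2] := dN i Vx.
have h : om i N Nh x = 0.
  have alg (z p q r s : R) : z = p * r + q * s -> r = 0 -> s = 0 -> z = 0.
    by move=> -> -> ->; rewrite !mulr0 addr0.
  exact: alg (dotp_expand_normal (pd i N x) Vx M1 M2) z1 z2.
split=> //; have := om_skew (k := 0) i oV sNh sN _ Vx; rewrite h oppr0; apply.
by move=> y /oN [*]; rewrite dotpC.
Qed.

(** The complement of a parallel unit normal field is parallel: its derivative
    is orthogonal to N, because <dN,Nh> = 0, and to Nh, because Nh has unit
    length. *)
Lemma complement_tangential x i : V x -> om i Nh n1 x = 0 /\ om i Nh n2 x = 0.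
Proof.
move=> Vx; have [_ h] := om_N_Nh i Vx; have o := oN Vx.
have hs : om i Nh Nh x = 0 by apply: (om_self (k := 1) i oV sNh _ Vx) => y /oN [].
have alg (z p q r s a' b' c' d' : R) : z = p * a' + q * b' + r * c' + s * d' ->
    p = 0 -> q = 0 -> c' = 0 -> d' = 0 -> z = 0.
  by move=> -> -> -> -> ->; rewrite !mul0r !mulr0 !addr0.
have key (n : V2 -> V4) : dotp (n x) (e1 x) = 0 -> dotp (n x) (e2 x) = 0 -> om i Nh n x = 0.
  move=> z1 z2; have E := oframe_dotp (n x) (pd i Nh x) o.
  exact: (etrans (dotpC _ _) (alg _ _ _ _ _ _ _ _ _ E z1 z2 h hs)).
have [q11 q12 q13 q14 q22 q23 q24 q33 q34 q44] := fr Vx.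
by split; apply: key; rewrite dotpC.
Qed.

Let c x := dotp (N x) (n1 x).
Let s x := dotp (N x) (n2 x).
Let ch x := dotp (Nh x) (n1 x).
Let sh x := dotp (Nh x) (n2 x).

(** The matrix of (N, Nh) in the frame (n1, n2) is orthogonal; both its rows and
    its columns are used. *)
Lemma normal_matrix x : V x ->
  [/\ c x * c x + s x * s x = 1, ch x * ch x + sh x * sh x = 1, c x * ch x + s x * sh x = 0 &
   [/\ c x * c x + ch x * ch x = 1, s x * s x + sh x * sh x = 1 & c x * s x + ch x * sh x = 0]].
Proof.
move=> Vx; have o := fr Vx; have o' := oN Vx; have [M1 M2] := Nt Vx; have [L1 L2] := Nht Vx.
have alg (z p q r t p' q' r' t' k : R) : z = p * p' + q * q' + r * r' + t * t' -> p = 0 -> q = 0 ->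
   z = k -> r * r' + t * t' = k.
  by move=> zE p0 q0 zk; rewrite -zk zE p0 q0 !mul0r !add0r.
have [q11 q12 q13 q14 q22 q23 q24 q33 q34 q44] := o.
have [w11 w12 w13 w14 w22 w23 w24 w33 w34 w44] := o'.
have C (w z : V4) : dotp w z = 0 -> dotp z w = 0 by rewrite dotpC.
split; [exact: alg (oframe_dotp _ _ o) M1 M2 w33|exact: alg (oframe_dotp _ _ o) L1 L2 w44
  |exact: alg (oframe_dotp _ _ o) M1 M2 w34|].
rewrite /c /s /ch /sh !(dotpC (N x)) !(dotpC (Nh x)).
split; [exact: alg (oframe_dotp _ _ o') (C _ _ q13) (C _ _ q23) q33
  |exact: alg (oframe_dotp _ _ o') (C _ _ q14) (C _ _ q24) q44
  |exact: alg (oframe_dotp _ _ o') (C _ _ q13) (C _ _ q23) q34].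
Qed.

Definition cosw x := c x * c x - s x * s x.
Definition sinw x := 2 * (c x * ch x).

Let forms_algebra (ai aj bi bj ui uj vi vj C S Ch Sh z : R) :
  ai = ui + vi -> aj = uj + vj -> bi = ui - vi -> bj = uj - vj ->
  z = - (C * ai) * - (Ch * aj) + - (S * bi) * - (Sh * bj) + 0 * 0 + 0 * 0 ->
  z = (C * Ch + S * Sh) * (ui * uj + vi * vj) + (C * Ch - S * Sh) * (ui * vj + vi * uj).
Proof. by move=> -> -> -> -> ->; ring. Qed.

Let pd_forms_gen (M L : V2 -> V4) x i j : smooth_on V M -> smooth_on V L -> V x ->
  (forall y, V y -> dotp (M y) (e1 y) = 0 /\ dotp (M y) (e2 y) = 0) ->
  (forall y, V y -> dotp (L y) (e1 y) = 0 /\ dotp (L y) (e2 y) = 0) ->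
  (forall y i, V y -> om i M n1 y = 0 /\ om i M n2 y = 0) ->
  (forall y i, V y -> om i L n1 y = 0 /\ om i L n2 y = 0) ->
  dotp (pd i M x) (pd j L x) =
    (dotp (M x) (n1 x) * dotp (L x) (n1 x) + dotp (M x) (n2 x) * dotp (L x) (n2 x)) *
      (pd i u x * pd j u x + pd i v x * pd j v x) +
    (dotp (M x) (n1 x) * dotp (L x) (n1 x) - dotp (M x) (n2 x) * dotp (L x) (n2 x)) *
      (pd i u x * pd j v x + pd i v x * pd j u x).
Proof.
move=> sM sL Vx tM tL dM dL; have [m1 m2] := dM x i Vx; have [l1 l2] := dL x j Vx.
have [m3 m4] := om_normal_field i sM tM Vx; have [l3 l4] := om_normal_field j sL tL Vx.
have E := om_dotp df M L i j Vx; rewrite m1 m2 m3 m4 l1 l2 l3 l4 in E.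
exact: forms_algebra (ua i Vx) (ua j Vx) (ub i Vx) (ub j Vx) E.
Qed.

(** With a = u + v and b = u - v, the products c^2 da^2 + s^2 db^2, c ch da^2 +
    s sh db^2 and ch^2 da^2 + sh^2 db^2 become the three quadratic forms, by
    orthogonality of the matrix of coefficients. *)
Lemma pd_forms x i j : V x ->
  [/\ dotp (pd i N x) (pd j N x) = pd i u x * pd j u x
        + cosw x * (pd i u x * pd j v x + pd i v x * pd j u x) + pd i v x * pd j v x,
      dotp (pd i N x) (pd j Nh x) = sinw x * (pd i u x * pd j v x + pd i v x * pd j u x) &
      dotp (pd i Nh x) (pd j Nh x) = pd i u x * pd j u x
        - cosw x * (pd i u x * pd j v x + pd i v x * pd j u x) + pd i v x * pd j v x].
Proof.
move=> Vx; have [h1 h2 h3 [h4 h5 h6]] := normal_matrix Vx.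
have alg1 (z p q y y' k : R) : z = (p + q) * (y + y') + (p - q) * k -> p + q = 1 ->
    z = y + (p - q) * k + y' by move=> -> ->; rewrite mul1r addrAC.
have alg2 (z p q y y' k : R) : z = (p + q) * (y + y') + (p - q) * k -> p + q = 0 ->
    z = 2 * p * k.
  move=> -> e; have -> : q = - p by lra.
  ring.
have alg3 (z p q y y' k p' q' : R) : z = (p + q) * (y + y') + (p - q) * k -> p + q = 1 ->
    p' + p = 1 -> q' + q = 1 -> z = y - (p' - q') * k + y'.
  move=> -> pq p1 q1; have -> : p' = 1 - p by lra.
  have -> : q' = 1 - q by lra.
  by rewrite pq; ring.
split.
- exact: (alg1 _ _ _ _ _ _ (pd_forms_gen i j sN sN Vx Nt Nt dN dN) h1).
- exact: (alg2 _ _ _ _ _ _ (pd_forms_gen i j sN sNh Vx Nt Nht dN complement_tangential) h3).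
- exact: (alg3 _ _ _ _ _ _ _ _ (pd_forms_gen i j sNh sNh Vx Nht Nht complement_tangential complement_tangential) h2 h4 h5).
Qed.

Lemma cosw_sinw x : V x -> cosw x * cosw x + sinw x * sinw x = 1.
Proof.
move=> Vx; have [h1 h2 h3 [h4 h5 h6]] := normal_matrix Vx.
exact: sq_algebra h1 h4.
Qed.

(** The determinant of an orthogonal matrix, equal to 1 or -1 according to the
    orientation of (N, Nh). *)
Definition orient x := c x * sh x - s x * ch x.
(** The differential of the angle, since the frame (N, Nh) is parallel and (n1,
    n2) rotates with speed psi = <dn1,n2>; the factor 2 comes from cos w = c^2 -
    s^2. *)
Definition dangle i x := 2 * (orient x * om i n1 n2 x).

Lemma pd_coef (M : V2 -> V4) x i : smooth_on V M -> V x ->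
  (forall y, V y -> dotp (M y) (e1 y) = 0 /\ dotp (M y) (e2 y) = 0) ->
  om i M n1 x = 0 -> om i M n2 x = 0 ->
  pd i (fun y => dotp (M y) (n1 y)) x = dotp (M x) (n2 x) * om i n1 n2 x /\
  pd i (fun y => dotp (M y) (n2 y)) x = - (dotp (M x) (n1 x) * om i n1 n2 x).
Proof.
move=> sM Vx tM z1 z2; have [[se1 se2 sn1 sn2 _] sa sb h12 h21 da db jac] := df.
have [M1 M2] := tM _ Vx; have dM := smooth_on_diff sM Vx.
have [_ _ k1 k2] := om_diag oV df i Vx; have [_ k3] := om_rotation oV df i Vx.
have alg (z p q y y' r w t t' : R) : z = p + q -> p = 0 -> q = w -> w = y * t + y' * t' -> z = y * t + y' * t'.
  by move=> -> -> -> ->; rewrite add0r.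
have E1 := alg _ _ _ _ _ 0 _ _ _ (pd_dotp i dM (smooth_on_diff sn1 Vx)) z1 (dotpC _ _) (dotp_expand_normal (pd i n1 x) Vx M1 M2).
have E2 := alg _ _ _ _ _ 0 _ _ _ (pd_dotp i dM (smooth_on_diff sn2 Vx)) z2 (dotpC _ _) (dotp_expand_normal (pd i n2 x) Vx M1 M2).
have fin1 (z y y' t t' : R) : z = y * t + y' * t' -> t = 0 -> z = y' * t'.
  by move=> -> ->; rewrite mulr0 add0r.
have fin2 (z y y' t t' w : R) : z = y * t + y' * t' -> t = - w -> t' = 0 -> z = - (y * w).
  by move=> -> -> ->; rewrite mulr0 addr0 mulrN.
by split; [exact: fin1 E1 k1|exact: fin2 E2 k3 k2].
Qed.

Let sc (M n : V2 -> V4) : smooth_on V M -> smooth_on V n -> smooth_on V (fun x => dotp (M x) (n x)).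
Proof. exact: smooth_on_dotp. Qed.

Let frs : [/\ smooth_on V n1, smooth_on V n2 & forall i, smooth_on V (om i n1 n2)].
Proof.
have [[_ _ s1 s2 _] _ _ _ _ _ _ _] := df; split=> // i; exact: smooth_om.
Qed.

Let scoef : [/\ smooth_on V c, smooth_on V s, smooth_on V ch & smooth_on V sh].
Proof. by have [s1 s2 _] := frs; split; exact: sc. Qed.

Lemma smooth_orient : smooth_on V orient.
Proof.
by have [s1 s2 s3 s4] := scoef; apply: (smooth_onB oV); exact: smooth_onM.
Qed.

Lemma smooth_cosw : smooth_on V cosw.
Proof.
by have [s1 s2 s3 s4] := scoef; apply: (smooth_onB oV); exact: smooth_onM.
Qed.

Lemma smooth_sinw : smooth_on V sinw.
Proof.
have [s1 s2 s3 s4] := scoef; apply: (smooth_onM oV); first exact: smooth_on_cst.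
exact: smooth_onM.
Qed.

Let pdMB (f g h k : V2 -> R) x i : smooth_on V f -> smooth_on V g -> smooth_on V h -> smooth_on V k ->
  V x -> pd i (fun y => f y * g y - h y * k y) x =
  pd i f x * g x + f x * pd i g x - (pd i h x * k x + h x * pd i k x).
Proof.
move=> sf sg sh' sk Vx; have ds (t : V2 -> R) : smooth_on V t -> differentiable t x by move=> st; exact: smooth_on_diff st Vx.
apply: (etrans (pdB i (ds _ (smooth_onM oV sf sg)) (ds _ (smooth_onM oV sh' sk)))).
by congr (_ - _); apply: pdM; exact: ds.
Qed.

Let pd_normals x i : V x -> let w := om i n1 n2 x in
  [/\ pd i c x = s x * w, pd i s x = - (c x * w), pd i ch x = sh x * w & pd i sh x = - (ch x * w)].
Proof.
move=> Vx w; have [z1 z2] := dN i Vx; have [y1 y2] := complement_tangential i Vx.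
have [E1 E2] := pd_coef sN Vx Nt z1 z2; have [E3 E4] := pd_coef sNh Vx Nht y1 y2.
by split; [exact: E1|exact: E2|exact: E3|exact: E4].
Qed.

Lemma pd_orient x i : V x -> pd i orient x = 0.
Proof.
move=> Vx; have [s1 s2 s3 s4] := scoef; have [E1 E2 E3 E4] := pd_normals i Vx.
exact: orient_algebra (pdMB i s1 s4 s2 s3 Vx) E1 E2 E3 E4.
Qed.

Lemma pd_cosw x i : V x -> pd i cosw x = - (dangle i x * sinw x).
Proof.
move=> Vx; have [s1 s2 s3 s4] := scoef; have [E1 E2 E3 E4] := pd_normals i Vx.
have [h1 h2 h3 [h4 h5 h6]] := normal_matrix Vx.
exact: cosw_algebra (pdMB i s1 s1 s2 s2 Vx) E1 E2 h1 h4 h6.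
Qed.

Lemma pd_sinw x i : V x -> pd i sinw x = dangle i x * cosw x.
Proof.
move=> Vx; have [s1 s2 s3 s4] := scoef; have [E1 E2 E3 E4] := pd_normals i Vx.
have [h1 h2 h3 [h4 h5 h6]] := normal_matrix Vx.
have E := pd_affine 2 0 i (smooth_onM oV s1 s3) Vx.
have d1 := smooth_on_diff s1 Vx; have d3 := smooth_on_diff s3 Vx.
have E' := pdM i d1 d3.
have E0 : pd i sinw x = pd i (fun y => 2 * (c y * ch y) + 0) x.
  by congr (pd i _ x); apply/funext => y; rewrite addr0.
exact: sinw_algebra E0 E E' E1 E3 h1 h2 h3 h5 h6.
Qed.

Lemma smooth_dangle i : smooth_on V (dangle i).
Proof.
have [_ _ so] := frs; apply: (smooth_onM oV); first exact: smooth_on_cst.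
by apply: (smooth_onM oV); [exact: smooth_orient|exact: so].
Qed.

Lemma pd_orientM (g : V2 -> R) x i : smooth_on V g -> V x ->
  pd i (fun y => 2 * (orient y * g y)) x = 2 * (orient x * pd i g x).
Proof.
move=> sg Vx; have E := pd_affine 2 0 i (smooth_onM oV smooth_orient sg) Vx.
have E' := pdM i (smooth_on_diff smooth_orient Vx) (smooth_on_diff sg Vx).
have E0 : pd i (fun y => 2 * (orient y * g y)) x = pd i (fun y => 2 * (orient y * g y) + 0) x.
  by congr (pd i _ x); apply/funext => y; rewrite addr0.
have alg (z z' z'' C C' d d' : R) : z = z' -> z' = 2 * z'' -> z'' = C' * d + C * d' -> C' = 0 ->
   z = 2 * (C * d') by move=> -> -> -> ->; rewrite mul0r add0r.
exact: alg E0 E E' (pd_orient i Vx).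
Qed.

Lemma dangle_closed x : V x -> pd 0 (dangle 1) x = pd 1 (dangle 0) x.
Proof.
move=> Vx; have [_ _ so] := frs.
apply: (etrans (pd_orientM 0 (so 1) Vx)); apply: etrans (esym (pd_orientM 1 (so 0) Vx)).
exact: (congr1 (fun z => 2 * (orient x * z)) (psi_closed oV df Vx)).
Qed.

(** The coefficient of dv in the differential of the angle. *)
Definition vpart x := 2 * (orient x * kappa n1 n2 u v x).

Lemma smooth_vpart : smooth_on V vpart.
Proof.
apply: (smooth_onM oV); first exact: smooth_on_cst.
by apply: (smooth_onM oV); [exact: smooth_orient|exact: smooth_kappa oV df su sv ua ub].
Qed.

Lemma dangle_uv x : V x -> exists l, forall i, dangle i x = l * pd i u x + vpart x * pd i v x.
Proof.
move=> Vx; have alg (o f l k y z : R) : f = l * y + k * z -> 2 * (o * f) = 2 * (o * l) * y + 2 * (o * k) * z.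
  by move=> ->; ring.
by eexists=> i; apply: alg; exact: psi_uv df ua ub x i Vx.
Qed.

Lemma vpart_v x : V x -> exists mu, forall i, pd i vpart x = mu * pd i v x.
Proof.
move=> Vx; have [mu H] := kappa_v oV df su sv ua ub Vx.
exists (2 * (orient x * mu)) => i.
apply: (etrans (pd_orientM i (smooth_kappa oV df su sv ua ub) Vx)).
by rewrite (H i) !mulrA.
Qed.

End Angle.

(** * Lifting a unit vector to an angle *)

Section AngleFunction.
Context {R : realType}.
Local Notation V2 := 'rV[R]_2.

Lemma pd_real (g : R -> R) (g' : R) (h : V2 -> R) x i : is_derive (h x) 1 g g' ->
  differentiable h x -> differentiable (g \o h) x /\ pd i (g \o h) x = pd i h x * g'.
Proof.
move=> dg dh.
have dG : differentiable g (h x) by apply/derivable1_diffP; exact: ex_derive.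
split; first exact: differentiable_comp.
transitivity ('d g (h x) (pd i h x)).
  exact: (congr1 (fun F : V2 -> R => F (basis_vec i)) (diff_comp dh dG)).
have dG' : derivable g (h x) 1 by apply/derivable1_diffP.
by rewrite (deriv1E dG') derive1E derive_val.
Qed.

Lemma polar_coordinates (x y : R) : x * x + y * y = 1 -> exists t, cos t = x /\ sin t = y.
Proof.
move=> xy; have x1 : -1 <= x <= 1.
  have : x ^+ 2 <= 1 by rewrite expr2; have := sqr_ge0 y; rewrite expr2; clear -xy; lra.
  by rewrite expr2 => xx; clear -xx; apply/andP; split; nra.
have ca : cos (acos x) = x by apply: acosK; rewrite in_itv.
have sa : sin (acos x) = Num.sqrt (y ^+ 2).
  by rewrite sin_acos//; congr Num.sqrt; rewrite !expr2; clear -xy; lra.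
rewrite sqrtr_sqr in sa.
case: (lerP 0 y) => y0.
  by exists (acos x); rewrite ca sa ger0_norm.
by exists (- acos x); rewrite cosN sinN ca sa ltr0_norm// opprK.
Qed.

Lemma unit_vectors_eq (p q x y : R) : p * p + q * q = 1 -> x * x + y * y = 1 ->
  p * x + q * y = 1 -> p = x /\ q = y.
Proof.
move=> h1 h2 h3; have z : (p - x) ^+ 2 + (q - y) ^+ 2 = 0 by rewrite !expr2; lra.
have := z => /eqP; rewrite paddr_eq0 ?sqr_ge0// !sqrf_eq0 !subr_eq0.
by move=> /andP[/eqP -> /eqP ->].
Qed.

Lemma cos_sin_sqr (t : R) : cos t * cos t + sin t * sin t = 1.
Proof. by rewrite -!expr2 cos2Dsin2. Qed.

Variables (V : set V2) (C Sn : V2 -> R) (al : 'I_2 -> V2 -> R).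
Hypothesis oV : open V.
Hypotheses (sC : smooth_on V C) (sS : smooth_on V Sn).
Hypothesis CS : forall x, V x -> C x * C x + Sn x * Sn x = 1.
Hypothesis dC : forall x i, V x -> pd i C x = - (al i x * Sn x).
Hypothesis dS : forall x i, V x -> pd i Sn x = al i x * C x.

Definition angle_on (U : set V2) (w : V2 -> R) :=
  smooth_on U w /\ forall x, U x -> cos (w x) = C x /\ sin (w x) = Sn x.

Let angle_algebra (w' f co si c' s' : R) : co * co + si * si = 1 ->
  w' * - si = c' -> w' * co = s' -> c' = - (f * si) -> s' = f * co -> w' = f.
Proof.
move=> cs h1 h2 e1 e2; transitivity (w' * co * co - w' * - si * si).
  by rewrite -[LHS]mulr1 -cs; ring.
by rewrite h1 h2 e1 e2 -[RHS]mulr1 -cs; ring.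
Qed.

Lemma angle_pd (U : set V2) w x i : open U -> U `<=` V -> angle_on U w -> U x -> pd i w x = al i x.
Proof.
move=> oU UV [sw H] Ux; have Vx := UV _ Ux; have dw := smooth_on_diff sw Ux.
have [cx sx] := H _ Ux.
have [dc Ec] := pd_real i (is_derive_cos (w x)) dw.
have [ds Es] := pd_real i (is_derive_sin (w x)) dw.
have F1 : pd i (cos \o w) x = pd i C x by apply: (pd_open_eq i oU Ux _ dc) => y /H [].
have F2 : pd i (sin \o w) x = pd i Sn x by apply: (pd_open_eq i oU Ux _ ds) => y /H [].
have k1 := dC i Vx; have k2 := dS i Vx; rewrite -cx in k2; rewrite -sx in k1.
exact: angle_algebra (cos_sin_sqr (w x)) (etrans (esym Ec) F1) (etrans (esym Es) F2) k1 k2.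
Qed.

(** The difference of two determinations is constant, having zero differential;
    it is an integral multiple of a full turn, expressed by its cosine and sine. *)
Lemma angle_shift (U : set V2) w w' x0 : open U -> convex_set U -> U x0 -> U `<=` V ->
  angle_on U w -> angle_on U w' ->
  exists k, [/\ cos k = 1, sin k = 0 & forall x, U x -> w' x = w x + k].
Proof.
move=> oU cU Ux0 UV aw aw'; have [sw H] := aw; have [sw' H'] := aw'.
have E : forall x y, U x -> U y -> w' x - w x = w' y - w y.
  apply: (@pd0_cst _ U (fun x => w' x - w x) cU) => [x Ux|x i Ux].
    by apply: (smooth_on_diff _ Ux); exact: smooth_onB.
  apply: (etrans (pdB i (smooth_on_diff sw' Ux) (smooth_on_diff sw Ux))).
  by rewrite (angle_pd i oU UV aw' Ux) (angle_pd i oU UV aw Ux) subrr.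
have [c1 s1] := H _ Ux0; have [c2 s2] := H' _ Ux0.
exists (w' x0 - w x0); split.
- by rewrite cosB c1 c2 s1 s2; exact: CS (UV _ Ux0).
- by rewrite sinB c1 c2 s1 s2 mulrC subrr.
- by move=> x Ux; rewrite -(E x x0 Ux Ux0) addrC subrK.
Qed.

Hypothesis sal : forall i, smooth_on V (al i).
Hypothesis cal : forall x, V x -> pd 0 (al 1) x = pd 1 (al 0) x.

Let lift_algebra (z P Q f si co c s p q c' s' : R) : z = P + Q -> P = p * c + co * c' -> Q = q * s + si * s' ->
  p = f * - si -> q = f * co -> c' = - (f * s) -> s' = f * c -> z = 0.
Proof. by move=> -> -> -> -> -> -> ->; ring. Qed.

(** Integrate the form al, with the right initial value at x0. The scalar
    product of (cos w, sin w) with (C, Sn) has zero differential and equals 1 at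
    x0, so the two unit vectors coincide. *)
Lemma angle_exists x0 : V x0 -> exists r w, [/\ 0 < r, ball x0 r `<=` V & angle_on (ball x0 r) w].
Proof.
move=> Vx0; have [r [w0 [r0 bV sw0 dw0]]] := poincare oV Vx0 sal cal.
have [t [ct st]] := polar_coordinates (CS Vx0).
have ob : open (ball x0 r) by exact: ball_open.
pose w x := 1 * w0 x + (t - w0 x0).
have sw : smooth_on (ball x0 r) w by exact: smooth_affine.
have dw x i : ball x0 r x -> pd i w x = al i x.
  by move=> bx; apply: (etrans (pd_affine _ _ i sw0 bx)); rewrite mul1r; exact: dw0.
have sCb := smooth_on_sub bV sC; have sSb := smooth_on_sub bV sS.
pose h x := (cos \o w) x * C x + (sin \o w) x * Sn x.
have dh x i : ball x0 r x -> differentiable h x /\ pd i h x = 0.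
  move=> bx; have Vx := bV _ bx; have dwx := smooth_on_diff sw bx.
  have [dc Ec] := pd_real i (is_derive_cos (w x)) dwx.
  have [ds Es] := pd_real i (is_derive_sin (w x)) dwx.
  rewrite (dw x i bx) in Ec; rewrite (dw x i bx) in Es.
  have dCx := smooth_on_diff sC Vx; have dSx := smooth_on_diff sS Vx.
  have d1 := differentiableM dc dCx; have d2 := differentiableM ds dSx.
  split; first exact: differentiableD.
  exact: lift_algebra (pdD i d1 d2) (pdM i dc dCx) (pdM i ds dSx) Ec Es (dC i Vx) (dS i Vx).
have w00 : w x0 = t by rewrite /w mul1r addrC subrK.
have h1 x : ball x0 r x -> h x = 1.
  move=> bx; have -> : h x = h x0.
    apply: (@pd0_cst _ (ball x0 r) h (@ball_convex _ _ _)) => // [y y_|y i y_|].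
    - by have [] := dh y 0 y_.
    - by have [] := dh y i y_.
    - exact: ballxx.
  by rewrite /h /= w00 ct st; exact: CS.
exists r, w; split=> //; split=> // x bx.
exact: unit_vectors_eq (cos_sin_sqr _) (CS (bV _ bx)) (h1 _ bx).
Qed.

End AngleFunction.

(** * The canonical immersion *)

Section Coordinates.
Context {R : realType} {S : surface R}.
Local Notation V2 := 'rV[R]_2.
Local Notation V4 := 'rV[R]_4.
Implicit Types (c : chart R S) (p q : S) (U V : set V2).

Lemma pd_pair (h k : V2 -> R) x i : differentiable h x -> differentiable k x ->
  pd i (fun y => (h y, k y)) x = (pd i h x, pd i k x).
Proof.
move=> dh dk.
exact: (congr1 (fun F : V2 -> R * R => F (basis_vec i)) (diff_pair dh dk)).
Qed.

Lemma smooth_on_pair V (h k : V2 -> R) : open V -> smooth_on V h -> smooth_on V k ->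
  smooth_on V (fun x => (h x, k x)).
Proof.
move=> oV sh sk n; move: (sh n) (sk n); elim: n h k {sh sk} => [|n IH] h k.
  by move=> ch ck x Vx; exact: (cvg_pair (ch x Vx) (ck x Vx)).
move=> [dh ph] [dk pk]; split=> [x Vx|i].
  by apply: differentiable_pair; [exact: dh|exact: dk].
apply: Ck_eq oV _ (IH _ _ (ph i) (pk i)) => x Vx.
by apply: esym; apply: pd_pair; [exact: dh|exact: dk].
Qed.

Lemma tdiff_real (F : S -> R) c p X :
  tdiff c F p X = X 0 0 * pd 0 (F \o cinv c) (cmap c p) + X 0 1 * pd 1 (F \o cinv c) (cmap c p).
Proof. exact: tdiffE. Qed.

Variable f : S -> V4.
Hypothesis sf : smooth f.
Variable h : S -> R * R.
Hypothesis hs : forall p, frame_sol f p h.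

(** The inverse of the substitution a = u + v, b = u - v, where (a, b) = h. *)
Definition ucoord p := 2^-1 * ((h p).1 + (h p).2).
Definition vcoord p := 2^-1 * ((h p).1 - (h p).2).
Local Notation u := ucoord.
Local Notation v := vcoord.

Lemma frame_uv c V e1 e2 n1 n2 : framed f c V h e1 e2 n1 n2 ->
  [/\ smooth_on V (u \o cinv c), smooth_on V (v \o cinv c),
   forall x i, V x -> pd i (fun y => (h (cinv c y)).1) x = pd i (u \o cinv c) x + pd i (v \o cinv c) x &
   forall x i, V x -> pd i (fun y => (h (cinv c y)).2) x = pd i (u \o cinv c) x - pd i (v \o cinv c) x].
Proof.
move=> [oV Vc [_ sa sb _ _ _ _ _] _].
have sU : smooth_on V (u \o cinv c).
  apply: (smooth_onM oV); first exact: smooth_on_cst.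
  exact: smooth_onD.
have sV : smooth_on V (v \o cinv c).
  apply: (smooth_onM oV); first exact: smooth_on_cst.
  exact: smooth_onB.
split=> // x i Vx; have du := smooth_on_diff sU Vx; have dv := smooth_on_diff sV Vx.
  apply: (etrans _ (pdD i du dv)); congr (pd i _ x); apply/funext => y.
  by rewrite /= /u /v -mulrDr; move: (h (cinv c y)).1 (h (cinv c y)).2 => s t; field.
apply: (etrans _ (pdB i du dv)); congr (pd i _ x); apply/funext => y.
by rewrite /= /u /v -mulrBr; move: (h (cinv c y)).1 (h (cinv c y)).2 => s t; field.
Qed.

Lemma uv_smooth : smooth u /\ smooth v.
Proof.
split; apply: smooth_local => p; have [c ac cp] := atlas_cover p.
  have [r [e1 [e2 [n1 [n2 [r0 fr]]]]]] := frame_sol_chart sf (hs p) ac cp.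
  have [sU sV _ _] := frame_uv fr; exists c, (ball (cmap c p) r).
  by split; [exact: ac|exact: cp|exact: ball_open|exact: ballxx|exact: sU].
have [r [e1 [e2 [n1 [n2 [r0 fr]]]]]] := frame_sol_chart sf (hs p) ac cp.
have [sU sV _ _] := frame_uv fr; exists c, (ball (cmap c p) r).
by split; [exact: ac|exact: cp|exact: ball_open|exact: ballxx|exact: sV].
Qed.

Lemma uv_jac c p : atlas c -> cdom c p ->
  pd 0 (u \o cinv c) (cmap c p) * pd 1 (v \o cinv c) (cmap c p)
  - pd 1 (u \o cinv c) (cmap c p) * pd 0 (v \o cinv c) (cmap c p) != 0.
Proof.
move=> ac cp; have [r [e1 [e2 [n1 [n2 [r0 fr]]]]]] := frame_sol_chart sf (hs p) ac cp.
have [sU sV ua ub] := frame_uv fr; have [oV Vc df _] := fr.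
exact: (uv_jacobian df ua ub (ballxx _ r0)).
Qed.

Lemma uv_immersion : immersion (fun p => (u p, v p)).
Proof.
have [sU sV] := uv_smooth; split=> [c ac|c p ac cp X Y].
  exact: smooth_on_pair (cimg_open ac) (sU c ac) (sV c ac).
have J := uv_jac ac cp.
have dU := smooth_on_diff (sU c ac) (cimg_cmap cp).
have dV := smooth_on_diff (sV c ac) (cimg_cmap cp).
have E Z : tdiff c (fun p => (u p, v p)) p Z = (tdiff c u p Z, tdiff c v p Z).
  exact: (congr1 (fun F : V2 -> R * R => F Z) (diff_pair dU dV)).
move=> XY; have EX := E X; have EY := E Y; rewrite XY in EX.
have := etrans (esym EX) EY => -[].
rewrite !tdiff_real.
have alg (x0 x1 y0 y1 u0 u1 v0 v1 : R) : u0 * v1 - u1 * v0 != 0 ->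
   x0 * u0 + x1 * u1 = y0 * u0 + y1 * u1 -> x0 * v0 + x1 * v1 = y0 * v0 + y1 * v1 ->
   x0 = y0 /\ x1 = y1.
  move=> D h1 h2.
  have D' : u0 * v1 - v0 * u1 != 0 by rewrite (mulrC v0).
  have [||z1 z2] := @linear_indep_jac _ (x0 - y0) (x1 - y1) _ _ _ _ D'.
  - transitivity (x0 * u0 + x1 * u1 - (y0 * u0 + y1 * u1)); first by ring.
    by rewrite h1 subrr.
  - transitivity (x0 * v0 + x1 * v1 - (y0 * v0 + y1 * v1)); first by ring.
    by rewrite h2 subrr.
  by split; apply/eqP; rewrite -subr_eq0 ?z1 ?z2.
move=> h1 h2; have [E0 E1] := alg _ _ _ _ _ _ _ _ J h1 h2.
by rewrite [LHS]row2E [RHS]row2E E0 E1.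
Qed.

Lemma uv_coef_unique c p (l k l' k' : R) : atlas c -> cdom c p ->
  (forall i, l * pd i (u \o cinv c) (cmap c p) + k * pd i (v \o cinv c) (cmap c p) =
    l' * pd i (u \o cinv c) (cmap c p) + k' * pd i (v \o cinv c) (cmap c p)) ->
  l = l' /\ k = k'.
Proof.
move=> ac cp H.
have alg (x0 x1 y0 y1 : R) : l * x0 + k * y0 = l' * x0 + k' * y0 ->
   l * x1 + k * y1 = l' * x1 + k' * y1 -> x0 * y1 - x1 * y0 != 0 -> l = l' /\ k = k'.
  move=> h1 h2 D; have [||z1 z2] := @linear_indep_jac _ (l - l') (k - k') _ _ _ _ D.
  - transitivity (l * x0 + k * y0 - (l' * x0 + k' * y0)); first by ring.
    by rewrite h1 subrr.
  - transitivity (l * x1 + k * y1 - (l' * x1 + k' * y1)); first by ring.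
    by rewrite h2 subrr.
  by split; apply/eqP; rewrite -subr_eq0 ?z1 ?z2.
exact: alg (H 0) (H 1) (uv_jac ac cp).
Qed.

(** The differentials of F, u and v transform in the same way under a change of
    chart, by tdiff_chart. *)
Lemma tdiff_uv (F : S -> R) c p (l k : R) : atlas c -> cdom c p ->
  differentiable (F \o cinv c) (cmap c p) ->
  (forall i, pd i (F \o cinv c) (cmap c p) =
     l * pd i (u \o cinv c) (cmap c p) + k * pd i (v \o cinv c) (cmap c p)) ->
  forall c' X, atlas c' -> cdom c' p -> tdiff c' F p X = l * tdiff c' u p X + k * tdiff c' v p X.
Proof.
move=> ac cp dF H c' X ac' c'p; have [sU sV] := uv_smooth.
have [J JE] := tdiff_chart ac ac' cp c'p.
rewrite (JE R F dF X) (JE R u (smooth_on_diff (sU c ac) (cimg_cmap cp)) X).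
rewrite (JE R v (smooth_on_diff (sV c ac) (cimg_cmap cp)) X) !tdiff_real.
have alg (x0 x1 f0 f1 u0 u1 v0 v1 : R) : f0 = l * u0 + k * v0 -> f1 = l * u1 + k * v1 ->
  x0 * f0 + x1 * f1 = l * (x0 * u0 + x1 * u1) + k * (x0 * v0 + x1 * v1).
  by move=> -> ->; ring.
exact: alg (H 0) (H 1).
Qed.

(** What a special section and its complement amount to in one chart; all local
    computations start from these data. *)
Definition adapted_normals c V (N Nh : S -> V4) e1 e2 n1 n2 :=
  [/\ framed f c V h e1 e2 n1 n2, smooth_on V (N \o cinv c), smooth_on V (Nh \o cinv c),
    forall x, V x -> oframe (e1 x) (e2 x) (N (cinv c x)) (Nh (cinv c x)) &
    forall x i, V x -> om i (N \o cinv c) n1 x = 0 /\ om i (N \o cinv c) n2 x = 0].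

Lemma pd_tdiff (W : normedModType R) (F : S -> W) c x i : atlas c -> cimg c x ->
  pd i (F \o cinv c) x = tdiff c F (cinv c x) (basis_vec i).
Proof.
move=> ac cx; have [e _] := cinvK ac cx; rewrite /tdiff.
exact: (congr1 (fun z => 'd (F \o cinv c) z (basis_vec i)) (esym e)).
Qed.

Lemma normal_field_frame c V (M : S -> V4) e1 e2 n1 n2 x : atlas c ->
  framed f c V h e1 e2 n1 n2 -> unit_normal_field f M -> V x ->
  dotp (M (cinv c x)) (e1 x) = 0 /\ dotp (M (cinv c x)) (e2 x) = 0.
Proof.
move=> ac [oV Vc df tan] [_ _ nM] Vx; apply/(tan _ Vx) => i.
have [e cx] := cinvK ac (Vc _ Vx).
apply: (etrans (congr1 (dotp _) (pd_tdiff f i ac (Vc _ Vx)))).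
by apply: nM; exists c, (basis_vec i); split.
Qed.

Lemma tangent_frame_normal c V e1 e2 n1 n2 x w : atlas c -> framed f c V h e1 e2 n1 n2 -> V x ->
  tangent_plane f (cinv c x) w -> dotp w (n1 x) = 0 /\ dotp w (n2 x) = 0.
Proof.
move=> ac [oV Vc df tan] Vx tw; have [e cx] := cinvK ac (Vc _ Vx).
have [X XE] := tangent_plane_chart sf ac cx tw.
have [[_ _ _ _ fr] _ _ _ _ _ _ _] := df.
have [q11 q12 q13 q14 q22 q23 q24 q33 q34 q44] := fr _ Vx.
have H n : dotp (e1 x) n = 0 -> dotp (e2 x) n = 0 -> dotp w n = 0.
  move=> z1 z2.
  have [_ T] := tan _ Vx n; have {}T : forall i, dotp n (pd i (f \o cinv c) x) = 0.
    by apply: T; rewrite (dotpC n (e1 x)) (dotpC n (e2 x)).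
  have E := tdiffE f c (cinv c x) X.
  have Ew := etrans XE E; rewrite Ew e.
  have alg (y0 y1 : R) (d0 d1 : V4) : dotp n d0 = 0 -> dotp n d1 = 0 -> dotp (y0 *: d0 + y1 *: d1) n = 0.
    by move=> k0 k1; rewrite dotpDl !dotpZl (dotpC d0) (dotpC d1) k0 k1 !mulr0 addr0.
  exact: alg (T 0) (T 1).
by split; apply: H.
Qed.

Lemma adapted_normals_of_framed c V N Nh e1 e2 n1 n2 : atlas c -> special_section f N ->
  orthonormal_complement f N Nh -> framed f c V h e1 e2 n1 n2 -> adapted_normals c V N Nh e1 e2 n1 n2.
Proof.
move=> ac [nN tN] [nNh NNh] fr; have [oV Vc df tan] := fr.
have [sN uN _] := nN; have [sNh uNh _] := nNh.
have [[_ _ _ _ ofr] _ _ _ _ _ _ _] := df.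
split.
- exact: fr.
- exact: smooth_on_sub Vc (sN c ac).
- exact: smooth_on_sub Vc (sNh c ac).
- move=> x Vx; have [q11 q12 q13 q14 q22 q23 q24 q33 q34 q44] := ofr _ Vx.
  have [m1 m2] := normal_field_frame ac fr nN Vx; have [l1 l2] := normal_field_frame ac fr nNh Vx.
  have C (w z : V4) : dotp w z = 0 -> dotp z w = 0 by rewrite dotpC.
  exact: (OFrame q11 q12 (C _ _ m1) (C _ _ l1) q22 (C _ _ m2) (C _ _ l2) (uN _) (NNh _) (uNh _)).
- move=> x i Vx; apply: (tangent_frame_normal ac fr Vx).
  apply: tN; rewrite (pd_tdiff N i ac (Vc _ Vx)).
  by exists c, (basis_vec i); split=> //; have [] := cinvK ac (Vc _ Vx).
Qed.

End Coordinates.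

(** * The polar map and its angle *)

Section PolarMap.
Context {R : realType} {S : surface R}.
Local Notation V2 := 'rV[R]_2.
Local Notation V4 := 'rV[R]_4.
Implicit Types (c : chart R S) (p q : S) (U V : set V2).

Let bil (x0 x1 y0 y1 : R) (p0 p1 q0 q1 : V4) :
  dotp (x0 *: p0 + x1 *: p1) (y0 *: q0 + y1 *: q1) =
  x0 * y0 * dotp p0 q0 + x0 * y1 * dotp p0 q1 + x1 * y0 * dotp p1 q0 + x1 * y1 * dotp p1 q1.
Proof.
rewrite !(dotpDl, dotpDr, dotpZl, dotpZr).
by move: (dotp p0 q0) (dotp p0 q1) (dotp p1 q0) (dotp p1 q1) => a b c d; ring.
Qed.

Let lin0 (x0 x1 : R) (p0 p1 q : V4) : dotp p0 q = 0 -> dotp p1 q = 0 ->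
  dotp (x0 *: p0 + x1 *: p1) q = 0.
Proof. by move=> h0 h1; rewrite dotpDl !dotpZl h0 h1 !mulr0 addr0. Qed.

Let form1 (x0 x1 y0 y1 u0 u1 v0 v1 k d00 d01 d10 d11 z : R) :
  z = x0 * y0 * d00 + x0 * y1 * d01 + x1 * y0 * d10 + x1 * y1 * d11 ->
  d00 = u0 * u0 + k * (u0 * v0 + v0 * u0) + v0 * v0 ->
  d01 = u0 * u1 + k * (u0 * v1 + v0 * u1) + v0 * v1 ->
  d10 = u1 * u0 + k * (u1 * v0 + v1 * u0) + v1 * v0 ->
  d11 = u1 * u1 + k * (u1 * v1 + v1 * u1) + v1 * v1 ->
  z = (x0 * u0 + x1 * u1) * (y0 * u0 + y1 * u1)
    + k * ((x0 * u0 + x1 * u1) * (y0 * v0 + y1 * v1) + (x0 * v0 + x1 * v1) * (y0 * u0 + y1 * u1))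
    + (x0 * v0 + x1 * v1) * (y0 * v0 + y1 * v1).
Proof. by move=> -> -> -> -> ->; ring. Qed.

Let form2 (x0 x1 y0 y1 u0 u1 v0 v1 k d00 d01 d10 d11 z : R) :
  z = x0 * y0 * d00 + x0 * y1 * d01 + x1 * y0 * d10 + x1 * y1 * d11 ->
  d00 = k * (u0 * v0 + v0 * u0) -> d01 = k * (u0 * v1 + v0 * u1) ->
  d10 = k * (u1 * v0 + v1 * u0) -> d11 = k * (u1 * v1 + v1 * u1) ->
  z = k * ((x0 * u0 + x1 * u1) * (y0 * v0 + y1 * v1) + (x0 * v0 + x1 * v1) * (y0 * u0 + y1 * u1)).
Proof. by move=> -> -> -> -> ->; ring. Qed.

Let form3 (x0 x1 y0 y1 u0 u1 v0 v1 k d00 d01 d10 d11 z : R) :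
  z = x0 * y0 * d00 + x0 * y1 * d01 + x1 * y0 * d10 + x1 * y1 * d11 ->
  d00 = u0 * u0 - k * (u0 * v0 + v0 * u0) + v0 * v0 ->
  d01 = u0 * u1 - k * (u0 * v1 + v0 * u1) + v0 * v1 ->
  d10 = u1 * u0 - k * (u1 * v0 + v1 * u0) + v1 * v0 ->
  d11 = u1 * u1 - k * (u1 * v1 + v1 * u1) + v1 * v1 ->
  z = (x0 * u0 + x1 * u1) * (y0 * u0 + y1 * u1)
    - k * ((x0 * u0 + x1 * u1) * (y0 * v0 + y1 * v1) + (x0 * v0 + x1 * v1) * (y0 * u0 + y1 * u1))
    + (x0 * v0 + x1 * v1) * (y0 * v0 + y1 * v1).
Proof. by move=> -> -> -> -> ->; ring. Qed.

Variable f : S -> V4.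
Hypothesis sf : smooth f.
Variable h : S -> R * R.
Hypothesis hs : forall p, frame_sol f p h.
Local Notation u := (ucoord h).
Local Notation v := (vcoord h).
Variables N Nh : S -> V4.
Hypotheses (spN : special_section f N) (cpN : orthonormal_complement f N Nh).

Let sN : smooth N. Proof. by have [[]] := spN. Qed.
Let sNh : smooth Nh. Proof. by have [[]] := cpN. Qed.

(** The conditions on first-order derivatives in the definition of a flat map,
    with arbitrary functions C and Sn in place of the cosine and sine of the
    angle. *)
Definition forms c q (C Sn : R) := forall X Y : V2,
  let du := tdiff c u q in let dv := tdiff c v q in
  let dF := tdiff c N q in let dFh := tdiff c Nh q in
  [/\ dotp (dF X) (dF Y) = du X * du Y + C * (du X * dv Y + dv X * du Y) + dv X * dv Y,
      dotp (dF X) (dFh Y) = Sn * (du X * dv Y + dv X * du Y),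
      dotp (dFh X) (dFh Y) = du X * du Y - C * (du X * dv Y + dv X * du Y) + dv X * dv Y,
      dotp (dF X) (Nh q) = 0 & dotp (N q) (dFh X) = 0].

Lemma forms_adapted c V e1 e2 n1 n2 x : atlas c -> adapted_normals f h c V N Nh e1 e2 n1 n2 -> V x ->
  forms c (cinv c x) (cosw n1 n2 (N \o cinv c) x) (sinw n1 (N \o cinv c) (Nh \o cinv c) x).
Proof.
move=> ac [fr sNV sNhV oN dN] Vx X Y; have [oV Vc df _] := fr.
have [sU sV ua ub] := frame_uv fr; have [e cx] := cinvK ac (Vc _ Vx).
cbv zeta; rewrite !tdiff_real !tdiffE e.
have P i j := pd_forms oV df ua ub sNV sNhV oN dN i j Vx.
have Z i := om_N_Nh oV df sNV sNhV oN dN i Vx.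
have [a00 b00 c00] := P 0 0; have [a01 b01 c01] := P 0 1.
have [a10 b10 c10] := P 1 0; have [a11 b11 c11] := P 1 1.
have [z0 w0] := Z 0; have [z1 w1] := Z 1.
split.
- exact: form1 (bil _ _ _ _ _ _ _ _) a00 a01 a10 a11.
- exact: form2 (bil _ _ _ _ _ _ _ _) b00 b01 b10 b11.
- exact: form3 (bil _ _ _ _ _ _ _ _) c00 c01 c10 c11.
- exact: lin0 z0 z1.
- by rewrite dotpC; exact: lin0 w0 w1.
Qed.

Lemma forms_chart c c' q C Sn : atlas c -> atlas c' -> cdom c q -> cdom c' q ->
  forms c q C Sn -> forms c' q C Sn.
Proof.
move=> ac ac' cq c'q H X Y; have [J JE] := tdiff_chart ac ac' cq c'q.
have [sU sV] := uv_smooth sf hs; have Iq := cimg_cmap cq.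
have dU := JE _ _ (smooth_on_diff (sU c ac) Iq); have dV := JE _ _ (smooth_on_diff (sV c ac) Iq).
have dN := JE _ _ (smooth_on_diff (sN ac) Iq); have dNh := JE _ _ (smooth_on_diff (sNh ac) Iq).
cbv zeta; rewrite !dU !dV !dN !dNh; exact: H.
Qed.

Let row_exists (x0 x1 : R) : exists X : V2, X 0 0 = x0 /\ X 0 1 = x1.
Proof.
by exists (\row_j if j == 0 then x0 else x1); rewrite !mxE.
Qed.

(** Evaluate the first two forms on the vectors dual to du and dv. *)
Lemma forms_unique c q C Sn C' Sn' : atlas c -> cdom c q ->
  forms c q C Sn -> forms c q C' Sn' -> C = C' /\ Sn = Sn'.
Proof.
move=> ac cq H H'; have D := uv_jac sf hs ac cq.
have coord (x0 x1 : R) : exists X, tdiff c u q X = x0 /\ tdiff c v q X = x1.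
  have alg (u0 u1 v0 v1 : R) : u0 * v1 - u1 * v0 != 0 -> exists X : V2,
      X 0 0 * u0 + X 0 1 * u1 = x0 /\ X 0 0 * v0 + X 0 1 * v1 = x1.
    move=> D0; pose d := (u0 * v1 - u1 * v0)^-1.
    have dK : d * (u0 * v1 - u1 * v0) = 1 by rewrite mulVf.
    have [X [X0 X1]] := row_exists (d * (v1 * x0 - u1 * x1)) (d * (u0 * x1 - v0 * x0)).
    exists X; rewrite X0 X1; split.
      by transitivity (d * (u0 * v1 - u1 * v0) * x0); [ring|rewrite dK mul1r].
    by transitivity (d * (u0 * v1 - u1 * v0) * x1); [ring|rewrite dK mul1r].
  by have [X [X0 X1]] := alg _ _ _ _ D; exists X; rewrite !tdiff_real.
have [X [Xu Xv]] := coord 1 0; have [Y [Yu Yv]] := coord 0 1.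
have [E1 E2 _ _ _] := H X Y; have [E1' E2' _ _ _] := H' X Y.
have := etrans (esym E1) E1'; have := etrans (esym E2) E2'.
by rewrite Xu Xv Yu Yv !mul1r !mul0r !addr0 !mulr1 !add0r; split.
Qed.

Lemma forms_exist q : exists CS : R * R, forall c, atlas c -> cdom c q -> forms c q CS.1 CS.2.
Proof.
have [c ac cq] := atlas_cover q.
have [r [e1 [e2 [n1 [n2 [r0 fr]]]]]] := frame_sol_chart sf (hs q) ac cq.
have md := adapted_normals_of_framed sf ac spN cpN fr.
have F := forms_adapted ac md (ballxx _ r0); rewrite (cmapK ac cq) in F.
exists (cosw n1 n2 (N \o cinv c) (cmap c q), sinw n1 (N \o cinv c) (Nh \o cinv c) (cmap c q)).
by move=> c' ac' c'q; exact: forms_chart ac ac' cq c'q F.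
Qed.

Variables C Sn : S -> R.
Hypothesis CSf : forall c q, atlas c -> cdom c q -> forms c q (C q) (Sn q).

(** Near a point, the form al is the differential of the angle whose cosine and
    sine are C and Sn, and vp is its coefficient of dv. *)
Record angle_data c V (al : 'I_2 -> V2 -> R) (vp : V2 -> R) : Prop := AngleData {
  ad_open : open V;
  ad_sub : V `<=` cimg c;
  ad_C : smooth_on V (C \o cinv c);
  ad_S : smooth_on V (Sn \o cinv c);
  ad_one : forall x, V x -> (C \o cinv c) x * (C \o cinv c) x + (Sn \o cinv c) x * (Sn \o cinv c) x = 1;
  ad_dC : forall x i, V x -> pd i (C \o cinv c) x = - (al i x * (Sn \o cinv c) x);
  ad_dS : forall x i, V x -> pd i (Sn \o cinv c) x = al i x * (C \o cinv c) x;
  ad_al : forall i, smooth_on V (al i);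
  ad_cl : forall x, V x -> pd 0 (al 1) x = pd 1 (al 0) x;
  ad_uv : forall x, V x -> exists l, forall i,
     al i x = l * pd i (u \o cinv c) x + vp x * pd i (v \o cinv c) x;
  ad_vp : smooth_on V vp;
  ad_dvp : forall x, V x -> exists mu, forall i, pd i vp x = mu * pd i (v \o cinv c) x }.

Lemma angle_data_exists c p : atlas c -> cdom c p ->
  exists r al vp, 0 < r /\ angle_data c (ball (cmap c p) r) al vp.
Proof.
move=> ac cp; have [r [e1 [e2 [n1 [n2 [r0 fr]]]]]] := frame_sol_chart sf (hs p) ac cp.
have md := adapted_normals_of_framed sf ac spN cpN fr; have [_ sNV sNhV oN dN] := md.
have [oV Vc df _] := fr; have [sU sV ua ub] := frame_uv fr.
set V := ball (cmap c p) r in md sNV sNhV oN dN oV Vc df sU sV ua ub *.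
have CE x : V x -> cosw n1 n2 (N \o cinv c) x = (C \o cinv c) x /\
    sinw n1 (N \o cinv c) (Nh \o cinv c) x = (Sn \o cinv c) x.
  move=> Vx; have [_ cx] := cinvK ac (Vc _ Vx).
  exact: forms_unique ac cx (forms_adapted ac md Vx) (CSf ac cx).
have Ce x Vx := (CE x Vx).1; have Se x Vx := (CE x Vx).2.
have sC := smooth_cosw oV df sNV sNhV; have sS := smooth_sinw oV df sNV sNhV.
exists r, (dangle n1 n2 (N \o cinv c) (Nh \o cinv c)),
  (vpart n1 n2 (u \o cinv c) (v \o cinv c) (N \o cinv c) (Nh \o cinv c)); split=> //; split.
- exact: oV.
- exact: Vc.
- exact: smooth_on_eq oV Ce sC.
- exact: smooth_on_eq oV Se sS.
- move=> x Vx; rewrite -(Ce _ Vx) -(Se _ Vx); exact: (cosw_sinw df oN Vx).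
- move=> x i Vx; apply: (etrans (esym (pd_open_eq i oV Vx Ce (smooth_on_diff sC Vx)))).
  rewrite -(Se _ Vx); exact: (pd_cosw oV df sNV sNhV oN dN i Vx).
- move=> x i Vx; apply: (etrans (esym (pd_open_eq i oV Vx Se (smooth_on_diff sS Vx)))).
  rewrite -(Ce _ Vx); exact: (pd_sinw oV df sNV sNhV oN dN i Vx).
- exact: (smooth_dangle oV df sNV sNhV).
- move=> x Vx; exact: (dangle_closed oV df sNV sNhV oN dN Vx).
- move=> x Vx; exact: (dangle_uv (N \o cinv c) (Nh \o cinv c) df ua ub Vx).
- exact: (smooth_vpart oV df sU sV ua ub sNV sNhV).
- move=> x Vx; exact: (vpart_v oV df sU sV ua ub sNV sNhV oN dN Vx).
Qed.

Definition angle_in c V (w : S -> R) := angle_on (C \o cinv c) (Sn \o cinv c) V (w \o cinv c).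

Definition angle_sol p (w : S -> R) := exists c V,
  [/\ atlas c, cdom c p, open V, V (cmap c p) & V `<=` cimg c /\ angle_in c V w].

Lemma angle_sol_chart p w c : angle_sol p w -> atlas c -> cdom c p ->
  exists r, [/\ 0 < r, ball (cmap c p) r `<=` cimg c & angle_in c (ball (cmap c p) r) w].
Proof.
move=> [c' [V [ac' c'p oV Vp [Vc [sw Hw]]]]] ac cp.
have [V' [oV' V'p V'c st H]] := transition ac' ac c'p cp oV Vp.
have [r bV] := nbhs_ex (open_nbhs_nbhs (conj oV' V'p)).
have VV x : V' x -> V ((cmap c' \o cinv c) x) by move=> /H [].
have sw' : smooth_on V' (w \o cinv c).
  apply: (smooth_on_eq oV' _ (smooth_on_comp oV oV' VV st sw)).
  by move=> x /H [_ _ e] /=; rewrite e.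
exists r%:num; split=> //; first exact: subset_trans bV V'c.
split; first exact: smooth_on_sub bV sw'.
by move=> x /bV /H [Vx _ e]; have := Hw _ Vx; rewrite /= e.
Qed.

Lemma angle_sol_open p w : angle_sol p w -> \forall q \near p, angle_sol q w.
Proof.
move=> [c [V [ac cp oV Vp [Vc aw]]]].
have nc : \forall q \near p, cdom c q.
  by apply: open_nbhs_nbhs; split; [exact: cdom_open|].
have nV : \forall q \near p, V (cmap c q).
  by apply: (cmap_continuous ac cp); apply: open_nbhs_nbhs.
near=> q; exists c, V; split; [exact: ac|by near: q|exact: oV|by near: q|by split].
Unshelve. all: end_near. Qed.

Lemma angle_sol_germ p w w' : germ_eq p w w' -> angle_sol p w -> angle_sol p w'.
Proof.
move=> ww sw; have [c ac cp] := atlas_cover p.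
have [r [r0 rI [swr Hw]]] := angle_sol_chart sw ac cp.
have [r' [r'0 _ H]] := near_chart ac cp ww.
pose s := Num.min r r'; have s0 : 0 < s by rewrite lt_min r0.
have os : open (ball (cmap c p) s) by exact: ball_open.
have sr : ball (cmap c p) s `<=` ball (cmap c p) r by apply: le_ball; rewrite ge_min lexx.
have sr' : ball (cmap c p) s `<=` ball (cmap c p) r' by apply: le_ball; rewrite ge_min lexx orbT.
exists c, (ball (cmap c p) s); split; [exact: ac|exact: cp|exact: os|exact: ballxx|split; first exact: subset_trans rI].
split.
  by apply: (smooth_on_eq os _ (smooth_on_sub sr swr)) => x /sr' /H.
by move=> x bx; have := Hw _ (sr _ bx); have := H _ (sr' _ bx); rewrite /= => ->.
Qed.

(** The ambiguity of the angle: translations by integral multiples of 2 pi. *)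
Definition full_turn (g : R -> R) := exists k, [/\ cos k = 1, sin k = 0 & forall y, g y = y + k].

Lemma angle_sol_rigid p w w' : angle_sol p w -> angle_sol p w' ->
  exists2 g, full_turn g & germ_eq p w' (g \o w).
Proof.
move=> sw sw'; have [c ac cp] := atlas_cover p.
have [r [r0 rI [swr Hw]]] := angle_sol_chart sw ac cp.
have [r' [r'0 _ [swr' Hw']]] := angle_sol_chart sw' ac cp.
have [t [al [vp [t0 ad]]]] := angle_data_exists ac cp.
pose s := Num.min t (Num.min r r'); have s0 : 0 < s by rewrite !lt_min t0 r0.
have os : open (ball (cmap c p) s) by exact: ball_open.
have st : ball (cmap c p) s `<=` ball (cmap c p) t by apply: le_ball; rewrite ge_min lexx.
have sr : ball (cmap c p) s `<=` ball (cmap c p) r by apply: le_ball; rewrite !ge_min lexx orbT.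
have sr' : ball (cmap c p) s `<=` ball (cmap c p) r' by apply: le_ball; rewrite !ge_min lexx !orbT.
have a1 : angle_in c (ball (cmap c p) s) w.
  by split; [exact: smooth_on_sub sr swr|move=> x /sr; exact: Hw].
have a2 : angle_in c (ball (cmap c p) s) w'.
  by split; [exact: smooth_on_sub sr' swr'|move=> x /sr'; exact: Hw'].
have [k [k1 k2 K]] := angle_shift (ad_one ad) (ad_dC ad) (ad_dS ad) os
  (@ball_convex _ _ s) (ballxx _ s0) st a1 a2.
exists (fun y => y + k); first by exists k.
by apply: (chart_near ac cp s0) => x /K.
Qed.

Lemma angle_sol_inv p w g : full_turn g -> angle_sol p w -> angle_sol p (g \o w).
Proof.
move=> [k [k1 k2 gE]] [c [V [ac cp oV Vp [Vc [sw Hw]]]]].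
exists c, V; split; [exact: ac|exact: cp|exact: oV|exact: Vp|split; first exact: Vc].
split.
  apply: (smooth_on_eq oV _ (smooth_onD oV sw (smooth_on_cst V k))) => x Vx.
  by rewrite /= gE.
by move=> x Vx; have [h1 h2] := Hw _ Vx; rewrite /= gE cosD sinD k1 k2 !mulr0 !mulr1 subr0 addr0.
Qed.

Lemma angle_sol_free p w g : full_turn g -> angle_sol p w -> germ_eq p (g \o w) w -> forall y, g y = y.
Proof.
move=> [k [_ _ gE]] _ ge y; have := nbhs_singleton ge; rewrite /= !gE => e.
have k0 : k = 0 by apply: (addrI (w p)); rewrite addr0.
by rewrite k0 addr0.
Qed.

Lemma angle_sol_exists p : exists w, angle_sol p w.
Proof.
have [c ac cp] := atlas_cover p; have [t [al [vp [t0 ad]]]] := angle_data_exists ac cp.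
have [r [w [r0 rt [sw Hw]]]] := angle_exists (ad_open ad) (ad_C ad) (ad_S ad) (ad_one ad)
  (ad_dC ad) (ad_dS ad) (ad_al ad) (ad_cl ad) (ballxx _ t0).
have rI := subset_trans rt (ad_sub ad).
have ob : open (ball (cmap c p) r) by exact: ball_open.
have E x : ball (cmap c p) r x -> w x = ((w \o cmap c) \o cinv c) x.
  by move=> /rI cx; have [e _] := cinvK ac cx; rewrite /= e.
exists (w \o cmap c), c, (ball (cmap c p) r).
split; [exact: ac|exact: cp|exact: ob|exact: ballxx|split; first exact: rI].
split; first exact: smooth_on_eq ob E sw.
by move=> x bx; rewrite -(E _ bx); exact: Hw.
Qed.

Lemma global_angle : simply_connected R S -> exists w : S -> R, smooth w /\
  forall p, cos (w p) = C p /\ sin (w p) = Sn p.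
Proof.
move=> sc; have [w Hw] : exists w, forall p, angle_sol p w.
  apply: (@rigid_global_section R S R angle_sol full_turn sc).
  - exact: locally_path_connected.
  - exact: angle_sol_open.
  - exact: angle_sol_germ.
  - exact: angle_sol_exists.
  - exact: angle_sol_rigid.
  - exact: angle_sol_inv.
  - exact: angle_sol_free.
exists w; split.
  apply: smooth_local => p; have [c [V [ac cp oV Vp [Vc [sw _]]]]] := Hw p.
  by exists c, V; split.
move=> p; have [c [V [ac cp oV Vp [Vc [_ H]]]]] := Hw p.
by have := H _ Vp; rewrite /= (cmapK ac cp).
Qed.

(** The functions w_u and w_v are first chosen pointwise; since du and dv are
    independent, w_v coincides near each point with the smooth function vp,
    whose differential is proportional to dv. *)
Lemma angle_mixed_zero w : smooth w -> (forall p, cos (w p) = C p /\ sin (w p) = Sn p) ->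
  uv_mixed_zero u v w.
Proof.
move=> sw Hw.
have loc c p : atlas c -> cdom c p -> exists r vp, [/\ 0 < r, ball (cmap c p) r `<=` cimg c,
    smooth_on (ball (cmap c p) r) vp,
    forall x, ball (cmap c p) r x -> exists mu, forall i, pd i vp x = mu * pd i (v \o cinv c) x &
    forall x, ball (cmap c p) r x -> exists l, forall i, pd i (w \o cinv c) x =
       l * pd i (u \o cinv c) x + vp x * pd i (v \o cinv c) x].
  move=> ac cp; have [r [al [vp [r0 ad]]]] := angle_data_exists ac cp.
  have aw : angle_in c (ball (cmap c p) r) w.
    by split; [exact: smooth_on_sub (ad_sub ad) (sw c ac)|move=> x _; exact: Hw].
  exists r, vp; split; [exact: r0|exact: ad_sub ad|exact: ad_vp ad|exact: ad_dvp ad|].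
  move=> x bx; have [l L] := ad_uv ad bx; exists l => i.
  exact: (etrans (angle_pd (ad_dC ad) (ad_dS ad) i (ad_open ad) (@subset_refl _ _) aw bx) (L i)).
have part p : exists lk : R * R, forall c X, atlas c -> cdom c p ->
    tdiff c w p X = lk.1 * tdiff c u p X + lk.2 * tdiff c v p X.
  have [c ac cp] := atlas_cover p; have [r [vp [r0 rI _ _ H]]] := loc c p ac cp.
  have [l L] := H _ (ballxx _ r0); exists (l, vp (cmap c p)).
  exact: (tdiff_uv sf hs ac cp (smooth_on_diff (sw c ac) (cimg_cmap cp)) L).
have [wuv Huv] := choice part.
pose wv p := (wuv p).2.
have vpE c p r (vp : V2 -> R) : atlas c -> ball (cmap c p) r `<=` cimg c ->
    (forall x, ball (cmap c p) r x -> exists l, forall i, pd i (w \o cinv c) x =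
       l * pd i (u \o cinv c) x + vp x * pd i (v \o cinv c) x) ->
    forall x, ball (cmap c p) r x -> vp x = (wv \o cinv c) x.
  move=> ac rI H x bx; have [e cx] := cinvK ac (rI _ bx); have [l L] := H _ bx.
  have K i : l * pd i (u \o cinv c) (cmap c (cinv c x)) + vp x * pd i (v \o cinv c) (cmap c (cinv c x))
      = (wuv (cinv c x)).1 * pd i (u \o cinv c) (cmap c (cinv c x))
        + wv (cinv c x) * pd i (v \o cinv c) (cmap c (cinv c x)).
    apply: etrans (Huv (cinv c x) c (basis_vec i) ac cx).
    apply: etrans (pd_tdiff w i ac (rI _ bx)); rewrite e; exact: esym (L i).
  exact: (uv_coef_unique sf hs ac cx K).2.
have swv : smooth wv.
  apply: smooth_local => p; have [c ac cp] := atlas_cover p.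
  have [r [vp [r0 rI svp _ H]]] := loc c p ac cp.
  exists c, (ball (cmap c p) r).
  split; [exact: ac|exact: cp|exact: ball_open|exact: ballxx|].
  by apply: (smooth_on_eq _ (vpE _ _ _ _ ac rI H) svp); exact: ball_open.
have part2 p : exists mu : R, forall c X, atlas c -> cdom c p ->
    tdiff c wv p X = 0 * tdiff c u p X + mu * tdiff c v p X.
  have [c ac cp] := atlas_cover p; have [r [vp [r0 rI svp dvp H]]] := loc c p ac cp.
  have [mu M] := dvp _ (ballxx _ r0); exists mu.
  apply: (tdiff_uv sf hs ac cp (smooth_on_diff (swv c ac) (cimg_cmap cp))) => i.
  rewrite mul0r add0r -(M i); apply: esym.
  apply: (pd_open_eq i _ (ballxx _ r0) (vpE _ _ _ _ ac rI H)); first exact: ball_open.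
  exact: smooth_on_diff svp (ballxx _ r0).
have [wvv Hvv] := choice part2.
exists (fun p => (wuv p).1), wv, wvv; split; first exact: swv.
  by move=> c p X; exact: Huv.
by move=> c p X; exact: Hvv.
Qed.

Lemma polar_angle : simply_connected R S -> exists w, is_polar_angle u v N Nh w.
Proof.
move=> sc; have [w [sw Hw]] := global_angle sc; exists w.
have [[_ uN _] _] := spN; have [[_ uNh _] NNh] := cpN.
split; [exact: (uv_immersion sf hs)|by split|by split|exact: sw|split].
- move=> c p X Y ac cp; have [-> ->] := Hw p; exact: CSf ac cp X Y.
- exact: NNh.
- exact: angle_mixed_zero.
Qed.

End PolarMap.

Section Complement.
Context {R : realType} {S : surface R}.
Local Notation V4 := 'rV[R]_4.

Lemma complement_polar (f : S -> V4) (h : S -> R * R) (N Nh : S -> V4) : smooth f ->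
  (forall p, frame_sol f p h) -> simply_connected R S ->
  special_section f N -> orthonormal_complement f N Nh ->
  is_polar_map (ucoord h) (vcoord h) N Nh.
Proof.
move=> sf hs sc spN cpN; have [CS H] := choice (forms_exist sf hs spN cpN).
exact: (@polar_angle _ _ f sf h hs N Nh spN cpN (fun q => (CS q).1) (fun q => (CS q).2)
  (fun c q => H q c) sc).
Qed.

(** The vectors a and b form a basis of the plane of e1 and e2, the square of
    the determinant of the change of basis being 1. *)
Lemma orthogonal_to_plane (e1 e2 n1 n2 a b w : V4) : oframe e1 e2 n1 n2 ->
  dotp a n1 = 0 -> dotp a n2 = 0 -> dotp b n1 = 0 -> dotp b n2 = 0 ->
  dotp a a = 1 -> dotp b b = 1 -> dotp a b = 0 -> dotp w a = 0 -> dotp w b = 0 ->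
  dotp w e1 = 0 /\ dotp w e2 = 0.
Proof.
move=> o a1 a2 b1 b2 aa bb ab wa wb.
have aa' := oframe_dotp a a o; have bb' := oframe_dotp b b o; have ab' := oframe_dotp a b o.
have wa' := oframe_dotp w a o; have wb' := oframe_dotp w b o.
rewrite aa a1 a2 !mul0r !addr0 in aa'; rewrite bb b1 b2 !mul0r !addr0 in bb'.
rewrite ab a1 a2 !mul0r !addr0 in ab'; rewrite wa a1 a2 !mulr0 !addr0 in wa'.
rewrite wb b1 b2 !mulr0 !addr0 in wb'.
move: aa' bb' ab' wa' wb'.
move: (dotp a e1) (dotp a e2) (dotp b e1) (dotp b e2) (dotp w e1) (dotp w e2) => p q r s x y.
move=> aa' bb' ab' wa' wb'.
have D : p * s - r * q != 0.
  apply/eqP => D0; have : (1 : R) = (p * s - r * q) * (p * s - r * q).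
    transitivity ((p * p + q * q) * (r * r + s * s) - (p * r + q * s) * (p * r + q * s)); last by ring.
    by rewrite -aa' -bb' -ab' mulr1 mul0r subr0.
  by rewrite D0 mul0r => /eqP; rewrite oner_eq0.
exact: (linear_indep_jac D (esym wa') (esym wb')).
Qed.

(** The vector product of the oriented tangent plane with N; the orientation
    given by the Gauss map makes it globally defined. *)
Lemma complement_exists (f : S -> V4) (G : S -> 'M[R]_4) (h : S -> R * R) (N : S -> V4) : smooth f ->
  (forall p, frame_sol f p h) -> is_gauss_map f G -> smooth G -> special_section f N ->
  orthonormal_complement f N (fun p => star (G p) (N p)).
Proof.
move=> sf hs [_ gm] sG [nN _]; have [sN uN pN] := nN; split; last first.
  by move=> p; have [a [b [_ ->]]] := gm p; have [_ _] := star_orth a b (N p); rewrite dotpC.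
split.
- by move=> c ac; exact: smooth_star (cimg_open ac) (sG c ac) (sN c ac).
- move=> p; have [a [b [[ta tb aa bb ab] ->]]] := gm p.
  have o := star_oframe aa bb (uN p) ab (etrans (dotpC _ _) (pN p a ta)) (etrans (dotpC _ _) (pN p b tb)).
  by have [*] := o.
- move=> p w tw; have [a [b [[ta tb aa bb ab] ->]]] := gm p.
  have [oa ob _] := star_orth a b (N p).
  have [c ac cp] := atlas_cover p.
  have [r [e1 [e2 [n1 [n2 [r0 fr]]]]]] := frame_sol_chart sf (hs p) ac cp.
  have x0 := ballxx (cmap c p) r0; have [_ _ df _] := fr; have [[_ _ _ _ ofr] _ _ _ _ _ _ _] := df.
  have tN z : tangent_plane f p z -> dotp z (n1 (cmap c p)) = 0 /\ dotp z (n2 (cmap c p)) = 0.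
    by move=> tz; apply: (tangent_frame_normal sf ac fr x0); rewrite (cmapK ac cp).
  have [a1 a2] := tN a ta; have [b1 b2] := tN b tb; have [w1 w2] := tN w tw.
  have [z1 z2] := orthogonal_to_plane (ofr _ x0) a1 a2 b1 b2 aa bb ab oa ob.
  have E := oframe_dotp (star (wedge a b) (N p)) w (ofr _ x0).
  by rewrite E z1 z2 w1 w2 !mul0r !mulr0 !addr0.
Qed.

End Complement.

Theorem proposition5 (R : realType) (S : surface R)
    (f : S -> 'rV[R]_4) (G : S -> 'M[R]_4)
    (S_simply_connected : simply_connected R S)
    (f_flat : flat_surface f)
    (f_flat_normal_bundle : flat_normal_bundle f)
    (G_gauss_map : is_gauss_map f G)
    (G_regular : immersion G) :
  exists u v : S -> R,
    immersion (fun p : S => (u p, v p)) /\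
    forall N : S -> 'rV[R]_4, special_section f N ->
      [/\ flat_map u v N,
          exists Nh : S -> 'rV[R]_4, orthonormal_complement f N Nh
        & forall Nh : S -> 'rV[R]_4, orthonormal_complement f N Nh ->
            is_polar_map u v N Nh].
Proof.
have [[sf _] _] := f_flat; have [sG _] := G_regular.
have [h hs] := global_frame sf f_flat f_flat_normal_bundle G_gauss_map G_regular S_simply_connected.
exists (ucoord h), (vcoord h); split; first exact: (uv_immersion sf hs).
move=> N spN; have cN := complement_exists sf hs G_gauss_map sG spN.
have P := complement_polar sf hs S_simply_connected spN.
by split; [exists (fun p => star (G p) (N p)); exact: P|exists (fun p => star (G p) (N p))|exact: P].
Qed.
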